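(* Let $\gamma: I\to M$ be a unit speed curve on a spacelike surface $M\subset\mathbb{R}^3_1$ such that $\|t'(s)\|\neq 0$ and $\|b'(s)\|\neq 0$ for all $s\in I$, and let $s_0\in I$. (A) Suppose that $\kappa_g(s_0)^2>\tau_g(s_0)^2$. Then: (1) $\overline{D}^T_r$ is non-singular at $s_0$ if and only if $\delta^T_r(s_0)\neq 0$; (2) the image of $\overline{D}^T_r$ is locally diffeomorphic to the ordinary cusp $C$ at $s_0$ if and only if $\delta^T_r(s_0)=0$ and $(\delta^T_r)'(s_0)\neq 0$. (B) Suppose that $\tau_g(s_0)^2>\kappa_g(s_0)^2$. Then: (1) $\overline{D}^S_r$ is non-singular at $s_0$ if and only if $\delta^S_r(s_0)\neq 0$; (2) the image of $\overline{D}^S_r$ is locally diffeomorphic to the ordinary cusp $C$ at $s_0$ if and only if $\delta^S_r(s_0)=0$ and $(\delta^S_r)'(s_0)\neq 0$. (C) Suppose that $\kappa_g(s_0)^2>\tau_g(s_0)^2$. Then: (1) $\overline{D}^L_r$ is non-singular at $s_0$ if and only if $\delta^L_r(s_0)\neq 0$; (2) the image of $\overline{D}^L_r$ is locally diffeomorphic to the ordinary cusp $C$ at $s_0$ if and only if $\delta^L_r(s_0)=0$ and $(\delta^L_r)'(s_0)\neq 0$. (D) Suppose that $(\kappa_n(s),\tau_g(s))\neq(0,0)$ for all $s\in I$. Then: (1) $\overline{D}^S_o$ is non-singular at $s_0$ if and only if $\delta^S_o(s_0)\neq 0$; (2) the image of $\overline{D}^S_o$ is locally diffeomorphic to the ordinary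 cusp $C$ at $s_0$ if and only if $\delta^S_o(s_0)=0$ and $(\delta^S_o)'(s_0)\neq 0$. (E) Suppose that $(\kappa_n(s),\tau_g(s))\neq(0,0)$ for all $s\in I$. Then: (1) $\overline{D}^L_o$ is non-singular at $s_0$ if and only if $\delta^L_o(s_0)\neq 0$; (2) the image of $\overline{D}^L_o$ is locally diffeomorphic to the ordinary cusp $C$ at $s_0$ if and only if $\delta^L_o(s_0)=0$ and $(\delta^L_o)'(s_0)\neq 0$.
   Context: All maps are $C^\infty$ and $I\subset\mathbb{R}$ is an open interval. $\mathbb{R}^3_1$ is $\mathbb{R}^3$ with $\langle x,y\rangle=-x_0y_0+x_1y_1+x_2y_2$, and $\|x\|=\sqrt{|\langle x,x\rangle|}$. A non-zero $x$ is spacelike, lightlike or timelike if $\langle x,x\rangle$ is $>0$, $=0$, $<0$ respectively. Put $H^2(-1)=\{x:\langle x,x\rangle=-1\}$, $S^2_1=\{x:\langle x,x\rangle=1\}$, $LC^*=\{x\neq 0:\langle x,x\rangle=0\}$. For $a,b\in\mathbb{R}^3_1$, $a\wedge b$ is the formal determinant with rows $(-e_0,e_1,e_2)$, $(a_0,a_1,a_2)$, $(b_0,b_1,b_2)$, where $\{e_0,e_1,e_2\}$ is the canonical basis. A spacelike surface is $M=X(U)$ with $U\subset\mathbb{R}^2$ open and $X:U\to\mathbb{R}^3_1$ an embedding all of whose tangent planes consist of spacelike vectors. Its unit timelike normal is $n=X_{u_1}\wedge X_{u_2}/\|X_{u_1}\wedge X_{u_2}\|$, with the orientation of $M$ chosen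 so that $n$ is future directed ($\langle n,e_0\rangle<0$). A curve on $M$ is $\gamma=X\circ\bar\gamma$ with $\bar\gamma:I\to U$ a regular curve, parametrized by arc-length $s$ (unit speed). Put $t=\gamma'$, $n_\gamma=n\circ\gamma$, $b=t\wedge n_\gamma$; $\{t,n_\gamma,b\}$ is the Lorentzian Darboux frame, with $\langle t,t\rangle=\langle b,b\rangle=1$, $\langle n_\gamma,n_\gamma\rangle=-1$ and mutually orthogonal. It satisfies $t'=\kappa_n n_\gamma+\kappa_g b$, $n_\gamma'=\kappa_n t+\tau_g b$, $b'=-\kappa_g t+\tau_g n_\gamma$, where $\kappa_n=-\langle t',n_\gamma\rangle$, $\kappa_g=\langle t',b\rangle$, $\tau_g=-\langle b',n_\gamma\rangle$. Define, wherever the indicated condition holds: - if $\kappa_g^2>\tau_g^2$: $\overline{D}^T_r=\dfrac{\tau_g t-\kappa_g n_\gamma}{\sqrt{\kappa_g^2-\tau_g^2}}\in H^2(-1)$, $\overline{D}^L_r=\dfrac{\tau_g t-\kappa_g n_\gamma}{\sqrt{\kappa_g^2-\tau_g^2}}+b\in LC^*$, $\delta^T_r=\kappa_n-\dfrac{\kappa_g\tau_g'-\kappa_g'\tau_g}{\kappa_g^2-\tau_g^2}$, $\delta^L_r=\kappa_n-\dfrac{\kappa_g\tau_g'-\kappa_g'\tau_g}{\kappa_g^2-\tau_g^2}+\sqrt{\kappa_g^2-\tau_g^2}$; - if $\tau_g^2>\kappa_g^2$: $\overline{D}^S_r=\dfrac{\tau_g t-\kappa_g n_\gamma}{\sqrt{\tau_g^2-\kappa_g^2}}\in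 S^2_1$, $\delta^S_r=\kappa_n+\dfrac{\kappa_g\tau_g'-\kappa_g'\tau_g}{\tau_g^2-\kappa_g^2}$; - if $(\kappa_n,\tau_g)\neq(0,0)$: $\overline{D}^S_o=\dfrac{\tau_g t-\kappa_n b}{\sqrt{\kappa_n^2+\tau_g^2}}\in S^2_1$, $\overline{D}^L_o=\dfrac{\tau_g t-\kappa_n b}{\sqrt{\kappa_n^2+\tau_g^2}}+n_\gamma\in LC^*$, $\delta^S_o=\kappa_g+\dfrac{\kappa_n\tau_g'-\kappa_n'\tau_g}{\kappa_n^2+\tau_g^2}$, $\delta^L_o=\kappa_g+\dfrac{\kappa_n\tau_g'-\kappa_n'\tau_g}{\kappa_n^2+\tau_g^2}+\sqrt{\kappa_n^2+\tau_g^2}$. A curve $D$ is non-singular at $s_0$ if $D'(s_0)\neq 0$. The ordinary cusp is $C=\{(x_1,x_2)\in\mathbb{R}^2: x_1^2=x_2^3\}$. For a curve $D$ in a surface $S$ (here $S=H^2(-1)$, $S^2_1$ or $LC^*$), ''the image of $D$ is locally diffeomorphic to $C$ at $s_0$'' means that for all sufficiently small open intervals $J\ni s_0$ there is a diffeomorphism from a neighbourhood of $D(s_0)$ in $S$ to a neighbourhood of $0$ in $\mathbb{R}^2$ sending $D(s_0)$ to $0$ and the germ of $D(J)$ at $D(s_0)$ onto the germ of $C$ at $0$. *)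

(* Defs.v *)
From HB Require Import structures.
From mathcomp Require Import all_boot all_order all_algebra.
From mathcomp Require Import all_classical all_reals all_analysis.

Set Implicit Arguments.
Unset Strict Implicit.
Unset Printing Implicit Defensive.
Import Order.TTheory GRing.Theory Num.Theory.
Import numFieldNormedType.Exports.
Local Open Scope ring_scope.
Local Open Scope classical_set_scope.

Fixpoint Ck_on (R : realType) (V W : normedModType R) (k : nat)
    (A : set V) (f : V -> W) : Prop :=
  match k with
  | 0 => forall x, A x -> {for x, continuous f}
  | k'.+1 => (forall x, A x -> differentiable f x) /\
             (forall v : V, Ck_on k' A ('D_v f))
  end.

(* Meant for open sets A. *)
Definition smooth_on_open (R : realType) (V W : normedModType R)
    (A : set V) (f : V -> W) : Prop :=
  forall k, Ck_on k A f.

(* A need not be open: f is smooth on A when it has smooth local extensions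
   to open subsets of the ambient space.  For A open in an embedded surface
   this is the usual notion of a smooth map on the surface. *)
Definition smooth_on (R : realType) (V W : normedModType R)
    (A : set V) (f : V -> W) : Prop :=
  forall x, A x -> exists (O : set V) (g : V -> W),
    [/\ open O, O x, smooth_on_open O g &
        forall y, A y -> O y -> g y = f y].

Definition diffeomorphism (R : realType) (V W : normedModType R)
    (A : set V) (B : set W) (f : V -> W) : Prop :=
  [/\ smooth_on A f,
      forall x, A x -> B (f x) &
      exists g : W -> V,
        [/\ smooth_on B g,
            forall y, B y -> A (g y),
            forall x, A x -> g (f x) = x &
            forall y, B y -> f (g y) = y]].

Definition open_interval (R : realType) (I : set R) : Prop :=
  open I /\ is_interval I.

Definition vec3 (R : realType) (x y z : R) : 'rV[R]_3 :=
  \row_(j < 3) nth 0 [:: x; y; z] j.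

Definition mink (R : realType) (x y : 'rV[R]_3) : R :=
  - (x 0 0 * y 0 0) + x 0 1 * y 0 1 + x 0 2 * y 0 2.

Definition mnorm (R : realType) (x : 'rV[R]_3) : R :=
  Num.sqrt `|mink x x|.

Definition spacelike (R : realType) (x : 'rV[R]_3) : Prop :=
  x <> 0 /\ 0 < mink x x.

(* Expansion along the first row of the formal determinant with rows
   (-e_0, e_1, e_2), (a_0, a_1, a_2), (b_0, b_1, b_2). *)
Definition wedge (R : realType) (a b : 'rV[R]_3) : 'rV[R]_3 :=
  vec3 (- (a 0 1 * b 0 2 - a 0 2 * b 0 1))
       (- (a 0 0 * b 0 2 - a 0 2 * b 0 0))
       (a 0 0 * b 0 1 - a 0 1 * b 0 0).

Definition H2 (R : realType) : set 'rV[R]_3 := [set x | mink x x = -1].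
Definition S21 (R : realType) : set 'rV[R]_3 := [set x | mink x x = 1].
Definition LCstar (R : realType) : set 'rV[R]_3 :=
  [set x | x <> 0 /\ mink x x = 0].

Definition embedding (R : realType) (U : set 'rV[R]_2)
    (X : 'rV[R]_2 -> 'rV[R]_3) : Prop :=
  [/\ smooth_on_open U X,
      forall u v, U u -> U v -> X u = X v -> u = v,
      forall u v, U u -> v <> 0 -> 'D_v X u <> 0 &
      forall A : set 'rV[R]_2, open A -> A `<=` U ->
        exists2 O : set 'rV[R]_3, open O & X @` A = X @` U `&` O].

Definition spacelike_surface (R : realType) (U : set 'rV[R]_2)
    (X : 'rV[R]_2 -> 'rV[R]_3) : Prop :=
  [/\ open U,
      embedding U X &
      forall u v, U u -> v <> 0 -> spacelike ('D_v X u)].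

(* The future-directed unit normal: the sign of X_{u1} /\ X_{u2} is adjusted
   pointwise, so that no assumption on the orientation of X is needed. *)
Definition unit_normal (R : realType) (X : 'rV[R]_2 -> 'rV[R]_3)
    (u : 'rV[R]_2) : 'rV[R]_3 :=
  let w := wedge ('D_(delta_mx 0 0) X u) ('D_(delta_mx 0 1) X u) in
  let n := (mnorm w)^-1 *: w in
  if mink n (delta_mx 0 0) < 0 then n else - n.

(* A curve on X(U) is given by its expression c in the parameter domain;
   the curve itself is X \o c. *)
Definition curve_in (R : realType) (U : set 'rV[R]_2) (I : set R)
    (c : R -> 'rV[R]_2) : Prop :=
  [/\ smooth_on_open I c,
      forall s, I s -> U (c s) &
      forall s, I s -> derive1 c s <> 0].

Definition darboux_t (R : realType) (X : 'rV[R]_2 -> 'rV[R]_3)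
    (c : R -> 'rV[R]_2) : R -> 'rV[R]_3 := derive1 (X \o c).

Definition darboux_n (R : realType) (X : 'rV[R]_2 -> 'rV[R]_3)
    (c : R -> 'rV[R]_2) : R -> 'rV[R]_3 := unit_normal X \o c.

Definition darboux_b (R : realType) (X : 'rV[R]_2 -> 'rV[R]_3)
    (c : R -> 'rV[R]_2) (s : R) : 'rV[R]_3 :=
  wedge (darboux_t X c s) (darboux_n X c s).

Definition kappa_n (R : realType) (X : 'rV[R]_2 -> 'rV[R]_3)
    (c : R -> 'rV[R]_2) (s : R) : R :=
  - mink (derive1 (darboux_t X c) s) (darboux_n X c s).

Definition kappa_g (R : realType) (X : 'rV[R]_2 -> 'rV[R]_3)
    (c : R -> 'rV[R]_2) (s : R) : R :=
  mink (derive1 (darboux_t X c) s) (darboux_b X c s).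

Definition tau_g (R : realType) (X : 'rV[R]_2 -> 'rV[R]_3)
    (c : R -> 'rV[R]_2) (s : R) : R :=
  - mink (derive1 (darboux_b X c) s) (darboux_n X c s).

(* The curves D and the invariants delta are total functions of s, meaningful
   only where the quantity under the square root is positive. *)
Definition DTr (R : realType) (X : 'rV[R]_2 -> 'rV[R]_3)
    (c : R -> 'rV[R]_2) (s : R) : 'rV[R]_3 :=
  (Num.sqrt (kappa_g X c s ^+ 2 - tau_g X c s ^+ 2))^-1 *:
    (tau_g X c s *: darboux_t X c s - kappa_g X c s *: darboux_n X c s).

Definition DLr (R : realType) (X : 'rV[R]_2 -> 'rV[R]_3)
    (c : R -> 'rV[R]_2) (s : R) : 'rV[R]_3 :=
  (Num.sqrt (kappa_g X c s ^+ 2 - tau_g X c s ^+ 2))^-1 *: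
    (tau_g X c s *: darboux_t X c s - kappa_g X c s *: darboux_n X c s)
  + darboux_b X c s.

Definition deltaTr (R : realType) (X : 'rV[R]_2 -> 'rV[R]_3)
    (c : R -> 'rV[R]_2) (s : R) : R :=
  kappa_n X c s -
  (kappa_g X c s * derive1 (tau_g X c) s - derive1 (kappa_g X c) s * tau_g X c s) /
  (kappa_g X c s ^+ 2 - tau_g X c s ^+ 2).

Definition deltaLr (R : realType) (X : 'rV[R]_2 -> 'rV[R]_3)
    (c : R -> 'rV[R]_2) (s : R) : R :=
  kappa_n X c s -
  (kappa_g X c s * derive1 (tau_g X c) s - derive1 (kappa_g X c) s * tau_g X c s) /
  (kappa_g X c s ^+ 2 - tau_g X c s ^+ 2) +
  Num.sqrt (kappa_g X c s ^+ 2 - tau_g X c s ^+ 2).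

Definition DSr (R : realType) (X : 'rV[R]_2 -> 'rV[R]_3)
    (c : R -> 'rV[R]_2) (s : R) : 'rV[R]_3 :=
  (Num.sqrt (tau_g X c s ^+ 2 - kappa_g X c s ^+ 2))^-1 *:
    (tau_g X c s *: darboux_t X c s - kappa_g X c s *: darboux_n X c s).

Definition deltaSr (R : realType) (X : 'rV[R]_2 -> 'rV[R]_3)
    (c : R -> 'rV[R]_2) (s : R) : R :=
  kappa_n X c s +
  (kappa_g X c s * derive1 (tau_g X c) s - derive1 (kappa_g X c) s * tau_g X c s) /
  (tau_g X c s ^+ 2 - kappa_g X c s ^+ 2).

Definition DSo (R : realType) (X : 'rV[R]_2 -> 'rV[R]_3)
    (c : R -> 'rV[R]_2) (s : R) : 'rV[R]_3 :=
  (Num.sqrt (kappa_n X c s ^+ 2 + tau_g X c s ^+ 2))^-1 *: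
    (tau_g X c s *: darboux_t X c s - kappa_n X c s *: darboux_b X c s).

Definition DLo (R : realType) (X : 'rV[R]_2 -> 'rV[R]_3)
    (c : R -> 'rV[R]_2) (s : R) : 'rV[R]_3 :=
  (Num.sqrt (kappa_n X c s ^+ 2 + tau_g X c s ^+ 2))^-1 *:
    (tau_g X c s *: darboux_t X c s - kappa_n X c s *: darboux_b X c s)
  + darboux_n X c s.

Definition deltaSo (R : realType) (X : 'rV[R]_2 -> 'rV[R]_3)
    (c : R -> 'rV[R]_2) (s : R) : R :=
  kappa_g X c s +
  (kappa_n X c s * derive1 (tau_g X c) s - derive1 (kappa_n X c) s * tau_g X c s) /
  (kappa_n X c s ^+ 2 + tau_g X c s ^+ 2).

Definition deltaLo (R : realType) (X : 'rV[R]_2 -> 'rV[R]_3)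
    (c : R -> 'rV[R]_2) (s : R) : R :=
  kappa_g X c s +
  (kappa_n X c s * derive1 (tau_g X c) s - derive1 (kappa_n X c) s * tau_g X c s) /
  (kappa_n X c s ^+ 2 + tau_g X c s ^+ 2) +
  Num.sqrt (kappa_n X c s ^+ 2 + tau_g X c s ^+ 2).

Definition nonsingular_at (R : realType) (D : R -> 'rV[R]_3) (s0 : R) : Prop :=
  derive1 D s0 <> 0.

Definition cusp (R : realType) : set 'rV[R]_2 :=
  [set x | x 0 0 ^+ 2 = x 0 1 ^+ 3].

(* The neighbourhoods in S and in the plane are taken open; S `&` O is the
   neighbourhood of D s0 in S.  The last clause says that phi sends the germ
   of D(J) at D s0 onto the germ of the cusp at 0. *)
Definition locally_diffeo_to_cusp (R : realType) (I : set R)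
    (S : set 'rV[R]_3) (D : R -> 'rV[R]_3) (s0 : R) : Prop :=
  exists2 e : R, 0 < e &
    forall J : set R, open_interval J -> J s0 ->
      J `<=` I `&` [set s | `|s - s0| < e] ->
      exists (O : set 'rV[R]_3) (W : set 'rV[R]_2) (phi : 'rV[R]_3 -> 'rV[R]_2),
        [/\ open O /\ (S `&` O) (D s0),
            open W /\ W 0,
            diffeomorphism (S `&` O) W phi,
            phi (D s0) = 0 &
            \forall y \near (0 : 'rV[R]_2),
              (phi @` (D @` J `&` (S `&` O))) y <-> cusp y].

(* Main.v *)
(** In each case the curve [D] belongs to a moving frame [D, T, B] of the Lorentz
    space, obtained from the Darboux frame by a circular or hyperbolic rotation,
    with [D' = delta T] and [B' = rho T], [rho <> 0]; on the light cone the curve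
    is [D + B], with derivative [(delta + rho) T].  So the curve is regular where
    [delta <> 0], and because of [rho <> 0] it is a front: at a zero of [delta]
    the direction [T] turns with nonzero speed inside the tangent plane of the
    surface.  In a chart of the surface the curve becomes a planar front [E] with
    [E' = delta V] and [V, V'] independent at the zeros of [delta].

    If [delta(s0) = 0] and [delta'(s0) <> 0], the front has 2-jet [(s^2, 0)] and a
    nonzero [s^3] term in the second coordinate.  After a change of parameter it
    is [(t^2, c(t))], and Whitney's theorem on even functions, proved by means of
    the lemmas of Hadamard and Borel, writes [c(t) = g(t^2) + t^3 k(t^2)] with
    [g], [k] smooth and [k(0) <> 0]; hence [(x, y) |-> ((y - g x) / k x, x)] maps
    it onto the cusp.  Conversely, if a front [E = (p, q)] satisfies [p^2 = q^3],
    its velocity vanishes at the origin, and differentiating [p^2 = q^3] where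
    [delta <> 0] forces [delta'(s0) <> 0] unless [delta] vanishes near [s0], in
    which case the image is a point. *)

From HB Require Import structures.
Require Import Defs.
From mathcomp Require Import all_boot all_order all_algebra.
From mathcomp Require Import all_classical all_reals all_analysis.
From mathcomp Require Import ring lra.
Set Implicit Arguments.
Unset Strict Implicit.
Unset Printing Implicit Defensive.
Import Order.TTheory GRing.Theory Num.Theory.
Import numFieldNormedType.Exports.
Local Open Scope ring_scope.
Local Open Scope classical_set_scope.

(** * Calculus of C^k maps *)

(** Being a cusp is a property of the image germ alone: the converse gives no parametrization to
    compare jets with, only the equation [p ^ 2 = q ^ 3]. The front condition survives the unknown
    diffeomorphism because the curve is stationary at a zero of [delta]: the Jacobian does not vary
    there to first order, and the determinant of [V, V'] is merely multiplied by it. The charts are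
    restrictions of affine maps [x |-> (<x, m1> - k1, <x, m2> - k2)], with [m1], [m2] read off from
    the frame at [s0], and their inverses are explicit: a square root on the quadrics, a rational
    map on the cone. The velocity in the chart is then [delta] times [(<T, m1>, <T, m2>)], and [T']
    has to pair nontrivially with [m2]. On a quadric [m2] is a multiple of [B], and [B' = rho T]
    suffices; on the cone it is a multiple of the null vector [D - B], and at a zero of
    [delta + rho] the two contributions to the pairing add up instead of cancelling. Borel's lemma
    enters because [f o sqrt] lives on a half line only, whereas the straightening map of the plane
    has to be smooth on both sides of the origin. *)

Lemma near_eq_differentiable (R : realType) (V W : normedModType R)
    (f g : V -> W) (x : V) :
  (\near x, f x = g x) -> differentiable f x -> differentiable g x.
Proof.
move=> fg df.
have fgx : f x = g x := nbhs_singleton fg.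
have gE : g \o shift x = cst (g x) + 'd f x +o_ 0 id.
  apply/eqaddoP => e e0.
  have /eqaddoP /(_ _ e0) H := diff_locally df.
  have H2 : \forall y \near (0 : V), f (y + x) = g (y + x).
    by move: fg; rewrite (near_shift 0 x) /= subr0.
  near=> y.
  have -> : (g \o shift x - (cst (g x) + 'd f x)) y =
            (f \o shift x - (cst (f x) + 'd f x)) y.
    rewrite /= !fctE /= fgx; congr (_ - _).
    by symmetry; near: y.
  by near: y.
have dgE : 'd g x = 'd f x :> (V -> W) by apply: diff_unique => //; apply: diff_continuous.
apply/diff_locallyP; rewrite dgE; split => //; exact: diff_continuous.
Unshelve. all: by end_near. Qed.

Section Ck.
Context {R : realType}.
Implicit Types (V W Z : normedModType R).

Lemma Ck_on_sub V W k (A B : set V) (f : V -> W) :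
  B `<=` A -> Ck_on k A f -> Ck_on k B f.
Proof.
move=> BA; elim: k f => [|k IH] f /=; first by move=> H x /BA; apply: H.
by move=> [H1 H2]; split=> [x /BA|v]; [apply: H1|apply/IH/H2].
Qed.

Lemma Ck_onW V W k (A : set V) (f : V -> W) : Ck_on k.+1 A f -> Ck_on k A f.
Proof.
elim: k f => [|k IH] f /=.
  by move=> [H _] x Ax; apply/differentiable_continuous/H.
by move=> [H1 H2]; split=> // v; apply: IH; exact: H2.
Qed.

(** Derivative formulas such as the product rule hold only on [A], so each induction on [k] has to
    exchange a function for one equal to it on [A]. Openness turns this into equality near each
    point, which ['D_v] respects. *)
Lemma Ck_on_eq V W k (A : set V) (f g : V -> W) :
  open A -> (forall x, A x -> f x = g x) -> Ck_on k A f -> Ck_on k A g.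
Proof.
move=> oA; have nearA x (P : V -> Prop) : A x -> (forall y, A y -> P y) -> \near x, P x.
  by move=> Ax H; apply: (filterS H); exact: open_nbhs_nbhs.
elim: k f g => [|k IH] f g fg /=.
  move=> H x Ax; have fgx := fg _ Ax.
  have := H _ Ax; rewrite /prop_for /continuous_at -fgx.
  by apply: cvg_trans; apply: near_eq_cvg; exact: nearA.
move=> [H1 H2]; split.
  by move=> x Ax; apply: near_eq_differentiable (H1 _ Ax); exact: nearA.
move=> v; apply: IH (H2 v) => x Ax.
by apply: near_eq_derive; exact: nearA.
Qed.

Lemma Ck_on_local V W k (A : set V) (f : V -> W) :
  (forall x, A x -> exists2 B : set V, B x & Ck_on k B f) -> Ck_on k A f.
Proof.
elim: k f => [|k IH] f H /=; first by move=> x /H [B Bx]; apply.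
split=> [x /H [B Bx [HB _]]|v]; first exact: (HB _ Bx).
by apply: IH => x /H [B Bx [_ HB]]; exists B => //; exact: HB.
Qed.

Lemma Ck_on_cst V W k (A : set V) (w : W) : Ck_on k A (fun=> w).
Proof.
elim: k w => [|k IH] w /=; first by move=> x _; exact: cst_continuous.
split=> [x _|v]; first exact: differentiable_cst.
rewrite (_ : 'D_v _ = fun=> 0); first exact: IH.
by apply/funext => x; exact: derive_cst.
Qed.

Lemma linear_is_diff V W (l : V -> W) (x : V) :
  linear l -> continuous l -> is_diff x l l.
Proof.
move=> ll cl; pose lM := GRing.isLinear.Build _ _ _ _ l ll.
pose lL : {linear V -> W} := HB.pack l lM.
apply: DiffDef; first exact: (@linear_differentiable _ _ _ lL).
exact: (@diff_lin _ _ _ lL).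
Qed.

Lemma Ck_on_lin V W k (A : set V) (l : V -> W) :
  linear l -> continuous l -> Ck_on k A l.
Proof.
move=> ll cl; case: k => [|k] /=; first by move=> x _; exact: cl.
have H x := linear_is_diff x ll cl.
split=> [x _|v]; first by have [] := H x.
rewrite (_ : 'D_v _ = fun=> l v); first exact: Ck_on_cst.
by apply/funext => x; have [dl dlE] := H x; rewrite deriveE // dlE.
Qed.

Lemma Ck_onD V W k (A : set V) (f g : V -> W) : open A ->
  Ck_on k A f -> Ck_on k A g -> Ck_on k A (fun x => f x + g x).
Proof.
move=> oA; elim: k f g => [|k IH] f g /=.
  by move=> H1 H2 x Ax; apply: continuousD; [exact: H1|exact: H2].
move=> [H1 H2] [H3 H4]; split=> [x Ax|v].
  by apply: differentiableD; [exact: (H1 _ Ax)|exact: (H3 _ Ax)].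
apply: (@Ck_on_eq _ _ _ _ (fun x => 'D_v f x + 'D_v g x)) => //.
  move=> x Ax; rewrite deriveD //; apply: diff_derivable; auto.
exact: IH.
Qed.

Lemma differentiable_lincomp V W Z (f : V -> W) (l : W -> Z) x v :
  linear l -> continuous l -> differentiable f x ->
  differentiable (l \o f) x /\ 'D_v (l \o f) x = l ('D_v f x).
Proof.
move=> ll cl df; have [dl dlE] := linear_is_diff (f x) ll cl.
have dc : differentiable (l \o f) x by exact: differentiable_comp.
by split => //; rewrite !deriveE// diff_comp//= dlE.
Qed.

Lemma Ck_on_lincomp V W Z k (A : set V) (f : V -> W) (l : W -> Z) :
  open A -> linear l -> continuous l -> Ck_on k A f ->
  Ck_on k A (fun x => l (f x)).
Proof.
move=> oA ll cl; elim: k f => [|k IH] f /=.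
  by move=> H x Ax; apply: (@continuous_comp _ _ _ f l); [exact: H|exact: cl].
have H x v := @differentiable_lincomp _ _ _ f _ x v ll cl.
move=> [H1 H2]; split=> [x Ax|v].
  by have [] := H x 0 (H1 _ Ax).
apply: (@Ck_on_eq _ _ _ _ (fun x => l ('D_v f x))) => //.
  by move=> x Ax; have [_ ->] := H x v (H1 _ Ax).
exact: IH.
Qed.

Lemma Ck_onM V k (A : set V) (f g : V -> R) : open A ->
  Ck_on k A f -> Ck_on k A g -> Ck_on k A (fun x => f x * g x).
Proof.
move=> oA; elim: k f g => [|k IH] f g.
  by move=> /= H1 H2 x Ax; apply: continuousM; [exact: H1|exact: H2].
move=> Hf Hg; have [H1 H2] := Hf; have [H3 H4] := Hg; split=> [x Ax|v].
  by apply: differentiableM; [exact: (H1 _ Ax)|exact: (H3 _ Ax)].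
apply: (@Ck_on_eq _ _ _ _ (fun x => f x * 'D_v g x + g x * 'D_v f x)) => //.
  move=> x Ax; rewrite deriveM //; apply: diff_derivable; auto.
by apply: Ck_onD => //; apply: IH; [exact: Ck_onW|exact: H4|exact: Ck_onW|exact: H2].
Qed.

Lemma Ck_on_sum V W k (A : set V) n (f : 'I_n -> V -> W) : open A ->
  (forall i, Ck_on k A (f i)) -> Ck_on k A (fun x => \sum_(i < n) f i x).
Proof.
move=> oA; elim: n f => [|n IH] f H.
  by apply: Ck_on_eq (@Ck_on_cst _ _ _ _ 0) => // x _; rewrite big_ord0.
apply: (@Ck_on_eq _ _ _ _ (fun x => \sum_(i < n) f (widen_ord (leqnSn n) i) x + f ord_max x)) => //.
  by move=> x _; rewrite big_ord_recr.
by apply: Ck_onD => //; exact: IH.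
Qed.

(** The chain rule differentiates [g] in the moving direction ['D_v f x], whereas [Ck_on] controls
    fixed directions only; a basis of the middle space reduces the former to the latter. *)
Lemma derive_comp_basis V W n (e : 'I_n -> W) (l : 'I_n -> W -> R)
    (f : V -> W) (g : W -> R) x v :
  (forall w, w = \sum_(i < n) l i w *: e i) ->
  differentiable f x -> differentiable g (f x) ->
  differentiable (g \o f) x /\
  'D_v (g \o f) x = \sum_(i < n) l i ('D_v f x) * 'D_(e i) g (f x).
Proof.
move=> le df dg; have dc : differentiable (g \o f) x by exact: differentiable_comp.
split => //; rewrite !deriveE// diff_comp//= [in LHS](le ('d f x v)) linear_sum.
by apply: eq_bigr => i _; rewrite linearZ deriveE.
Qed.

(** The abstract basis covers both row vectors and the line itself, with basis [1]. *)
Lemma Ck_on_comp_basis V W n (e : 'I_n -> W) (l : 'I_n -> W -> R) k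
    (A : set V) (B : set W) (f : V -> W) (g : W -> R) :
  (forall w, w = \sum_(i < n) l i w *: e i) ->
  (forall i, linear (l i)) -> (forall i, continuous (l i)) ->
  open A -> (forall x, A x -> B (f x)) ->
  Ck_on k A f -> Ck_on k B g -> Ck_on k A (g \o f).
Proof.
move=> le ll cl oA AB; elim: k g => [|k IH] g.
  move=> /= H1 H2 x Ax; apply: continuous_comp; first exact: H1.
  by apply: H2; exact: AB.
move=> Hf Hg; have [H1 H2] := Hf; have [H3 H4] := Hg.
have H x v (Ax : A x) := @derive_comp_basis _ _ _ _ _ _ _ x v le (H1 _ Ax) (H3 _ (AB _ Ax)).
split=> [x Ax|v]; first by have [] := H x 0 Ax.
apply: (@Ck_on_eq _ _ _ _ (fun x => \sum_(i < n) l i ('D_v f x) * ('D_(e i) g \o f) x)) => //.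
  by move=> x Ax; have [_ ->] := H x v Ax.
apply: Ck_on_sum => // i; apply: Ck_onM => //.
  by apply: (@Ck_on_lincomp _ _ _ _ _ ('D_v f) (l i)); [|exact: ll|exact: cl|exact: H2].
by apply: IH; [exact: Ck_onW|exact: H4].
Qed.

Lemma row_basis n (w : 'rV[R]_n) : w = \sum_(i < n) w 0 i *: delta_mx 0 i.
Proof. exact: row_sum_delta. Qed.

Lemma coord_linear n (i : 'I_n) : linear (fun w : 'rV[R]_n => w 0 i : R).
Proof. by move=> a u v; rewrite !mxE. Qed.

Lemma scale_linear V (w : V) : linear (fun a : R => a *: w).
Proof. by move=> a u v; rewrite scalerDl scalerA. Qed.

Lemma Ck_on_comp_row V n k (A : set V) (B : set 'rV[R]_n) (f : V -> 'rV[R]_n)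
    (g : 'rV[R]_n -> R) : open A -> (forall x, A x -> B (f x)) ->
  Ck_on k A f -> Ck_on k B g -> Ck_on k A (fun x => g (f x)).
Proof.
apply: (@Ck_on_comp_basis _ _ _ (fun i => delta_mx 0 i) (fun i w => w 0 i)).
- exact: row_basis.
- by move=> i; exact: coord_linear.
- by move=> i; exact: coord_continuous.
Qed.

Lemma Ck_on_comp V k (A : set V) (B : set R) (f : V -> R)
    (g : R -> R) : open A -> (forall x, A x -> B (f x)) ->
  Ck_on k A f -> Ck_on k B g -> Ck_on k A (fun x => g (f x)).
Proof.
apply: (@Ck_on_comp_basis _ R^o 1 (fun i => 1) (fun i w => w)).
- by move=> w; rewrite big_ord1 /GRing.scale /= mulr1.
- by move=> i a u v.
- by move=> i x; exact: cvg_id.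
Qed.

Lemma Ck_on_row V n k (A : set V) (f : V -> 'rV[R]_n) : open A ->
  Ck_on k A f <-> forall i, Ck_on k A (fun x => f x 0 i).
Proof.
move=> oA; split=> [H i|H].
  apply: (@Ck_on_lincomp _ _ _ _ _ f (fun w => w 0 i)) => //.
  - exact: coord_linear.
  - exact: coord_continuous.
apply: (@Ck_on_eq _ _ _ _ (fun x => \sum_(i < n) f x 0 i *: delta_mx 0 i)) => //.
  by move=> x _; rewrite -row_basis.
apply: Ck_on_sum => // i.
apply: (@Ck_on_lincomp _ _ _ _ _ (fun x => f x 0 i) (fun a => a *: delta_mx 0 i)) => //.
- exact: scale_linear.
- exact: scalel_continuous.
Qed.

End Ck.

Section Smooth.
Context {R : realType}.
Implicit Types (V W Z : normedModType R).
Local Notation smooth := smooth_on_open.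

Lemma smooth_Ck V W k (A : set V) (f : V -> W) : smooth A f -> Ck_on k A f.
Proof. by move=> H; exact: H. Qed.

Lemma smooth_sub V W (A B : set V) (f : V -> W) :
  B `<=` A -> smooth A f -> smooth B f.
Proof. by move=> BA H k; apply: Ck_on_sub (H k). Qed.

Lemma smooth_eq V W (A : set V) (f g : V -> W) :
  open A -> (forall x, A x -> f x = g x) -> smooth A f -> smooth A g.
Proof. by move=> oA fg H k; apply: Ck_on_eq (H k). Qed.

Lemma smooth_local V W (A : set V) (f : V -> W) :
  (forall x, A x -> exists2 B : set V, B x & smooth B f) -> smooth A f.
Proof.
by move=> H k; apply: Ck_on_local => x /H [B Bx HB]; exists B => //; exact: HB.
Qed.

Lemma smooth_cst V W (A : set V) (w : W) : smooth A (fun=> w).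
Proof. by move=> k; exact: Ck_on_cst. Qed.

Lemma smooth_lin V W (A : set V) (l : V -> W) :
  linear l -> continuous l -> smooth A l.
Proof. by move=> ll cl k; exact: Ck_on_lin. Qed.

Lemma smooth_id V (A : set V) : smooth A id.
Proof. by apply: smooth_lin => // x; exact: cvg_id. Qed.

Lemma smooth_coord n (A : set 'rV[R]_n) i : smooth A (fun w => w 0 i).
Proof. by apply: smooth_lin; [exact: coord_linear|exact: coord_continuous]. Qed.

Lemma smoothD V W (A : set V) (f g : V -> W) : open A ->
  smooth A f -> smooth A g -> smooth A (fun x => f x + g x).
Proof. by move=> oA Hf Hg k; exact: Ck_onD. Qed.

Lemma smoothM V (A : set V) (f g : V -> R) : open A ->
  smooth A f -> smooth A g -> smooth A (fun x => f x * g x).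
Proof. by move=> oA Hf Hg k; exact: Ck_onM. Qed.

Lemma smoothN V (A : set V) (f : V -> R) : open A ->
  smooth A f -> smooth A (fun x => - f x).
Proof.
move=> oA Hf; apply: (@smooth_eq _ _ _ (fun x => -1 * f x)) => //.
  by move=> x _; rewrite mulN1r.
by apply: smoothM => //; exact: smooth_cst.
Qed.

Lemma smoothB V (A : set V) (f g : V -> R) : open A ->
  smooth A f -> smooth A g -> smooth A (fun x => f x - g x).
Proof. by move=> oA Hf Hg; apply: smoothD => //; exact: smoothN. Qed.

Lemma smoothX V (A : set V) (f : V -> R) n : open A ->
  smooth A f -> smooth A (fun x => f x ^+ n).
Proof.
move=> oA Hf; elim: n => [|n IH].
  by apply: (smooth_eq oA _ (smooth_cst A (1 : R))) => x _; rewrite expr0.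
apply: (@smooth_eq _ _ _ (fun x => f x * f x ^+ n)) => //.
  by move=> x _; rewrite exprS.
exact: smoothM.
Qed.

Lemma smooth_row V n (A : set V) (f : V -> 'rV[R]_n) : open A ->
  smooth A f <-> forall i, smooth A (fun x => f x 0 i).
Proof.
move=> oA; split=> [H i k|H k].
  exact: (proj1 (Ck_on_row _ _ oA) (H k)).
by apply/Ck_on_row => // i; exact: H.
Qed.

Lemma smoothZ V n (A : set V) (f : V -> R) (g : V -> 'rV[R]_n) : open A ->
  smooth A f -> smooth A g -> smooth A (fun x => f x *: g x).
Proof.
move=> oA Hf Hg; apply/smooth_row => // i.
apply: (@smooth_eq _ _ _ (fun x => f x * g x 0 i)) => //.
  by move=> x _; rewrite mxE.
by apply: smoothM => //; exact: (proj1 (smooth_row _ oA) Hg).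
Qed.

Lemma smooth_comp V (A : set V) (B : set R) (f : V -> R)
    (g : R -> R) : open A -> (forall x, A x -> B (f x)) ->
  smooth A f -> smooth B g -> smooth A (fun x => g (f x)).
Proof. by move=> oA AB Hf Hg k; apply: Ck_on_comp (Hf k) (Hg k). Qed.

Lemma smooth_comp_row V n m (A : set V) (B : set 'rV[R]_n) (f : V -> 'rV[R]_n)
    (g : 'rV[R]_n -> 'rV[R]_m) : open A -> open B -> (forall x, A x -> B (f x)) ->
  smooth A f -> smooth B g -> smooth A (fun x => g (f x)).
Proof.
move=> oA oB AB Hf Hg; apply/smooth_row => // i k.
have {}Hg := proj1 (smooth_row _ oB) Hg.
by apply: (@Ck_on_comp_row _ _ _ _ _ _ f (fun w => g w 0 i)) (Hf k) (Hg i k).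
Qed.

Lemma smooth_comp_rowR V n (A : set V) (B : set 'rV[R]_n) (f : V -> 'rV[R]_n)
    (g : 'rV[R]_n -> R) : open A -> (forall x, A x -> B (f x)) ->
  smooth A f -> smooth B g -> smooth A (fun x => g (f x)).
Proof. by move=> oA AB Hf Hg k; apply: Ck_on_comp_row (Hf k) (Hg k). Qed.

Lemma smooth_differentiable V W (A : set V) (f : V -> W) x :
  smooth A f -> A x -> differentiable f x.
Proof. by move=> /(_ 1) [H _] Ax; exact: H. Qed.

Lemma smooth_continuous V W (A : set V) (f : V -> W) x :
  smooth A f -> A x -> {for x, continuous f}.
Proof. by move=> /(_ 0) H Ax; exact: H. Qed.

Lemma smooth_derive V W (A : set V) (f : V -> W) v :
  smooth A f -> smooth A ('D_v f).
Proof. by move=> H k; have [_] := H k.+1; apply. Qed.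

Lemma smooth_derive1 W (A : set R) (f : R -> W) :
  smooth A f -> smooth A (derive1 f).
Proof.
move=> H; rewrite (_ : derive1 f = 'D_1 f); last by apply/funext => x; rewrite derive1E.
exact: smooth_derive.
Qed.

Lemma smooth_is_derive W (A : set R) (f : R -> W) x :
  smooth A f -> A x -> is_derive x 1 f (derive1 f x).
Proof.
move=> H Ax; rewrite derive1E; apply: derivableP; apply: diff_derivable.
exact: smooth_differentiable H Ax.
Qed.

Lemma is_derive_bootstrap k (A : set R) (f g : R -> R) : open A ->
  (forall x, A x -> is_derive x 1 f (g x)) -> Ck_on k A g -> Ck_on k.+1 A f.
Proof.
move=> oA fg Hg; have df x (Ax : A x) : differentiable f x.
  by apply/derivable1_diffP; have [] := fg _ Ax.
split=> // v.
apply: (@Ck_on_eq _ _ _ _ _ (fun x => v * g x)) => //.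
  move=> x Ax; rewrite deriveE; last exact: df.
  have [dx <-] := fg _ Ax; rewrite deriveE; last exact: df.
  have : 'd f x (v *: (1 : R)) = v *: 'd f x 1 by rewrite linearZ.
  by rewrite /GRing.scale /= mulr1.
by apply: Ck_onM => //; exact: Ck_on_cst.
Qed.

(** Intended for functions whose derivative is an expression in themselves, such as [1 / x], [sqrt]
    or a local inverse: each round gains one order of differentiability. *)
Lemma smooth_bootstrap (A : set R) (f g : R -> R) : open A ->
  (forall x, A x -> is_derive x 1 f (g x)) ->
  (forall k, Ck_on k A f -> Ck_on k A g) -> smooth A f.
Proof.
move=> oA fg H; elim=> [|k IH].
  move=> x Ax; apply/differentiable_continuous/derivable1_diffP.
  by have [] := fg _ Ax.
by apply: is_derive_bootstrap fg _ => //; exact: H.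
Qed.

(** Intended for functions all of whose derivatives are given in closed form: Hadamard's quotient,
    [sin], and the function of [x ^ 2] in Whitney's theorem. *)
Lemma smooth_seq (A : set R) (F : nat -> R -> R) : open A ->
  (forall n x, A x -> is_derive x 1 (F n) (F n.+1 x)) ->
  forall n, smooth A (F n).
Proof.
move=> oA H n k; elim: k n => [|k IH] n.
  move=> x Ax; apply/differentiable_continuous/derivable1_diffP.
  by have [] := H n _ Ax.
by apply: is_derive_bootstrap (H n) (IH _).
Qed.

Lemma smooth_inv : smooth [set x : R | x != 0] (fun x => x^-1).
Proof.
have oA : open [set x : R | x != 0] by exact: open_neq.
apply: (@smooth_bootstrap _ _ (fun x => - (x^-1 * x^-1))) => //.
  move=> x x0; apply: is_derive_eq (is_deriveV x0 (is_derive_id _ _)) _.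
  by rewrite /GRing.scale /= mulr1 expr2 invfM.
move=> k H; apply: (@Ck_on_eq _ _ _ _ _ (fun x : R => -1 * (x^-1 * x^-1))) => //.
  by move=> x _; rewrite mulN1r.
apply: Ck_onM => //; [exact: Ck_on_cst|exact: Ck_onM].
Qed.

Lemma Ck_onV V k (A : set V) (f : V -> R) : open A ->
  (forall x, A x -> f x != 0) -> Ck_on k A f -> Ck_on k A (fun x => (f x)^-1).
Proof. by move=> oA f0 H; apply: Ck_on_comp H (smooth_inv k). Qed.

Lemma smoothV V (A : set V) (f : V -> R) : open A ->
  (forall x, A x -> f x != 0) -> smooth A f -> smooth A (fun x => (f x)^-1).
Proof. by move=> oA f0 H k; exact: Ck_onV. Qed.

Lemma smooth_sqrt_pos : smooth [set x : R | 0 < x] Num.sqrt.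
Proof.
have oA : open [set x : R | 0 < x] by exact: open_gt.
apply: (@smooth_bootstrap _ _ (fun x => (2 * Num.sqrt x)^-1)) => //.
move=> k H; apply: Ck_onV => //.
  by move=> x /= x0; rewrite mulf_neq0 // gt_eqF // sqrtr_gt0.
by apply: Ck_onM => //; exact: Ck_on_cst.
Qed.

Lemma smooth_sqrt V (A : set V) (f : V -> R) : open A ->
  (forall x, A x -> 0 < f x) -> smooth A f -> smooth A (fun x => Num.sqrt (f x)).
Proof. by move=> oA f0 H; apply: smooth_comp H smooth_sqrt_pos. Qed.

End Smooth.

(** * Derivatives on the real line and Hadamard's lemma *)

Section RealDerivatives.
Context {R : realType}.
Implicit Types (f g : R -> R) (x a b : R).

Lemma is_derive1D f g x a b : is_derive x 1 f a -> is_derive x 1 g b ->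
  is_derive x 1 (fun y => f y + g y) (a + b).
Proof. by move=> Hf Hg; exact: is_deriveD. Qed.

Lemma is_derive1B f g x a b : is_derive x 1 f a -> is_derive x 1 g b ->
  is_derive x 1 (fun y => f y - g y) (a - b).
Proof. by move=> Hf Hg; exact: is_deriveB. Qed.

Lemma is_derive1M f g x a b : is_derive x 1 f a -> is_derive x 1 g b ->
  is_derive x 1 (fun y => f y * g y) (a * g x + f x * b).
Proof.
move=> Hf Hg; apply: is_derive_eq (is_deriveM Hf Hg) _.
by rewrite /GRing.scale /= addrC [a * _]mulrC.
Qed.

Lemma is_derive1Ml c f x a : is_derive x 1 f a ->
  is_derive x 1 (fun y => c * f y) (c * a).
Proof.
move=> Hf; apply: is_derive_eq (is_derive1M (is_derive_cst c x 1) Hf) _.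
by rewrite mul0r add0r.
Qed.

Lemma is_derive1X n f x a : is_derive x 1 f a ->
  is_derive x 1 (fun y => f y ^+ n) (n%:R * f x ^+ n.-1 * a).
Proof.
move=> Hf; rewrite (_ : (fun y => f y ^+ n) = f ^+ n); last by rewrite exprfctE.
exact: is_deriveX.
Qed.

Lemma is_derive1_pow n x : is_derive x 1 (fun y : R => y ^+ n) (n%:R * x ^+ n.-1).
Proof.
by apply: is_derive_eq (is_derive1X n (is_derive_id x (1 : R))) _; rewrite mulr1.
Qed.

Lemma is_derive1V f x a : f x != 0 -> is_derive x 1 f a ->
  is_derive x 1 (fun y => (f y)^-1) (- a / f x ^+ 2).
Proof.
move=> fx0 Hf; apply: is_derive_eq (is_deriveV fx0 Hf) _.
by rewrite /GRing.scale /= mulrC !mulrN mulNr.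
Qed.

Lemma is_derive1_cont f x a : is_derive x 1 f a -> {for x, continuous f}.
Proof.
by move=> [d _]; exact/differentiable_continuous/derivable1_diffP.
Qed.

(** The bound, multiplied out and non-strict, admits [h = 0] and has the shape produced by the mean
    value estimate; it serves at points where a function changes its defining formula. *)
Lemma is_derive1P f x a : is_derive x 1 f a <->
  (forall e, 0 < e -> exists2 d, 0 < d & forall h, `|h| < d ->
    `|f (x + h) - f x - h * a| <= e * `|h|).
Proof.
split=> [Hf e e0|H].
  have df : differentiable f x by apply/derivable1_diffP; case: Hf.
  have dE h : 'd f x h = h * a.
    rewrite -[h in LHS]mulr1 -[h * 1]/(h *: 1) linearZ -deriveE //.
    by have [_ ->] := Hf.
  have := diff_locally df => /eqaddoP /(_ _ e0) /nbhs_ballP[d /= d0 H].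
  exists d => // h hd; have := H h; rewrite /ball /= sub0r normrN => /(_ hd).
  by rewrite !fctE /= dE opprD addrA [h + x]addrC.
have H' : (fun h => h^-1 *: (f (h + x) - f x)) @ 0^' --> a.
  apply/cvgrPdist_le => e e0; have [d d0 {}H] := H _ e0.
  near=> h; have h0 : h != 0 by near: h; exact: nbhs_dnbhs_neq.
  have hd : `|h| < d by near: h; exact: dnbhs0_lt.
  rewrite -[a](mulKf h0) -mulrBr normrM normfV ler_pdivrMl ?normr_gt0 //.
  by rewrite distrC [h + x]addrC [`|h| * e]mulrC; exact: H.
have H2 : (fun h : R => h^-1 *: ((f \o shift x) (h *: (1:R)) - f x)) @ 0^' --> a.
  by under eq_fun do rewrite /= /GRing.scale /= mulr1; exact: H'.
apply: DeriveDef; first by apply/cvg_ex; exists a.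
exact: cvg_lim H2.
Unshelve. all: by end_near. Qed.

Lemma is_derive1_eq_near f g x a : (\near x, f x = g x) ->
  is_derive x 1 f a -> is_derive x 1 g a.
Proof. exact: near_eq_is_derive. Qed.

(** Hypotheses on the symmetric interval about [x] spare every use a case distinction on the sign of
    [y - x]. *)
Lemma MVT_bound f (df : R -> R) x y M :
  (forall t, `|t - x| <= `|y - x| -> is_derive t 1 f (df t)) ->
  (forall t, `|t - x| <= `|y - x| -> `|df t| <= M) ->
  `|f y - f x| <= M * `|y - x|.
Proof.
move=> H1 H2.
have bnd t : (x <= t <= y) || (y <= t <= x) -> `|t - x| <= `|y - x|.
  move=> /orP[|] /andP[h1 h2].
    rewrite !ger0_norm ?subr_ge0 ?lerB //; exact: le_trans h2.
  by rewrite !ler0_norm ?subr_le0 ?lerN2 ?lerB //; exact: le_trans h2.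
have cont t : `|t - x| <= `|y - x| -> {for t, continuous f}.
  by move=> /H1; exact: is_derive1_cont.
case: (leP x y) => [xy|/ltW yx].
  have [||c cxy ->] := @MVT_segment _ f df x y xy.
  - by move=> t /andP[/ltW h1 /ltW h2]; apply/H1/bnd; rewrite h1 h2.
  - apply: continuous_in_subspaceT => t; rewrite inE /= in_itv /= => h.
    by apply/cont/bnd; rewrite h.
  - rewrite normrM ler_wpM2r //; apply/H2/bnd.
    by move: cxy; rewrite in_itv /= => ->.
have [||c cxy] := @MVT_segment _ f df y x yx.
- by move=> t /andP[/ltW h1 /ltW h2]; apply/H1/bnd; rewrite h1 h2 orbT.
- apply: continuous_in_subspaceT => t; rewrite inE /= in_itv /= => h.
  by apply/cont/bnd; rewrite h orbT.
- rewrite distrC => ->; rewrite normrM [`|y - x|]distrC ler_wpM2r //; apply/H2/bnd.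
  by move: cxy; rewrite in_itv /= => ->; rewrite orbT.
Qed.

End RealDerivatives.

Section Hadamard.
Context {R : realType}.
Implicit Types (f g : R -> R) (r x : R).
Local Notation smooth := smooth_on_open.
Local Notation B r := [set x : R | `|x| < r].

Lemma open_centered_ball r : open (B r).
Proof.
rewrite (_ : B r = (fun x => `|x|) @^-1` [set y | y < r]) //.
by apply: open_comp => [x _|]; [exact: norm_continuous|exact: open_lt].
Qed.

Lemma smooth_derive1n (A : set R) f n : smooth A f -> smooth A (derive1n n f).
Proof.
move=> H; elim: n => [|n IH]; first by rewrite derive1n0.
by rewrite derive1nS; exact: smooth_derive1.
Qed.

Lemma smooth_is_derive1n (A : set R) f n x : smooth A f -> A x ->
  is_derive x 1 (derive1n n f) (derive1n n.+1 f x).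
Proof.
by move=> H Ax; rewrite derive1nS; apply: smooth_is_derive Ax; exact: smooth_derive1n.
Qed.

(* [x ^ n.+1 * h^(n)(x)] for the quotient [h = f / id]. *)
Fixpoint quotient_numerator f (n : nat) x : R :=
  if n is k.+1 then x ^+ k.+1 * derive1n k.+1 f x - k.+1%:R * quotient_numerator f k x
  else f x.

(** Telescoping: differentiating the power of [x] produces exactly the term that the derivative of
    the previous numerator cancels. *)
Lemma quotient_numerator_derive (A : set R) f n x : smooth A f -> A x ->
  is_derive x 1 (quotient_numerator f n) (x ^+ n * derive1n n.+1 f x).
Proof.
move=> H Ax; elim: n => [|n IH].
  by rewrite expr0 mul1r; have := @smooth_is_derive1n A f 0 x H Ax; rewrite derive1n0.
apply: is_derive_eq.
  apply: is_derive1B (is_derive1Ml n.+1%:R IH).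
  exact: (is_derive1M (is_derive1_pow n.+1 x) (smooth_is_derive1n n.+1 H Ax)).
by rewrite /= mulrA addrAC subrr add0r.
Qed.

(** The derivatives of [f / id] off [0] are [G n x / x ^ n.+1], and Taylor's formula predicts their
    values [f^(n.+1)(0) / n.+1] at [0]. Only differentiability at [0] of these extensions needs an
    estimate. *)
Lemma hadamard r f : 0 < r -> smooth (B r) f -> f 0 = 0 ->
  exists2 h, smooth (B r) h & forall x, f x = x * h x.
Proof.
move=> r0 Hf f0.
pose G := quotient_numerator f.
have G0 n : G n 0 = 0.
  by elim: n => [//|n IH]; rewrite /G /= -/(G n 0) IH expr0n /= mul0r mulr0 subr0.
pose F n x := if x == 0 then derive1n n.+1 f 0 / n.+1%:R else G n x / x ^+ n.+1.
have B0 : B r 0 by rewrite /= normr0.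
exists (F 0).
  apply: smooth_seq => //; first exact: open_centered_ball.
  move=> n x Bx; have [->|x0] := eqVneq x 0; last first.
    apply: (@is_derive1_eq_near _ (fun y => G n y * (y ^+ n.+1)^-1)).
      have : \near x, x != 0.
        by apply: (@open_nbhs_nbhs _ x [set x | x != 0]); split => //; exact: open_neq.
      by apply: filterS => y y0; rewrite /F (negbTE y0).
    apply: is_derive_eq.
      apply: is_derive1M; first exact: quotient_numerator_derive Hf Bx.
      by apply: is_derive1V (is_derive1_pow _ _); rewrite expf_neq0.
    rewrite /F (negbTE x0) /G /= -/(G n x) !exprS.
    have xn0 : x ^+ n != 0 by rewrite expf_neq0.
    by field; rewrite x0 xn0.
  apply/is_derive1P => e e0.
  have := proj1 (is_derive1P _ _ _) (smooth_is_derive1n n.+1 Hf B0) _ e0.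
  move=> [d d0 Hd].
  exists (Num.min d r); first by rewrite lt_min d0 r0.
  move=> h; rewrite lt_min => /andP[hd hr]; rewrite add0r.
  have [->|h0] := eqVneq h 0; first by rewrite subrr mul0r subr0 normr0 mulr0.
  rewrite /F eqxx (negbTE h0).
  set a := derive1n n.+1 f 0 in Hd *; set b := derive1n n.+2 f 0 in Hd *.
  (* [Q] is [G n] minus its Taylor polynomial. Its derivative is [t ^ n] times the first-order
     remainder of [f^(n.+1)] at [0], hence at most [e * |t| ^ n.+1], and the mean value estimate
     gives the factor still needed. *)
  pose Q t := G n t - a / n.+1%:R * t ^+ n.+1 - b / n.+2%:R * t ^+ n.+2.
  have QE : G n h / h ^+ n.+1 - a / n.+1%:R - h * (b / n.+2%:R) = (Q h - Q 0) / h ^+ n.+1.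
    have hn0 : h ^+ n.+1 != 0 by rewrite expf_neq0.
    rewrite /Q G0 !expr0n /= !mulr0 !subr0 [h ^+ n.+2]exprS.
    move: (a / _) (b / _) (h ^+ n.+1) hn0 => a' b' p p0.
    by field; rewrite p0.
  rewrite QE normrM normfV ler_pdivrMr ?normr_gt0 ?expf_neq0 //.
  have -> : e * `|h| * `|h ^+ n.+1| = (e * `|h| ^+ n.+1) * `|h - 0|.
    by rewrite subr0 normrX -!mulrA; congr (_ * _); rewrite mulrC.
  apply: (@MVT_bound _ Q (fun t => t ^+ n * (derive1n n.+1 f t - a - t * b))) => t;
    rewrite !subr0 => th.
    apply: is_derive_eq.
      apply: is_derive1B (is_derive1Ml _ (is_derive1_pow _ _)).
      apply: is_derive1B (is_derive1Ml _ (is_derive1_pow _ _)).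
      by apply: quotient_numerator_derive Hf _; exact: le_lt_trans hr.
    rewrite /= !mulrBr -/a; congr (_ - _ - _).
      by rewrite mulrA mulfVK ?pnatr_eq0 // mulrC.
    by rewrite mulrA mulfVK ?pnatr_eq0 // exprS [in RHS]mulrA mulrC [t * _]mulrC.
  rewrite normrM normrX exprS mulrA [leLHS]mulrC.
  have := Hd t (le_lt_trans th hd); rewrite add0r => Ht.
  apply: ler_pM => //; last by rewrite lerXn2r // nnegrE.
  by apply: (le_trans Ht); rewrite ler_wpM2l // ltW.
move=> x; rewrite /F; have [->|x0] := eqVneq x 0; first by rewrite f0 mul0r.
by rewrite expr1 /G /= mulrC divfK.
Qed.

End Hadamard.

(** * Borel's lemma *)

Section Borel.
Context {R : realType}.
Implicit Types (f g : R -> R) (x a c : R).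
Local Notation smooth := (@smooth_on_open R R R setT).

Lemma derive1_val f x a : is_derive x 1 f a -> derive1 f x = a.
Proof. by move=> [_ <-]; rewrite derive1E. Qed.

Lemma smoothT_is_derive f x : smooth f -> is_derive x 1 f (derive1 f x).
Proof. by move=> Hf; exact: smooth_is_derive Hf I. Qed.

Lemma derive1n_add f g k : smooth f -> smooth g ->
  derive1n k (fun x => f x + g x) = (fun x => derive1n k f x + derive1n k g x).
Proof.
move=> Hf Hg; elim: k => [|k IH]; first by rewrite !derive1n0.
rewrite derive1nS IH; apply/funext => x; apply: derive1_val.
by apply: is_derive1D; apply: smooth_is_derive1n I.
Qed.

Lemma derive1n_scale f c l k : smooth f ->
  derive1n k (fun x => c * f (l * x)) =
  (fun x => c * l ^+ k * derive1n k f (l * x)).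
Proof.
move=> Hf; elim: k => [|k IH].
  by rewrite !derive1n0; apply/funext => x; rewrite mulr1.
rewrite derive1nS IH; apply/funext => x; apply: derive1_val.
rewrite exprSr mulrA -mulrA; apply: is_derive1Ml.
have Hl : is_derive x 1 (fun y => l * y) (l * 1).
  exact: is_derive1Ml (is_derive_id x (1 : R)).
apply: is_derive_eq (is_derive1_comp (smooth_is_derive1n k Hf I) Hl) _.
by rewrite mulr1 mulrC.
Qed.

(** The bounds are on the whole line because they have to survive the substitution [x |-> l * x]
    with large [l]. Derivability is recorded since [derive1] is total. *)
Fixpoint bounded_Ck (k : nat) f : Prop :=
  (exists M, forall x, `|f x| <= M) /\
  if k is k'.+1 then (forall x, derivable f x 1) /\ bounded_Ck k' (derive1 f)
  else True.

Lemma bounded_CkW k f : bounded_Ck k.+1 f -> bounded_Ck k f.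
Proof.
elim: k f => [|k IH] f; first by move=> [].
by move=> [Mf [df /IH ?]]; split.
Qed.

Lemma bounded_CkD k f g : bounded_Ck k f -> bounded_Ck k g ->
  bounded_Ck k (fun x => f x + g x).
Proof.
have bD f1 g1 : (exists M, forall x, `|f1 x| <= M) ->
    (exists M, forall x, `|g1 x| <= M) -> exists M, forall x, `|f1 x + g1 x| <= M.
  move=> [M HM] [N HN]; exists (M + N) => x.
  by apply: le_trans (ler_normD _ _) _; exact: lerD.
elim: k f g => [|k IH] f g [Mf Hf] [Mg Hg]; split => //; try exact: bD.
case: Hf => df Hf; case: Hg => dg Hg; split; first by move=> x; exact: derivableD.
rewrite (_ : derive1 _ = fun x => derive1 f x + derive1 g x); first exact: IH.
apply/funext => x; apply: derive1_val; rewrite !derive1E.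
by apply: is_derive1D; exact: derivableP.
Qed.

Lemma bounded_CkM k f g : bounded_Ck k f -> bounded_Ck k g ->
  bounded_Ck k (fun x => f x * g x).
Proof.
have bM f1 g1 : (exists M, forall x, `|f1 x| <= M) ->
    (exists M, forall x, `|g1 x| <= M) -> exists M, forall x, `|f1 x * g1 x| <= M.
  by move=> [M HM] [N HN]; exists (M * N) => x; rewrite normrM ler_pM.
elim: k f g => [|k IH] f g [Mf Hf] [Mg Hg]; split => //; try exact: bM.
case: (Hf) => df Hf'; case: (Hg) => dg Hg'; split.
  by move=> x; exact: derivableM.
rewrite (_ : derive1 _ = fun x => derive1 f x * g x + f x * derive1 g x); last first.
  apply/funext => x; apply: derive1_val; rewrite !derive1E.
  by apply: is_derive1M; exact: derivableP.
by apply: bounded_CkD; apply: IH => //; exact: bounded_CkW.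
Qed.

Lemma bounded_Ck_cst k c : bounded_Ck k (fun=> c).
Proof.
elim: k c => [|k IH] c; split => //; try by exists `|c|.
split=> // ; rewrite (_ : derive1 _ = fun=> 0); first exact: IH.
by apply/funext => x; rewrite derive1_cst.
Qed.

Lemma bounded_Ck_trig k : bounded_Ck k (@sin R) /\ bounded_Ck k (@cos R).
Proof.
have bs : exists M, forall x : R, `|sin x| <= M.
  by exists 1 => x; rewrite ler_norml sin_geN1 sin_le1.
have bc : exists M, forall x : R, `|cos x| <= M.
  by exists 1 => x; rewrite ler_norml cos_geN1 cos_le1.
elim: k => [|k [IHs IHc]]; first by [].
split; split => //.
  split; first by move=> x; exact: derivable_sin.
  by rewrite (_ : derive1 _ = cos) //; apply/funext => x; apply: derive1_val.
split; first by move=> x; exact: derivable_cos.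
rewrite (_ : derive1 _ = fun x => -1 * sin x).
  by apply: bounded_CkM => //; exact: bounded_Ck_cst.
by apply/funext => x; apply: derive1_val; rewrite mulN1r; exact: is_derive_cos.
Qed.

Lemma bounded_Ck_sinX k n : bounded_Ck k (fun x : R => sin x ^+ n).
Proof.
elim: n => [|n IH]; first by rewrite (_ : (fun x => _) = fun=> 1); [exact: bounded_Ck_cst|].
rewrite (_ : (fun x => _) = fun x => sin x * sin x ^+ n).
  by apply: bounded_CkM => //; have [] := bounded_Ck_trig k.
by apply/funext => x; rewrite exprS.
Qed.

Lemma bounded_Ck_derive1n k f : bounded_Ck k f ->
  exists M, forall x, `|derive1n k f x| <= M.
Proof.
by elim: k f => [|k IH] f [Mf //] [_ /IH]; rewrite derive1Sn.
Qed.

Lemma smooth_sin : smooth (@sin R).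
Proof.
pose F n := [eta nth (@sin R) [:: @sin R; @cos R; fun x => - sin x; fun x => - cos x]] (n %% 4)%N.
apply: (@smooth_seq _ _ F openT) 0%N => n x _.
have : (n %% 4 < 4)%N by rewrite ltn_mod.
rewrite /F -[n.+1]addn1 -modnDml; case: (n %% 4)%N => [|[|[|[|//]]]] _ /=.
- exact: is_derive_sin.
- exact: is_derive_cos.
- exact: is_deriveN.
- by rewrite -[X in is_derive _ _ _ X]opprK; apply: is_deriveN; exact: is_derive_cos.
Qed.

Lemma smooth_cos : smooth (@cos R).
Proof.
rewrite (_ : cos = derive1 sin); first exact: smooth_derive1 smooth_sin.
by apply/funext => x; symmetry; apply: derive1_val.
Qed.

(* Differentiating [sin ^ n.+1 * g] leaves a factor [sin ^ n], with cofactor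
   [n.+1 * cos * g + sin * g^'] of value [n.+1 * g 0] at [0]. *)
Lemma sinX_mul_derive n g : smooth g ->
  (forall k, (k < n)%N -> derive1n k (fun x => sin x ^+ n * g x) 0 = 0) /\
  derive1n n (fun x => sin x ^+ n * g x) 0 = n`!%:R * g 0.
Proof.
elim: n g => [|n IH] g Hg.
  by split=> //; rewrite derive1n0 expr0 mul1r fact0 mul1r.
pose g1 x := n.+1%:R * (cos x * g x) + sin x * derive1 g x.
have Hg1 : smooth g1.
  apply: smoothD; first exact: openT.
    apply: smoothM; [exact: openT|exact: smooth_cst|].
    by apply: smoothM; [exact: openT|exact: smooth_cos|].
  apply: smoothM; [exact: openT|exact: smooth_sin|exact: smooth_derive1].
have dE : derive1 (fun x => sin x ^+ n.+1 * g x) = fun x => sin x ^+ n * g1 x.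
  apply/funext => x; apply: derive1_val; apply: is_derive_eq.
    apply: is_derive1M (smoothT_is_derive x Hg).
    exact: is_derive1X (is_derive_sin _).
  by rewrite /g1 /= exprS; ring.
have [H1 H2] := IH _ Hg1; split.
  move=> [|k] kn; first by rewrite derive1n0 sin0 expr0n mul0r.
  by rewrite derive1Sn dE H1.
by rewrite derive1Sn dE H2 /g1 cos0 sin0 mul0r addr0 mul1r factS natrM mulrCA mulrA.
Qed.

(* The function is [c * sin (l * x) ^ n]: with the n-th derivative at [0] fixed,
   the derivatives of order [k < n] are of size [l ^ (k - n)], hence small for
   large [l].  No cutoff function is needed because [sin] has bounded
   derivatives. *)
Lemma borel_step n e a : 0 < e -> exists f, [/\ smooth f,
  forall k, (k < n)%N -> derive1n k f 0 = 0, derive1n n f 0 = a &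
  forall k x, (k < n)%N -> `|derive1n k f x| <= e].
Proof.
move=> e0; pose s x : R := sin x ^+ n.
have Hs : smooth s by apply: smoothX; [exact: openT|exact: smooth_sin].
have [s1 s2] : (forall k, (k < n)%N -> derive1n k s 0 = 0) /\ derive1n n s 0 = n`!%:R.
  have := @sinX_mul_derive n (fun=> 1) (smooth_cst _ _).
  by rewrite (_ : (fun x => _ * 1) = s) ?mulr1 //; apply/funext => x; rewrite mulr1.
have [M M0 HM] : exists2 M, 0 <= M & forall k x, (k < n)%N -> `|derive1n k s x| <= M.
  have : forall m, exists2 M, 0 <= M & forall k x, (k < m)%N -> `|derive1n k s x| <= M.
    elim=> [|m [M M0 HM]]; first by exists 0.
    have [N HN] := bounded_Ck_derive1n (bounded_Ck_sinX m n).
    exists (Num.max M N); first by rewrite le_max M0.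
    move=> k x; rewrite ltnS leq_eqVlt le_max => /orP[/eqP->|/HM->//].
    by rewrite HN orbT.
  by apply.
have nf0 : (n`!%:R : R) != 0 by rewrite pnatr_eq0 -lt0n fact_gt0.
have nfp : 0 < (n`!%:R : R) by rewrite ltr0n fact_gt0.
(* Since [l >= 1], the factor [l ^ (n - k)] is at least [l], so the derivatives of order [k < n] are
   bounded by [|a| / n! / l * M]; the second summand of [l] brings this below [e]. The constant [c]
   makes the derivative of order [n] at [0] equal to [a]. *)
pose l := 1 + `|a| * M / (n`!%:R * e).
have l1 : 1 <= l by rewrite /l lerDl divr_ge0 ?mulr_ge0 // ltW.
have l0 : 0 < l by exact: lt_le_trans l1.
have ln0 m : l ^+ m != 0 by rewrite expf_neq0 // gt_eqF.
pose c := a / (n`!%:R * l ^+ n).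
have dE k : derive1n k (fun x => c * s (l * x)) = fun x => c * l ^+ k * derive1n k s (l * x).
  exact: derive1n_scale.
exists (fun x => c * s (l * x)); split.
- apply: smoothM; [exact: openT|exact: smooth_cst|].
  apply: (@smooth_comp _ _ _ setT) Hs => //; first exact: openT.
  by apply: smoothM; [exact: openT|exact: smooth_cst|exact: smooth_id].
- by move=> k kn; rewrite dE /= mulr0 s1 ?mulr0.
- rewrite dE /= mulr0 s2 /c; have := ln0 n; move: (l ^+ n) => p p0.
  by field; rewrite nf0 p0.
- move=> k x kn; rewrite dE normrM.
  have -> : c * l ^+ k = a / n`!%:R / l ^+ (n - k).
    rewrite /c -[n in l ^+ n](subnK (ltnW kn)) exprD.
    have := ln0 k; have := ln0 (n - k)%N; move: (l ^+ (n - k)) (l ^+ k) => p q p0 q0.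
    by field; rewrite nf0 p0 q0.
  apply: (@le_trans _ _ (`|a| / n`!%:R / l * M)).
    apply: ler_pM => //; last exact: HM.
    rewrite !normrM !normfV normr_nat (ger0_norm (ltW (exprn_gt0 _ l0))).
    apply: ler_wpM2l;  first by rewrite divr_ge0.
    rewrite lef_pV2 ?posrE ?exprn_gt0 //.
    rewrite -(subnSK kn) exprS; rewrite ler_peMr ?(ltW l0) //; exact: exprn_ege1.
  rewrite mulrAC ler_pdivrMr // /l mulrDr mulr1.
  apply: (@le_trans _ _ (e * (`|a| * M / (n`!%:R * e)))); last by rewrite lerDr ltW.
  rewrite le_eqVlt; apply/orP; left; apply/eqP; field.
  by rewrite nf0 gt_eqF.
Qed.

End Borel.

(** * Convergence of the successive Borel corrections *)

Section BorelLimit.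
Context {R : realType}.
Implicit Types (f g : R -> R) (x e : R).
Local Notation smooth := (@smooth_on_open R R R setT).
Local Notation w n := ((2 ^+ n)^-1 : R).

Lemma inv_pow2_gt0 n : 0 < w n.
Proof. by rewrite invr_gt0 exprn_gt0. Qed.

Lemma inv_pow2_double n : w n = 2 * w n.+1.
Proof. by rewrite exprS invfM mulrA divff ?mul1r. Qed.

Lemma inv_pow2_small e : 0 < e -> exists N, forall n, (N <= n)%N -> w n < e.
Proof.
move=> e0; exists (Num.bound e^-1) => n Nn.
rewrite invf_plt ?posrE ?exprn_gt0 //.
have /lt_le_trans : e^-1 < (Num.bound e^-1)%:R by rewrite archi_boundP // invr_ge0 ltW.
apply; rewrite -natrX ler_nat; apply: (leq_trans Nn); exact/ltnW/ltn_expl.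
Qed.

(** The intervals of radius [2 * w n] about [u n] are nested because [w n = 2 * w n.+1]; the limit
    is the supremum of their left ends. *)
Lemma geometric_cauchy_limit (u : nat -> R) N :
  (forall n, (N <= n)%N -> `|u n.+1 - u n| <= w n) ->
  exists l, forall n, (N <= n)%N -> `|u n - l| <= 2 * w n.
Proof.
move=> H.
pose lo n := u n - 2 * w n; pose hi n := u n + 2 * w n.
have lo_nd n m : (N <= n)%N -> (n <= m)%N -> lo n <= lo m.
  move=> Nn; elim: m => [|m IH]; first by rewrite leqn0 => /eqP->.
  rewrite leq_eqVlt => /orP[/eqP->//|]; rewrite ltnS => nm.
  apply: (le_trans (IH nm)); have := H m (leq_trans Nn nm).
  rewrite ler_norml => /andP[h _]; rewrite /lo (inv_pow2_double m).
  move: h; rewrite (inv_pow2_double m); have := inv_pow2_gt0 m.+1.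
  by move: (w m.+1) => v; lra.
have hi_ni n m : (N <= n)%N -> (n <= m)%N -> hi m <= hi n.
  move=> Nn; elim: m => [|m IH]; first by rewrite leqn0 => /eqP->.
  rewrite leq_eqVlt => /orP[/eqP->//|]; rewrite ltnS => nm.
  apply: le_trans _ (IH nm); have := H m (leq_trans Nn nm).
  rewrite ler_norml => /andP[_ h]; rewrite /hi (inv_pow2_double m).
  move: h; rewrite (inv_pow2_double m); have := inv_pow2_gt0 m.+1.
  by move: (w m.+1) => v; lra.
have lohi n m : (N <= n)%N -> (N <= m)%N -> lo n <= hi m.
  move=> Nn Nm; have lh k : lo k <= hi k.
    by rewrite /lo /hi; have := inv_pow2_gt0 k; move: (w k) => v; lra.
  apply: (le_trans (lo_nd _ _ Nn (leq_maxl n m))); apply: (le_trans (lh _)).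
  exact: hi_ni Nm (leq_maxr n m).
pose S := [set lo n | n in [set n | (N <= n)%N]].
have S0 : S !=set0 by exists (lo N), N => /=.
have Sub : has_ubound S by exists (hi N) => _ [n Nn <-]; exact: lohi.
exists (sup S) => n Nn; rewrite ler_norml; apply/andP; split.
  have : sup S <= hi n by apply: ge_sup => // _ [m Nm <-]; exact: lohi.
  by rewrite /hi; lra.
have : lo n <= sup S by apply: ub_le_sup => //; exists n.
by rewrite /lo; lra.
Qed.

(** Each correction sets the derivative of order [n] at [0], keeps the lower ones there, and changes
    those by at most [2 ^ (-n)] on the whole line, so all derivatives converge uniformly. The
    conclusion exposes the whole sequence of derivatives because Whitney's theorem glues it term by
    term to another such sequence. *)
Lemma borel (c : nat -> R) : exists h : nat -> R -> R,
  (forall n x, is_derive x 1 (h n) (h n.+1 x)) /\ forall n, h n 0 = c n.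
Proof.
have [st Hst] : exists st : nat -> R -> R -> R, forall n a, [/\ smooth (st n a),
  forall k, (k < n)%N -> derive1n k (st n a) 0 = 0, derive1n n (st n a) 0 = a &
  forall k x, (k < n)%N -> `|derive1n k (st n a) x| <= w n].
  have H n a := cid (@borel_step R n (w n) a (inv_pow2_gt0 n)).
  by exists (fun n a => sval (H n a)) => n a; exact: svalP (H n a).
pose fix P n : R -> R := if n is m.+1 then
  (fun x => P m x + st m (c m - derive1n m (P m) 0) x) else fun=> 0.
have sP n : smooth (P n).
  elim: n => [|n IH] /=; first exact: smooth_cst.
  by apply: smoothD => //; [exact: openT|have [] := Hst n (c n - derive1n n (P n) 0)].
have PS n k x : derive1n k (P n.+1) x =
    derive1n k (P n) x + derive1n k (st n (c n - derive1n n (P n) 0)) x.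
  by rewrite /= derive1n_add //; have [] := Hst n (c n - derive1n n (P n) 0).
have P0 n k : (k < n)%N -> derive1n k (P n) 0 = c k.
  elim: n => [//|n IH]; rewrite ltnS leq_eqVlt PS => /orP[/eqP->|kn].
    have [_ _ Z _] := Hst n (c n - derive1n n (P n) 0).
    by rewrite Z addrC subrK.
  have [_ Z _ _] := Hst n (c n - derive1n n (P n) 0).
  by rewrite Z // addr0 IH.
have PC n k x : (k < n)%N -> `|derive1n k (P n.+1) x - derive1n k (P n) x| <= w n.
  move=> kn; rewrite PS addrAC subrr add0r.
  by have [_ _ _] := Hst n (c n - derive1n n (P n) 0); apply.
have [h Hh] : exists h : nat -> R -> R, forall k x n, (k < n)%N ->
    `|derive1n k (P n) x - h k x| <= 2 * w n.
  have : forall k x, exists l, forall n, (k < n)%N -> `|derive1n k (P n) x - l| <= 2 * w n.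
    by move=> k x; apply: geometric_cauchy_limit => n kn; exact: PC.
  by move=> H; exists (fun k x => sval (cid (H k x))) => k x; exact: svalP (cid (H k x)).
(* This is how estimates pass to the limit: a quantity independent of [n] and below every [4 * w n]
   is nonpositive. *)
have small a N : (forall n, (N <= n)%N -> a <= 4 * w n) -> a <= 0.
  move=> H; rewrite leNgt; apply/negP => a0.
  have a4 : 0 < a / 4 by rewrite divr_gt0.
  have [M HM] := inv_pow2_small a4.
  have := HM (maxn M N) (leq_maxl _ _); have := H _ (leq_maxr M N).
  by move: (w _) => v; lra.
exists h; split => [k x|k]; last first.
  apply/eqP; rewrite -subr_eq0 -normr_le0; apply: (@small _ k.+1) => n kn.
  have := Hh k 0 n kn; rewrite P0 // distrC => /le_trans; apply.
  by have := inv_pow2_gt0 n; move: (w n) => v; lra.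
(* Uniform smallness of the increments of the derivatives passes to the limit
   as a Lipschitz estimate. *)
have lip n t : (k.+1 < n)%N ->
  `|(h k (x + t) - h k x) - (derive1n k (P n) (x + t) - derive1n k (P n) x)| <= 4 * w n * `|t|.
  move=> kn; rewrite -subr_le0; apply: (@small _ n) => m nm; rewrite lerBlDl.
  have km : (k < m)%N by apply: leq_trans nm; exact: ltnW.
  pose D y := derive1n k (P m) y - derive1n k (P n) y.
  have DL : `|D (x + t) - D x| <= 4 * w n * `|t|.
    have := @MVT_bound R D (fun y => derive1n k.+1 (P m) y - derive1n k.+1 (P n) y) x (x + t) (4 * w n).
    have -> : x + t - x = t by ring.
    apply=> y _; first by apply: is_derive1B; exact: smooth_is_derive1n I.
    rewrite -(subrKA (h k.+1 y)); apply: (le_trans (ler_normD _ _)).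
    have h1 := Hh k.+1 y m (leq_trans kn nm).
    have h2 := Hh k.+1 y n kn; rewrite distrC in h2.
    have h3 : w m <= w n by rewrite lef_pV2 ?posrE ?exprn_gt0 // ler_weXn2l // ler1n.
    by move: h1 h2 h3; move: (w m) (w n) `|_| `|_| => a b p q; lra.
  have h1 := Hh k (x + t) m km; have h2 := Hh k x m km.
  have -> : h k (x + t) - h k x - (derive1n k (P n) (x + t) - derive1n k (P n) x) =
    (D (x + t) - D x) + (- (derive1n k (P m) (x + t) - h k (x + t)) + (derive1n k (P m) x - h k x)).
    by rewrite /D; ring.
  apply: (le_trans (ler_normD _ _)); apply: lerD DL _.
  apply: (le_trans (ler_normD _ _)); rewrite normrN.
  by move: h1 h2; move: (w m) `|_| `|_| => a b p; lra.
apply/is_derive1P => e e0.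
(* Three errors add up: [4 * w n] from the Lipschitz estimate, [e / 2] from differentiating [P n],
   and [2 * w n] from replacing the derivative of [P n] by its limit. Hence the requirement
   [6 * w n <= e / 2]. *)
have e12 : 0 < e / 12 by rewrite divr_gt0.
have [N HN] := inv_pow2_small e12.
pose n := maxn N k.+2; have wn := HN n (leq_maxl _ _).
have kn : (k.+1 < n)%N by exact: leq_maxr.
have e20 : 0 < e / 2 by rewrite divr_gt0.
have := proj1 (is_derive1P _ _ _) (smooth_is_derive1n k (sP n) (I : setT x)) _ e20.
move=> [d d0 Hd]; exists d => // t td.
have := Hd t td; have := lip n t kn; have := Hh k.+1 x n kn.
set A := derive1n k (P n) (x + t); set B := derive1n k (P n) x.
set C := derive1n k.+1 (P n) x => h1 h2 h3.
have -> : h k (x + t) - h k x - t * h k.+1 x =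
  (h k (x + t) - h k x - (A - B)) + ((A - B - t * C) + t * (C - h k.+1 x)) by ring.
apply: (le_trans (ler_normD _ _)).
have h4 : `|A - B - t * C + t * (C - h k.+1 x)| <= e / 2 * `|t| + `|t| * (2 * w n).
  by apply: (le_trans (ler_normD _ _)); apply: lerD => //; rewrite normrM ler_wpM2l.
apply: (le_trans (lerD h2 h4)).
have t0 : 0 <= `|t| by [].
have -> : 4 * w n * `|t| + (e / 2 * `|t| + `|t| * (2 * w n)) = (6 * w n + e / 2) * `|t| by ring.
by rewrite ler_wpM2r //; move: wn; move: (w n) => v; lra.
Qed.

End BorelLimit.

(** * Whitney's theorem on even functions *)

Section EvenFunctions.
Context {R : realType}.
Implicit Types (f g : R -> R) (r x t : R).
Local Notation smooth := smooth_on_open.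
Local Notation B r := [set x : R | `|x| < r].

Lemma even_derive_quotient r f : 0 < r -> smooth (B r) f -> (forall x, f (- x) = f x) ->
  exists g, [/\ smooth (B r) g, (forall x, g (- x) = g x) &
    forall x, B r x -> derive1 f x = 2 * x * g x].
Proof.
move=> r0 Hf ev.
have oB : open (B r) by exact: open_centered_ball.
have odd x : B r x -> derive1 f (- x) = - derive1 f x.
  move=> Bx; have BNx : B r (- x) by rewrite /= normrN.
  have H : is_derive x 1 (f \o -%R) (derive1 f (- x) * (-1)).
    apply: is_derive1_comp; first exact: smooth_is_derive Hf BNx.
  have fE : f \o -%R = f by apply/funext => y; rewrite /= ev.
  by move: H; rewrite fE => /derive1_val ->; rewrite mulrN1 opprK.
have f'0 : derive1 f 0 = 0.
  have := odd 0; rewrite /= normr0 oppr0 => /(_ r0) h; lra.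
have [g Hg gE] := hadamard r0 (smooth_derive1 Hf) f'0.
(* Oddness of [derive1 f] is known only on the ball; the cutoff makes the quotient even on the whole
   line, as the next iteration requires. *)
pose g1 x := if `|x| < r then 2^-1 * g x else 0.
exists g1; split.
- apply: (@smooth_eq _ _ _ _ (fun x => 2^-1 * g x)) => //.
    by move=> x /= xr; rewrite /g1 xr.
  by apply: smoothM => //; exact: smooth_cst.
- move=> x; rewrite /g1 normrN; case: ifP => // xr.
  have [->|x0] := eqVneq x 0; first by rewrite oppr0.
  congr (_ * _); apply: (mulfI x0).
  by have := odd x xr; rewrite !gE mulNr => /oppr_inj.
- by move=> x xr; rewrite /g1 (xr : `|x| < r) gE; field.
Qed.

(* Whitney: with [f_0 = f] and [f_{n+1}(x) = f_n'(x) / (2x)], the derivatives of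
   [g = f o sqrt] are the [f_n o sqrt]; Borel's lemma extends [g] to [x < 0]. *)
Lemma smooth_even r f : 0 < r -> smooth (B r) f -> (forall x, f (- x) = f x) ->
  exists2 g, smooth (B (r ^+ 2)) g & forall x, B r x -> f x = g (x ^+ 2).
Proof.
move=> r0 Hf ev.
have [F [F0 HF]] : exists F : nat -> R -> R, F 0%N = f /\
    forall n, [/\ smooth (B r) (F n), (forall x, F n (- x) = F n x) &
      forall x, B r x -> derive1 (F n) x = 2 * x * F n.+1 x].
  pose Q f := smooth (B r) f /\ (forall x, f (- x) = f x).
  have [s Hs] : exists s : (R -> R) -> R -> R, forall f, Q f -> Q (s f) /\
      forall x, B r x -> derive1 f x = 2 * x * s f x.
    suff H f1 : exists g, Q f1 -> Q g /\ forall x, B r x -> derive1 f1 x = 2 * x * g x.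
      by exists (fun f => sval (cid (H f))) => f1; exact: svalP (cid (H f1)).
    have [[Q1 Q2]|NQ] := pselect (Q f1); last by exists f1.
    by have [g [g1 g2 g3]] := even_derive_quotient r0 Q1 Q2; exists g.
  have QF n : Q (iter n s f) by elim: n => [//|n /Hs[]].
  exists (fun n => iter n s f); split => // n; have [q1 q2] := QF n; split => //.
  by have [_] := Hs _ (QF n).
have [h [h1 h2]] := borel (fun n => F n 0).
have rr0 : 0 < r ^+ 2 by rewrite exprn_gt0.
pose G n x := if 0 <= x then F n (Num.sqrt x) else h n x.
have sqr x : `|x| < r ^+ 2 -> Num.sqrt x < r.
  move=> xr; rewrite -(ger0_norm (ltW r0)) -sqrtr_sqr ltr_sqrt //.
  exact: le_lt_trans (ler_norm _) xr.
have sqB x : `|x| < r ^+ 2 -> B r (Num.sqrt x).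
  by move=> /sqr; rewrite /= ger0_norm ?sqrtr_ge0.
exists (G 0%N); last first.
  move=> x xr; rewrite /G sqr_ge0 sqrtr_sqr F0.
  by case: (lerP 0 x) => [/ger0_norm->//|/ltr0_norm->]; rewrite ev.
apply: (@smooth_seq _ _ G); first exact: open_centered_ball.
move=> n x xr; have [Fs Fe Fd] := HF n; have [x0|x0|<-] := ltrgtP 0 x.
- apply: (@is_derive1_eq_near _ (F n \o Num.sqrt)).
    have : \near x, 0 < x.
      by apply: (@open_nbhs_nbhs _ x [set x | 0 < x]); split => //; exact: open_gt.
    by apply: filterS => y y0; rewrite /G (ltW y0).
  have H1 := smooth_is_derive Fs (sqB _ xr).
  apply: is_derive_eq (is_derive1_comp H1 (is_derive1_sqrt x0)) _.
  rewrite Fd; last exact: sqB.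
  have s0 : Num.sqrt x != 0 by rewrite gt_eqF // sqrtr_gt0.
  rewrite /G (ltW x0) mulrAC divff ?mul1r //.
  by rewrite mulf_neq0.
- rewrite /G leNgt x0 /=; apply: (@is_derive1_eq_near _ (h n)) => //.
  have : \near x, x < 0.
    by apply: (@open_nbhs_nbhs _ x [set x | x < 0]); split => //; exact: open_lt.
  by apply: filterS => y y0; rewrite /G leNgt y0.
- have G0 m : G m 0 = F m 0 by rewrite /G lexx sqrtr0.
  apply/is_derive1P => e e0.
  have [d1 d10 Hd1] := proj1 (is_derive1P _ _ _) (h1 n 0) _ e0.
  have c0 : {for 0, continuous (F n.+1)}.
    have [Fs' _ _] := HF n.+1; apply: smooth_continuous Fs' _; by rewrite /= normr0.
  have e20 : 0 < e / 2 by rewrite divr_gt0.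
  have /cvgrPdist_le /(_ _ e20) /nbhs_ballP [d2 /= d20 Hd2] := c0.
  exists (Num.min d1 (Num.min (d2 ^+ 2) (r ^+ 2))).
    by rewrite !lt_min d10 exprn_gt0 //= rr0.
  move=> t; rewrite !lt_min => /and3P[td1 td2 tr]; rewrite add0r !G0.
  have [t0|t0] := lerP 0 t; last first.
    by have := Hd1 t td1; rewrite add0r !h2 /G [0 <= t]leNgt t0.
  rewrite /G t0 (ger0_norm t0).
  have [s sE] : exists s, s = Num.sqrt t by exists (Num.sqrt t).
  have s0 : 0 <= s by rewrite sE sqrtr_ge0.
  have tE : t = s ^+ 2 by rewrite sE sqr_sqrtr.
  have sr : s < r by rewrite sE; exact: sqr.
  have sd : s < d2.
    rewrite -(ltr_pXn2r (n := 2)) ?nnegrE ?(ltW d20) //.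
    by rewrite -tE -[t]ger0_norm.
  rewrite -sE; set a := F n.+1 0.
  (* With [t = s ^ 2], the remainder at [0] becomes an increment of [D] over [[0, s]]. The
     derivative [2 * y * (F n.+1 y - F n.+1 0)] of [D] is at most [e * s] by continuity of [F n.+1],
     and integrating over length [s] gives [e * t]. *)
  pose D y := F n y - a * y ^+ 2.
  have -> : F n s - F n 0 - t * a = D s - D 0 by rewrite /D tE expr0n /=; ring.
  have -> : e * t = (e * s) * `|s - 0| by rewrite subr0 ger0_norm // tE; ring.
  apply: (@MVT_bound _ D (fun y => 2 * y * F n.+1 y - a * (2%:R * y ^+ 1))) => y;
    rewrite !subr0 (ger0_norm s0) => ys.
    apply: is_derive1B; last exact: is_derive1Ml (is_derive1_pow 2 y).
    have By : B r y by exact: le_lt_trans sr.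
    by rewrite -Fd //; exact: smooth_is_derive Fs By.
  have -> : 2 * y * F n.+1 y - a * (2%:R * y ^+ 1) = - (2 * y * (a - F n.+1 y)).
    by rewrite expr1; ring.
  rewrite normrN !normrM normr_nat.
  have /Hd2 Hy : ball 0 d2 y by rewrite /ball /= sub0r normrN; exact: le_lt_trans sd.
  have -> : e * s = 2 * s * (e / 2) by field.
  by apply: ler_pM => //; rewrite ?mulr_ge0 // ler_wpM2l.
Qed.

End EvenFunctions.

(** * Normal form of a planar cusp *)

Section NormalForm.
Context {R : realType}.
Implicit Types (f g : R -> R) (r x t : R).
Local Notation smooth := smooth_on_open.
Local Notation B r := [set x : R | `|x| < r].

Lemma near0_ball (P : R -> Prop) : (\forall x \near (0 : R), P x) ->
  exists2 d : R, 0 < d & forall x, `|x| < d -> P x.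
Proof.
move=> /nbhs_ballP [d /= d0 H]; exists d => // x xd; apply: H.
by rewrite /ball /= sub0r normrN.
Qed.

Lemma ballC_near r x (P : R -> Prop) :
  `|x| < r -> (forall y, `|y| < r -> P y) -> \near x, P x.
Proof.
move=> xr H; have h : nbhs x (B r).
  by apply: open_nbhs_nbhs; split => //; exact: open_centered_ball.
exact: (@filterS _ (nbhs x) _ (B r) P H h).
Qed.

Lemma nbhs_gt a x : a < x -> nbhs x [set y | a < y].
Proof. by move=> ax; apply: open_nbhs_nbhs; split => //; exact: open_gt. Qed.

Lemma nbhs_lt a x : x < a -> nbhs x [set y | y < a].
Proof. by move=> ax; apply: open_nbhs_nbhs; split => //; exact: open_lt. Qed.

Lemma hadamard_derive1n r f h n x : smooth (B r) h ->
  (forall x, f x = x * h x) -> `|x| < r ->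
  derive1n n.+1 f x = n.+1%:R * derive1n n h x + x * derive1n n.+1 h x.
Proof.
move=> Hh fE; elim: n x => [|n IH] x xr.
  rewrite derive1nS !derive1n0 (_ : f = fun x => x * h x); last exact/funext.
  apply: derive1_val.
  apply: is_derive_eq (is_derive1M (is_derive_id x (1:R)) (smooth_is_derive Hh xr)) _.
  by [].
rewrite derive1nS; apply: derive1_val.
apply: (@is_derive1_eq_near _ (fun x => n.+1%:R * derive1n n h x + x * derive1n n.+1 h x)).
  by apply: (ballC_near xr) => y yr; rewrite IH.
apply: is_derive_eq.
  apply: is_derive1D (is_derive1Ml _ (smooth_is_derive1n n Hh xr)) _.
  exact: is_derive1M (is_derive_id x (1:R)) (smooth_is_derive1n n.+1 Hh xr).
by rewrite mul1r addrA -[in RHS]natr1 mulrDl mul1r.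
Qed.

(** Division by [x] shifts the Taylor coefficients at [0], so a vanishing jet can be divided out one
    order at a time. *)
Lemma hadamard1n r f : 0 < r -> smooth (B r) f -> f 0 = 0 ->
  exists h, [/\ smooth (B r) h, (forall x, f x = x * h x) &
    forall n, derive1n n.+1 f 0 = n.+1%:R * derive1n n h 0].
Proof.
move=> r0 Hf f0; have [h Hh fE] := hadamard r0 Hf f0; exists h; split => // n.
by rewrite (hadamard_derive1n _ Hh fE) ?normr0 // mul0r addr0.
Qed.

(** Strict monotonicity and the intermediate value theorem provide the inverse, and [g' = 1 / f'(g)]
    bootstraps its smoothness. The radii are kept explicit so that both inverse identities hold on
    known intervals. *)
Lemma smooth_inverse r f : 0 < r -> smooth (B r) f -> f 0 = 0 -> 0 < derive1 f 0 ->
  exists g r1 r2, [/\ 0 < r1 <= r, 0 < r2, smooth (B r2) g,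
    forall u, `|u| < r2 -> `|g u| < r1 /\ f (g u) = u &
    forall s, `|s| < r1 -> g (f s) = s].
Proof.
move=> r0 Hf f0 f'0.
have B0 : B r 0 by rewrite /= normr0.
have c' : {for 0, continuous (derive1 f)} := smooth_continuous (smooth_derive1 Hf) B0.
have [d d0 Hd] : exists2 d, 0 < d & forall x, `|x| < d -> 0 < derive1 f x.
  by apply: near0_ball; apply: (c' [set y | 0 < y]); exact: nbhs_gt.
(* Halving keeps the closed interval [[-q, q]] inside the ball where [f] is smooth with positive
   derivative. *)
pose q := Num.min d r / 2.
have q0 : 0 < q by rewrite divr_gt0 // lt_min d0.
have qd : q < d.
  by rewrite /q ltr_pdivrMr // gt_min ltr_pMr ?ltr1n.
have qr : q < r.
  by rewrite /q ltr_pdivrMr // gt_min [r < r * 2]ltr_pMr ?ltr1n // orbT.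
have Bq x : x \in `[-q, q]%R -> B r x.
  by rewrite in_itv /= -ler_norml => h; exact: le_lt_trans qr.
have fc : {within `[-q, q], continuous f}.
  apply: continuous_in_subspaceT => x; rewrite inE => /Bq.
  exact: smooth_continuous.
have mono : {in `[-q, q]%R &, {homo f : x y / x < y}}.
  apply: gtr0_derive1_lt_cc fc => x; rewrite in_itv /= -ltr_norml => xq.
    by have [] := smooth_is_derive Hf (lt_trans xq qr : B r x).
  exact/Hd/(lt_trans xq).
have inj x y : `|x| <= q -> `|y| <= q -> f x = f y -> x = y.
  move=> xq yq fxy; have xI : x \in `[-q, q]%R by rewrite in_itv /= -ler_norml.
  have yI : y \in `[-q, q]%R by rewrite in_itv /= -ler_norml.
  case: (ltrgtP x y) => // h.
    by have := mono _ _ xI yI h; rewrite fxy ltxx.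
  by have := mono _ _ yI xI h; rewrite fxy ltxx.
have qI : q \in `[-q, q]%R by rewrite in_itv /= lexx andbT; lra.
have NqI : - q \in `[-q, q]%R by rewrite in_itv /= lexx /=; lra.
have OI : 0 \in `[-q, q]%R by rewrite in_itv /=; apply/andP; split; lra.
have fq : 0 < f q by rewrite -f0; apply: mono.
have fNq : f (- q) < 0 by rewrite -f0; apply: mono; rewrite // oppr_lt0.
pose g u := xget 0 [set s | `|s| <= q /\ f s = u].
have gP s : `|s| <= q -> g (f s) = s.
  move=> sq; rewrite /g; case: xgetP => [z _ [zq fz]|/(_ s)]; last by case.
  exact: inj.
(* The interval of radius [r2] lies in the range of [f] on [[-q, q]]; the default value of [xget]
   matters only outside that range. *)
pose r2 := Num.min (f q) (- f (- q)).
have gB u : `|u| < r2 -> `|g u| < q /\ f (g u) = u.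
  rewrite lt_min !ltr_norml => /andP[/andP[_ h1] /andP[h2 _]].
  have NqLq : - q <= q by lra.
  have fle : f (- q) <= f q := ltW (lt_trans fNq fq).
  have [|s sI fs] := @IVT R f (-q) q u NqLq fc.
    rewrite (min_l fle) (max_r fle) (ltW h1) andbT.
    by rewrite opprK in h2; exact: ltW.
  have sq : `|s| <= q by rewrite ler_norml; move: sI; rewrite in_itv.
  rewrite -fs gP //; split => //; rewrite -ltr_norml lt_neqAle sq andbT.
  apply/eqP => sE; have [/ger0_norm|/ltr0_norm] := lerP 0 s; rewrite sE => sE'.
    by move: h1; rewrite -fs -sE' ltxx.
  have sE2 : s = - q by rewrite sE' opprK.
  by move: h2; rewrite -fs sE2 opprK ltxx.
exists g, q, r2; split => //.
- by rewrite q0 ltW.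
- by rewrite lt_min fq oppr_gt0.
- have r2o : open (B r2) by exact: open_centered_ball.
  have d'0 u : B r2 u -> derive1 f (g u) != 0.
    by move=> /gB[gu _]; rewrite gt_eqF //; apply/Hd/(lt_trans gu).
  apply: (@smooth_bootstrap R (B r2) g (fun u => (derive1 f (g u))^-1) r2o).
    move=> u ur; have [gu fgu] := gB _ ur.
    rewrite -{1}fgu; apply: is_derive_inverse.
    + by apply: (ballC_near gu) => y yq; exact/gP/ltW.
    + apply: (ballC_near gu) => y yq; apply: smooth_continuous Hf _.
      exact: lt_trans qr.
    + by apply: smooth_is_derive Hf _; exact: lt_trans qr.
    + exact: d'0.
  move=> k Hk; apply: Ck_onV => //.
  apply: (@Ck_on_comp _ _ k (B r2) (B r) g (derive1 f)) => //.
    by move=> u /gB[gu _]; exact: lt_trans qr.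
  exact: smooth_Ck (smooth_derive1 Hf).
- by move=> s sq; exact/gP/ltW.
Qed.

Lemma smooth_oppr_comp r f : smooth (B r) f -> smooth (B r) (fun x => f (- x)).
Proof.
move=> Hf; have oB := @open_centered_ball R r.
apply: (@smooth_comp _ _ (B r) (B r) -%R f) => //; last exact: smoothN (smooth_id _).
by move=> x /=; rewrite normrN.
Qed.

(** The even part of [f] yields the odd part of [x ^ 3 * f x], the odd part of [f] its even part.
    Whitney's theorem makes both factors functions of [x ^ 2], and the value of [f] at [0] passes to
    [k]. *)
Lemma even_odd_split r f : 0 < r -> smooth (B r) f ->
  exists g k, [/\ smooth (B (r ^+ 2)) g, smooth (B (r ^+ 2)) k, k 0 = f 0 &
   forall x, B r x -> x ^+ 3 * f x = g (x ^+ 2) + x ^+ 3 * k (x ^+ 2)].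
Proof.
move=> r0 Hf0; have oB := @open_centered_ball R r.
pose f1 x := if `|x| < r then f x else 0.
have Hf : smooth (B r) f1.
  by apply: smooth_eq Hf0 => // x /= xr; rewrite /f1 xr.
have HfN := smooth_oppr_comp Hf.
have Hc (c : R) : smooth (B r) (fun=> c) by exact: smooth_cst.
have [k Hk kE] : exists2 k, smooth (B (r ^+ 2)) k &
    forall x, B r x -> 2^-1 * (f1 x + f1 (- x)) = k (x ^+ 2).
  apply: (@smooth_even _ r (fun x => 2^-1 * (f1 x + f1 (- x)))) => //.
    by apply: smoothM => //; exact: smoothD.
  by move=> x; rewrite opprK addrC.
have [g Hg gE] : exists2 g, smooth (B (r ^+ 2)) g &
    forall x, B r x -> x ^+ 3 * (2^-1 * (f1 x - f1 (- x))) = g (x ^+ 2).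
  apply: (@smooth_even _ r (fun x => x ^+ 3 * (2^-1 * (f1 x - f1 (- x))))) => //.
    apply: smoothM => //; first by apply: smoothX => //; exact: smooth_id.
    by apply: smoothM => //; exact: smoothB.
  by move=> x; rewrite opprK; ring.
exists g, k; split => //.
  have B0 : B r 0 by rewrite /= normr0.
  have := kE _ B0; rewrite expr0n /= oppr0 => <-.
  by rewrite /f1 normr0 r0; field.
move=> x xr; rewrite -gE // -kE //.
have -> : f x = f1 x by rewrite /f1 (xr : `|x| < r).
by field.
Qed.

(** Here [sg] is the sign of the second derivative of [be] at [0]. The last clause says that [tau]
    maps every neighbourhood of [0] onto a neighbourhood of [0]; it is what makes the image of an
    arbitrarily short interval fill a full germ of the cusp. *)
Lemma cusp_normal_form0 r (be ga : R -> R) : 0 < r ->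
  smooth (B r) be -> smooth (B r) ga ->
  be 0 = 0 -> derive1n 1 be 0 = 0 -> derive1n 2 be 0 <> 0 ->
  ga 0 = 0 -> derive1n 1 ga 0 = 0 -> derive1n 2 ga 0 = 0 -> derive1n 3 ga 0 <> 0 ->
  exists e rho sg g k tau, [/\ [/\ 0 < e, e <= r, 0 < rho & sg * sg = 1],
    [/\ smooth (B rho) g, smooth (B rho) k & forall x, `|x| < rho -> k x != 0],
    forall s, `|s| < e -> [/\ tau s ^+ 2 < rho, be s = sg * tau s ^+ 2 &
      ga s = g (tau s ^+ 2) + tau s ^+ 3 * k (tau s ^+ 2)] &
    forall eta, 0 < eta -> exists2 d, 0 < d &
      forall u, `|u| < d -> exists s, [/\ `|s| < eta, `|s| < e & tau s = u]].
Proof.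
move=> r0 Hbe Hga b0 b1 b2 g0 g1 g2 g3.
have [be1 [Hbe1 beE be1d]] := hadamard1n r0 Hbe b0.
have be10 : be1 0 = 0 by have := be1d 0%N; rewrite b1 mul1r derive1n0 => <-.
have [be2 [Hbe2 be1E be2d]] := hadamard1n r0 Hbe1 be10.
have be20 : be2 0 != 0.
  apply/eqP => h; apply: b2; rewrite be1d be2d derive1n0 h !mulr0.
  by [].
have [ga1 [Hga1 gaE ga1d]] := hadamard1n r0 Hga g0.
have ga10 : ga1 0 = 0 by have := ga1d 0%N; rewrite g1 mul1r derive1n0 => <-.
have [ga2 [Hga2 ga1E ga2d]] := hadamard1n r0 Hga1 ga10.
have ga20 : ga2 0 = 0.
  have := ga1d 1%N; rewrite g2 ga2d mul1r derive1n0 => /esym/eqP.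
  by rewrite mulf_eq0 pnatr_eq0 /= => /eqP.
have [ga3 [Hga3 ga2E ga3d]] := hadamard1n r0 Hga2 ga20.
have ga30 : ga3 0 != 0.
  by apply/eqP => h; apply: g3; rewrite ga1d ga2d ga3d derive1n0 h !mulr0.
move=> {b2 g3}.
have [sg sg1 sgp] : exists2 sg : R, sg * sg = 1 & 0 < sg * be2 0.
  have [h|h|h] := ltrgtP 0 (be2 0).
  - by exists 1; rewrite mul1r.
  - by exists (-1); rewrite mulN1r ?opprK ?oppr_gt0.
  - by move: be20; rewrite -h eqxx.
(* [be = sg * tau ^ 2] and [ga = tau ^ 3 * K(tau)] for the parameter
   [tau = s * sqrt A]; then the odd part of [tau ^ 3 * K(tau)] is [tau ^ 3] times
   a function of [tau ^ 2]. *)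
pose A s := sg * be2 s.
have oBr : open (B r) by exact: open_centered_ball.
have HA : smooth (B r) A.
  exact: (smoothM oBr (smooth_cst (B r) sg) Hbe2).
have B0 : B r 0 by rewrite /= normr0.
have [d d0 Hd] : exists2 d, 0 < d & forall x, `|x| < d -> 0 < A x.
  apply: near0_ball; have c := smooth_continuous HA B0; apply: (c [set y | 0 < y]).
  exact: nbhs_gt.
have [p [p0 pr pd]] : exists p, [/\ 0 < p, p <= r & p <= d].
  by exists (Num.min d r); rewrite lt_min d0 r0 !ge_min !lexx orbT.
have Ap x : `|x| < p -> 0 < A x by move=> xp; apply: Hd; exact: lt_le_trans pd.
have BB : B p `<=` B r by move=> x /= xp; exact: lt_le_trans pr.
have oBp : open (B p) by exact: open_centered_ball.
pose b s := Num.sqrt (A s).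
have Hb : smooth (B p) b by apply: smooth_sqrt => //; exact: smooth_sub HA.
have bp s : `|s| < p -> 0 < b s by move=> /Ap h; rewrite sqrtr_gt0.
pose tau s := s * b s.
have Htau : smooth (B p) tau by apply: smoothM => //; exact: smooth_id.
have tau0 : tau 0 = 0 by rewrite /tau mul0r.
have Bp0 : B p 0 by rewrite /= normr0.
have tau'0 : 0 < derive1 tau 0.
  rewrite (derive1_val (is_derive1M (is_derive_id 0 (1:R)) (smooth_is_derive Hb Bp0))).
  by rewrite mul0r addr0 mul1r; exact: bp.
have [th [r1 [r2 [/andP[r10 r1p] r20 Hth thB thK]]]] := smooth_inverse p0 Htau tau0 tau'0.
have oB2 : open (B r2) by exact: open_centered_ball.
have thp u : B r2 u -> B p (th u) by move=> /thB[h _]; exact: lt_le_trans r1p.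
pose K u := ga3 (th u) / b (th u) ^+ 3.
have HK : smooth (B r2) K.
  apply: smoothM => //.
    by apply: smooth_comp Hth Hga3 => // u /thp; exact: BB.
  apply: smoothV => //.
    by move=> u /thp/bp h; rewrite expf_neq0 // gt_eqF.
  by apply: smoothX => //; exact: smooth_comp Hth Hb.
have th0 : th 0 = 0 by rewrite -{1}tau0 thK // normr0.
have gaK s : `|s| < r1 -> ga s = tau s ^+ 3 * K (tau s).
  move=> sr; rewrite gaE ga1E ga2E /K thK //.
  have : b s != 0 by rewrite gt_eqF // bp //; exact: lt_le_trans r1p.
  by rewrite /tau => bs0; field.
have beT s : `|s| < p -> be s = sg * tau s ^+ 2.
  move=> sp; rewrite beE be1E /tau exprMn sqr_sqrtr ?ltW ?Ap // /A.
  have -> : sg * (s ^+ 2 * (sg * be2 s)) = (sg * sg) * (s * (s * be2 s)) by ring.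
  by rewrite sg1 mul1r.
have [g [k [Hg Hk k0 gkE]]] := even_odd_split r20 HK.
have {}k0 : k 0 != 0.
  by rewrite k0 /K th0 mulf_neq0 // invr_neq0 // expf_neq0 // gt_eqF // bp // normr0.
have r220 : 0 < r2 ^+ 2 by rewrite exprn_gt0.
have B20 : B (r2 ^+ 2) 0 by rewrite /= normr0.
have [d1 d10 Hd1] : exists2 d, 0 < d & forall x, `|x| < d -> k x != 0.
  apply: near0_ball; have c := smooth_continuous Hk B20; apply: (c [set y | y != 0]).
  by apply: open_nbhs_nbhs; split => //; exact: open_neq.
have [rho [rho0 rhod rhor]] : exists rho, [/\ 0 < rho, rho <= d1 & rho <= r2 ^+ 2].
  by exists (Num.min d1 (r2 ^+ 2)); rewrite lt_min d10 r220 !ge_min !lexx orbT.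
have rhoS : B rho `<=` B (r2 ^+ 2) by move=> x /= xr; exact: lt_le_trans rhor.
have [d2 d20 Hd2] : exists2 d, 0 < d & forall s, `|s| < d -> tau s ^+ 2 < rho.
  have Ht2 : smooth (B p) (fun s => tau s ^+ 2) by exact: smoothX.
  apply: near0_ball; have c := smooth_continuous Ht2 Bp0; apply: (c [set y | y < rho]).
  by rewrite /= tau0 expr0n /=; exact: nbhs_lt.
pose e := Num.min d2 r1.
have e0 : 0 < e by rewrite lt_min d20.
exists e, rho, sg, g, k, tau; split.
- by split => //; rewrite ge_min (le_trans r1p pr) orbT.
- split; [exact: smooth_sub Hg|exact: smooth_sub Hk|].
  by move=> x xr; apply: Hd1; exact: lt_le_trans rhod.
- move=> s; rewrite lt_min => /andP[sd sr]; have trho := Hd2 _ sd; split => //.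
    by apply: beT; exact: lt_le_trans r1p.
  rewrite gaK // gkE //= -ltr_sqr ?nnegrE ?(ltW r20) // real_normK ?num_real //.
  exact: lt_le_trans rhor.
- move=> eta eta0.
  have B20' : B r2 0 by rewrite /= normr0.
  have [d3 d30 Hd3] : exists2 d, 0 < d & forall u, `|u| < d -> `|th u| < Num.min eta e.
    apply: near0_ball.
    have c := smooth_continuous Hth B20'; apply: (c [set y | `|y| < Num.min eta e]).
    rewrite th0; apply: open_nbhs_nbhs; split; first exact: open_centered_ball.
    by rewrite /= normr0 lt_min eta0.
  exists (Num.min d3 r2); first by rewrite lt_min d30.
  move=> u; rewrite lt_min => /andP[ud ur]; exists (th u).
  have := Hd3 _ ud; rewrite lt_min => /andP[-> ->]; split => //.
  by have [] := thB _ ur.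
Qed.

End NormalForm.

Lemma nbhs_setI (T : topologicalType) (x : T) (A B : set T) :
  nbhs x A -> nbhs x B -> nbhs x (A `&` B).
Proof. exact: filterI. Qed.

(** * Planar fronts and the cusp equation *)

Section PlanarFronts.
Context {R : realType}.
Implicit Types (r x t s : R).
Local Notation smooth := smooth_on_open.
Local Notation B r := [set x : R | `|x| < r].

(** With [dl] and [d] vanishing at [0], the jets there are [be'' = dl' * a], [ga'' = dl' * d = 0]
    and [ga''' = 2 * dl' * d']. *)
Lemma front_normal_form0 r (be ga dl a d : R -> R) : 0 < r ->
  smooth (B r) be -> smooth (B r) ga -> smooth (B r) dl -> smooth (B r) a -> smooth (B r) d ->
  (forall s, B r s -> is_derive s 1 be (dl s * a s)) ->
  (forall s, B r s -> is_derive s 1 ga (dl s * d s)) ->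
  be 0 = 0 -> ga 0 = 0 -> a 0 != 0 -> d 0 = 0 -> derive1 d 0 != 0 ->
  dl 0 = 0 -> derive1 dl 0 != 0 ->
  exists e rho sg g k tau, [/\ [/\ 0 < e, e <= r, 0 < rho & sg * sg = 1],
    [/\ smooth (B rho) g, smooth (B rho) k & forall x, `|x| < rho -> k x != 0],
    forall s, `|s| < e -> [/\ tau s ^+ 2 < rho, be s = sg * tau s ^+ 2 &
      ga s = g (tau s ^+ 2) + tau s ^+ 3 * k (tau s ^+ 2)] &
    forall eta, 0 < eta -> exists2 d, 0 < d &
      forall u, `|u| < d -> exists s, [/\ `|s| < eta, `|s| < e & tau s = u]].
Proof.
move=> r0 Hbe Hga Hdl Ha Hd dbe dga be0 ga0 a0 d0 d'0 dl0 dl'0.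
have B0 : B r 0 by rewrite /= normr0.
have d1 (f : R -> R) s : smooth (B r) f -> B r s -> is_derive s 1 f (derive1 f s).
  by move=> Hf; exact: smooth_is_derive.
have M1 (f : R -> R) s : B r s -> smooth (B r) f ->
  is_derive s 1 (fun s => dl s * f s) (derive1 dl s * f s + dl s * derive1 f s).
  by move=> Bs Hf; apply: is_derive1M; exact: d1.
apply: cusp_normal_form0 => //.
- by rewrite derive1nS derive1n0 (derive1_val (dbe _ B0)) dl0 mul0r.
- rewrite derive1nS derive1nS derive1n0.
  have H : is_derive (0:R) 1 (derive1 be) (derive1 dl 0 * a 0 + dl 0 * derive1 a 0).
    apply: (@is_derive1_eq_near _ (fun s => dl s * a s)); last exact: M1.
    by apply: (ballC_near B0) => s Bs; rewrite (derive1_val (dbe _ Bs)).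
  by rewrite (derive1_val H) dl0 mul0r addr0; apply/eqP; rewrite mulf_neq0.
- by rewrite derive1nS derive1n0 (derive1_val (dga _ B0)) dl0 mul0r.
- rewrite derive1nS derive1nS derive1n0.
  have H : is_derive (0:R) 1 (derive1 ga) (derive1 dl 0 * d 0 + dl 0 * derive1 d 0).
    apply: (@is_derive1_eq_near _ (fun s => dl s * d s)); last exact: M1.
    by apply: (ballC_near B0) => s Bs; rewrite (derive1_val (dga _ Bs)).
  by rewrite (derive1_val H) dl0 mul0r addr0 d0 mulr0.
- rewrite derive1nS derive1nS derive1nS derive1n0.
  have H s (Bs : B r s) : is_derive s 1 (derive1 ga) (derive1 dl s * d s + dl s * derive1 d s).
    apply: (@is_derive1_eq_near _ (fun s => dl s * d s)); last exact: M1.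
    by apply: (ballC_near Bs) => t Bt; rewrite (derive1_val (dga _ Bt)).
  have Hdl' := smooth_derive1 Hdl; have Hd' := smooth_derive1 Hd.
  have H2 : is_derive (0:R) 1 (derive1 (derive1 ga))
    (derive1 (derive1 dl) 0 * d 0 + derive1 dl 0 * derive1 d 0 +
     (derive1 dl 0 * derive1 d 0 + dl 0 * derive1 (derive1 d) 0)).
    apply: (@is_derive1_eq_near _ (fun s => derive1 dl s * d s + dl s * derive1 d s)).
      by apply: (ballC_near B0) => s Bs; rewrite (derive1_val (H _ Bs)).
    by apply: is_derive1D; apply: is_derive1M; exact: d1.
  rewrite (derive1_val H2) d0 dl0 mulr0 mul0r add0r addr0; apply/eqP.
  by rewrite -mulr2n mulrn_eq0 /= mulf_neq0.
Qed.

Lemma front_normal_form (N : set R) s0 (be ga dl a d : R -> R) : open N -> N s0 ->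
  smooth N be -> smooth N ga -> smooth N dl -> smooth N a -> smooth N d ->
  (forall s, N s -> is_derive s 1 be (dl s * a s)) ->
  (forall s, N s -> is_derive s 1 ga (dl s * d s)) ->
  be s0 = 0 -> ga s0 = 0 -> a s0 != 0 -> d s0 = 0 -> derive1 d s0 != 0 ->
  dl s0 = 0 -> derive1 dl s0 != 0 ->
  exists e rho sg g k tau, [/\ [/\ 0 < e, 0 < rho & sg * sg = 1],
    [/\ smooth (B rho) g, smooth (B rho) k & forall x, `|x| < rho -> k x != 0],
    forall s, `|s - s0| < e -> [/\ tau s ^+ 2 < rho, be s = sg * tau s ^+ 2 &
      ga s = g (tau s ^+ 2) + tau s ^+ 3 * k (tau s ^+ 2)] &
    forall eta, 0 < eta -> exists2 d, 0 < d &
      forall u, `|u| < d -> exists s, [/\ `|s - s0| < eta, `|s - s0| < e & tau s = u]].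
Proof.
move=> oN N0 Hbe Hga Hdl Ha Hd dbe dga be0 ga0 a0 d0 d'0 dl0 dl'0.
have [r r0 Hr] : exists2 r, 0 < r & forall x, `|x| < r -> N (x + s0).
  have /nbhs_ballP [r /= r0 H] : nbhs s0 N by exact: open_nbhs_nbhs.
  exists r => // x xr; apply: H; rewrite /ball /= opprD addrCA subrr addr0.
  by rewrite normrN.
have oB := @open_centered_ball R r.
have sh (f : R -> R) : smooth N f -> smooth (B r) (fun x => f (x + s0)).
  move=> Hf; have Hs : smooth (B r) (fun x => x + s0).
    by apply: smoothD => //; [exact: smooth_id|exact: smooth_cst].
  exact: (smooth_comp oB Hr Hs Hf).
have dsh (f : R -> R) l x : is_derive (x + s0) 1 f l -> is_derive x 1 (fun x => f (x + s0)) l.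
  move=> Hf; have Hs : is_derive x 1 (fun x => x + s0) (1 + 0).
    exact: is_derive1D (is_derive_id x (1:R)) (is_derive_cst s0 x 1).
  have := @is_derive1_comp R f (fun x => x + s0) x l (1 + 0) Hf Hs.
  by rewrite addr0 mulr1.
have sh' (f : R -> R) : smooth N f -> derive1 (fun x => f (x + s0)) 0 = derive1 f s0.
  move=> Hf; apply: derive1_val; apply: dsh; rewrite add0r.
  exact: smooth_is_derive Hf N0.
have [|||||||||||||| e [rho [sg [g [k [tau [[e0 er rho0 sg1] H1 H2 H3]]]]]]] :=
  @front_normal_form0 r (fun x => be (x + s0)) (fun x => ga (x + s0))
    (fun x => dl (x + s0)) (fun x => a (x + s0)) (fun x => d (x + s0)) r0;
  rewrite ?add0r ?sh' //; try exact: sh.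
- by move=> s Bs; apply: dsh; apply: dbe; exact: Hr.
- by move=> s Bs; apply: dsh; apply: dga; exact: Hr.
exists e, rho, sg, g, k, (fun s => tau (s - s0)); split => //.
  by move=> s se; have := H2 _ se; rewrite subrK.
move=> eta eta0; have [c c0 Hc] := H3 _ eta0; exists c => // u uc.
have [s [h1 h2 h3]] := Hc _ uc; exists (s + s0).
by rewrite addrK.
Qed.

Lemma near_derive_neq0 (f : R -> R) s l : f s = 0 -> is_derive s 1 f l -> l != 0 ->
  exists2 d, 0 < d & forall h, `|h| < d -> h != 0 -> f (s + h) != 0.
Proof.
move=> f0 Hf l0; have l20 : 0 < `|l| / 2 by rewrite divr_gt0 ?normr_gt0.
have [d d0 Hd] := proj1 (is_derive1P _ _ _) Hf _ l20; exists d => // h hd h0.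
apply/eqP => fh; have := Hd h hd; rewrite fh f0 subr0 sub0r normrN normrM mulrC.
have h1 : 0 < `|h| by rewrite normr_gt0.
rewrite ler_pM2r // => h2; have : 0 < `|l| by rewrite normr_gt0.
by lra.
Qed.

(** The equation forces [q >= 0], so [q] has a minimum at [s] and [q' = 0]; moreover
    [|p| = q ^ (3/2)] is of order [3/2] in the increment, so [p' = 0]. *)
Lemma cusp_curve_singular (p q : R -> R) s p' q' :
  (\near s, p s ^+ 2 = q s ^+ 3) -> p s = 0 -> q s = 0 ->
  is_derive s 1 p p' -> is_derive s 1 q q' -> p' = 0 /\ q' = 0.
Proof.
move=> /nbhs_ballP[r /= r0 Hr] p0 q0 Hp Hq.
have pq h : `|h| < r -> p (s + h) ^+ 2 = q (s + h) ^+ 3.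
  move=> hr; apply: Hr; rewrite /ball /= opprD addrA subrr add0r normrN.
  by [].
have qge h : `|h| < r -> 0 <= q (s + h).
  move=> hr; rewrite leNgt; apply/negP => qn.
  have := sqr_ge0 (p (s + h)); rewrite pq // leNgt => /negP; apply.
  by rewrite exprS pmulr_llt0 // exprn_even_gt0 //= lt_eqF.
split.
  apply/eqP; apply/negPn/negP => p'0.
  have e0 : 0 < `|p'| / 2 by rewrite divr_gt0 ?normr_gt0.
  have [d1 d10 Hd1] := proj1 (is_derive1P _ _ _) Hp _ e0.
  have [d2 d20 Hd2] := proj1 (is_derive1P _ _ _) Hq _ ltr01.
  pose C := `|q'| + 1; have C0 : 0 < C by rewrite ltr_wpDl.
  (* If [p' != 0], then [|p| >= |p'| / 2 * h] and [|q| <= C * h], so the cusp equation gives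
     [(|p'| / 2) ^ 2 <= h * C ^ 3]. The last bound on [h] excludes this. *)
  pose h := Num.min (Num.min d1 d2) (Num.min r ((`|p'| / 2) ^+ 2 / C ^+ 3)) / 2.
  have m0 : 0 < Num.min (Num.min d1 d2) (Num.min r ((`|p'| / 2) ^+ 2 / C ^+ 3)).
    by rewrite !lt_min d10 d20 r0 divr_gt0 // exprn_gt0.
  have h0 : 0 < h by rewrite divr_gt0.
  have : h < Num.min (Num.min d1 d2) (Num.min r ((`|p'| / 2) ^+ 2 / C ^+ 3)).
    by rewrite /h ltr_pdivrMr // ltr_pMr ?ltr1n.
  have hE : `|h| = h by rewrite ger0_norm // ltW.
  rewrite !lt_min => /andP[/andP[hd1 hd2] /andP[hr]].
  rewrite ltr_pdivlMr ?exprn_gt0 // => hC.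
  have := Hd1 h; rewrite p0 subr0 hE => /(_ hd1) h1.
  have := Hd2 h; rewrite q0 subr0 hE mul1r => /(_ hd2) h2.
  have hp : `|p'| / 2 * h <= `|p (s + h)|.
    have := ler_normB (p (s + h)) (p (s + h) - h * p').
    rewrite opprB addrCA subrr addr0 normrM hE; move: h1; lra.
  have hq : `|q (s + h)| <= C * h.
    have := ler_normD (q (s + h) - h * q') (h * q').
    by rewrite subrK normrM hE /C; move: h2; lra.
  have hpq : `|p (s + h)| ^+ 2 = `|q (s + h)| ^+ 3 by rewrite -!normrX pq ?hE.
  have l1 : (`|p'| / 2 * h) ^+ 2 <= `|p (s + h)| ^+ 2.
    by rewrite lerXn2r // nnegrE mulr_ge0 // ltW.
  have l2 : `|q (s + h)| ^+ 3 <= (C * h) ^+ 3.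
    by rewrite lerXn2r // nnegrE mulr_ge0 // ltW.
  have : (`|p'| / 2) ^+ 2 * h ^+ 2 <= h * C ^+ 3 * h ^+ 2.
    rewrite -exprMn; apply: (le_trans l1); rewrite hpq; apply: (le_trans l2).
    by rewrite exprMn [h ^+ 3]exprS mulrCA mulrA.
  by rewrite ler_pM2r ?exprn_gt0 // leNgt hC.
apply/eqP; apply/negPn/negP => q'0.
have e0 : 0 < `|q'| / 2 by rewrite divr_gt0 ?normr_gt0.
have [d2 d20 Hd2] := proj1 (is_derive1P _ _ _) Hq _ e0.
(* A step against the sign of [q'] would make [q] negative. *)
pose h := - Num.sg q' * (Num.min r d2 / 2).
have m0 : 0 < Num.min r d2 by rewrite lt_min r0.
have hE : `|h| = Num.min r d2 / 2.
  by rewrite normrM normrN normr_sg q'0 mul1r ger0_norm // divr_ge0 // ltW.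
have h0 : 0 < `|h| by rewrite hE divr_gt0.
have : `|h| < Num.min r d2 by rewrite hE ltr_pdivrMr // ltr_pMr ?ltr1n.
rewrite lt_min => /andP[hr hd2].
have hq : h * q' = - (`|h| * `|q'|).
  by rewrite hE [`|q'|]normrEsg /h; ring.
have := Hd2 h hd2; rewrite q0 subr0 hq opprK => h1.
have := qge h hr; have := ler_norm (q (s + h) + `|h| * `|q'|).
have : 0 < `|h| * `|q'| by rewrite mulr_gt0 // normr_gt0.
by move: h1; move: (`|h|) (`|q'|) => x y; lra.
Qed.

(* On [dl != 0] the cusp equation and its derivative give [9 q V2^2 = 4 V1^2],
   so either [dl] vanishes near [s0] or [V1 s0 = 0].  Differentiating once more,
   [dl] agrees where it is nonzero with a function having a nonzero derivative
   at [s0]; if [dl'(s0) = 0] this forces [dl = 0] near [s0]. *)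
Lemma cusp_front_derivative (N : set R) s0 (p q dl V1 V2 : R -> R) :
  open N -> N s0 -> smooth N p -> smooth N q -> smooth N dl -> smooth N V1 -> smooth N V2 ->
  (forall s, N s -> is_derive s 1 p (dl s * V1 s)) ->
  (forall s, N s -> is_derive s 1 q (dl s * V2 s)) ->
  (forall s, N s -> p s ^+ 2 = q s ^+ 3) -> p s0 = 0 -> q s0 = 0 ->
  (V1 s0 != 0) || (V2 s0 != 0) ->
  (dl s0 = 0 -> V1 s0 * derive1 V2 s0 - V2 s0 * derive1 V1 s0 != 0) ->
  (\forall s \near s0, dl s = 0) \/ (dl s0 = 0 /\ derive1 dl s0 != 0).
Proof.
move=> oN N0 Hp Hq Hdl HV1 HV2 dp dq pq p0 q0 V0 Hdet.
have nN s : N s -> nbhs s N by move=> Ns; exact: open_nbhs_nbhs.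
have sing s : N s -> p s = 0 -> q s = 0 -> dl s * V1 s = 0 /\ dl s * V2 s = 0.
  move=> Ns ps qs; apply: (cusp_curve_singular _ ps qs (dp _ Ns) (dq _ Ns)).
  exact: (@filterS _ (nbhs s) _ N _ pq (nN _ Ns)).
have dl0 : dl s0 = 0.
  have [/eqP h1 /eqP h2] := sing _ N0 p0 q0.
  by move: h1 h2 V0; rewrite !mulf_eq0; case: (dl s0 =P 0) => //= _ -> ->.
have {}Hdet := Hdet dl0.
have [|dl'0] := eqVneq (derive1 dl s0) 0; last by right.
move=> dl'0; left.
have dV (f : R -> R) s : smooth N f -> N s -> is_derive s 1 f (derive1 f s).
  by move=> Hf; exact: smooth_is_derive.
have Vnear : \forall s \near s0, (V1 s != 0) || (V2 s != 0).
  have c1 := smooth_continuous HV1 N0; have c2 := smooth_continuous HV2 N0.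
  have n0 (x : R) : x != 0 -> nbhs x [set y | y != 0].
    by move=> x0; apply: open_nbhs_nbhs; split => //; exact: open_neq.
  case/orP: V0 => h.
    have := c1 _ (n0 _ h); apply: (@filterS _ (nbhs s0)) => s /= hs.
    by apply/orP; left.
  have := c2 _ (n0 _ h); apply: (@filterS _ (nbhs s0)) => s /= hs.
  by apply/orP; right.
have [M [oM M0 MN MV]] : exists M : set R, [/\ open M, M s0, M `<=` N &
    forall s, M s -> (V1 s != 0) || (V2 s != 0)].
  have := nbhs_setI (nN _ N0) Vnear; rewrite nbhsE => -[M [oM M0] H].
  by exists M; split => //; [move=> s /H[]|move=> s /H[]].
pose E s := 9 * q s * V2 s ^+ 2 - 4 * V1 s ^+ 2.
have E0 s : M s -> dl s != 0 -> E s = 0.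
  move=> Ms ds; have Ns := MN _ Ms.
  have q3 : p s ^+ 2 = q s ^+ 3 by exact: pq.
  have q0' : q s != 0.
    apply/eqP => qs; have ps : p s = 0.
      by move: q3; rewrite qs expr0n /= => /eqP; rewrite sqrf_eq0 => /eqP.
    have [/eqP h1 /eqP h2] := sing _ Ns ps qs; move: h1 h2 (MV _ Ms).
    by rewrite !mulf_eq0 (negbTE ds) /= => -> ->.
  have H1 : is_derive s 1 (fun s => p s ^+ 2 - q s ^+ 3)
     (2%:R * p s ^+ 1 * (dl s * V1 s) - 3%:R * q s ^+ 2 * (dl s * V2 s)).
    by apply: is_derive1B; apply: is_derive1X; [exact: dp|exact: dq].
  have H2 : is_derive s 1 (fun s => p s ^+ 2 - q s ^+ 3) 0.
    apply: (@is_derive1_eq_near _ (fun=> 0)).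
    apply: (@filterS _ (nbhs s) _ N) => [t Nt|]; last exact: nN.
    by rewrite pq // subrr.
  have : 2%:R * p s ^+ 1 * (dl s * V1 s) - 3%:R * q s ^+ 2 * (dl s * V2 s) = 0.
    by rewrite -(derive1_val H1) (derive1_val H2).
  rewrite expr1 => h.
  have h2 : 2 * p s * V1 s = 3 * q s ^+ 2 * V2 s.
    by apply: (mulfI ds); move: h => /eqP; rewrite subr_eq0 => /eqP h; lra.
  apply: (mulfI (expf_neq0 3 q0')); rewrite mulr0 /E.
  have -> : q s ^+ 3 * (9 * q s * V2 s ^+ 2 - 4 * V1 s ^+ 2) =
    (3 * q s ^+ 2 * V2 s) ^+ 2 - 4 * q s ^+ 3 * V1 s ^+ 2 by ring.
  by rewrite -q3 -h2; ring.
have HE : smooth N E.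
  apply: smoothB => //.
    apply: smoothM => //; last exact: smoothX.
    by apply: smoothM => //; exact: smooth_cst.
  by apply: smoothM => //; [exact: smooth_cst|exact: smoothX].
have [V10|V10] := eqVneq (V1 s0) 0; last first.
  have Es0 : E s0 != 0.
    by rewrite /E q0 mulr0 mul0r sub0r oppr_eq0 mulf_neq0 // expf_neq0.
  have c := smooth_continuous HE N0.
  have : nbhs s0 [set s | E s != 0].
    by apply: (c [set y | y != 0]); apply: open_nbhs_nbhs; split => //; exact: open_neq.
  move=> nE; have nM : nbhs s0 M by apply: open_nbhs_nbhs.
  apply: (@filterS _ (nbhs s0) _ _ _ _ (nbhs_setI nM nE)) => s [Ms Es].
  by apply/eqP; apply/negPn/negP => /(E0 _ Ms) h; rewrite /= h eqxx in Es.
(* This is the derivative of [E] with [dl * V2] written for that of [q]. It vanishes at [s0], and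
   since [dl], [dl'], [q] and [V1] vanish there, only [-8 * V1'(s0) ^ 2] survives in its own
   derivative. So [s0] is an isolated zero of [E'], while [E'] vanishes wherever [dl] does not. *)
pose E' s := 9 * (dl s * V2 s) * V2 s ^+ 2 + 9 * q s * (2%:R * V2 s ^+ 1 * derive1 V2 s) -
   4 * (2%:R * V1 s ^+ 1 * derive1 V1 s).
have dE s : N s -> is_derive s 1 E (E' s).
  move=> Ns; apply: is_derive1B.
    apply: is_derive1M; first by apply: is_derive1Ml; exact: dq.
    by apply: is_derive1X; exact: dV.
  by apply: is_derive1Ml; apply: is_derive1X; exact: dV.
have V1'0 : derive1 V1 s0 != 0.
  by apply/eqP => h; move: Hdet; rewrite V10 h mul0r mulr0 subr0 eqxx.
have E'0 s : M s -> dl s != 0 -> E' s = 0.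
  move=> Ms ds; have Ns := MN _ Ms.
  rewrite -(derive1_val (dE _ Ns)); apply: derive1_val.
  apply: (@is_derive1_eq_near _ (fun=> 0)).
  have nM : nbhs s M by apply: open_nbhs_nbhs.
  have nd : nbhs s [set s | dl s != 0].
    have c := smooth_continuous Hdl Ns; apply: (c [set y | y != 0]).
    by apply: open_nbhs_nbhs; split => //; exact: open_neq.
  by apply: (@filterS _ (nbhs s) _ _ _ _ (nbhs_setI nM nd)) => t [Mt dt]; rewrite E0.
have E's0 : E' s0 = 0.
  by rewrite /E' dl0 q0 V10 expr1; ring.
have dE' : is_derive s0 1 E' (- 8 * derive1 V1 s0 ^+ 2).
  have v1 := dV _ _ HV1 N0; have v1' := dV _ _ (smooth_derive1 HV1) N0.
  have v2 := dV _ _ HV2 N0; have v2' := dV _ _ (smooth_derive1 HV2) N0.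
  have H := is_derive1B (is_derive1D
      (is_derive1M (is_derive1Ml 9 (is_derive1M (dV _ _ Hdl N0) v2)) (is_derive1X 2 v2))
      (is_derive1M (is_derive1Ml 9 (dq _ N0))
        (is_derive1M (is_derive1Ml 2%:R (is_derive1X 1 v2)) v2')))
    (is_derive1Ml 4 (is_derive1M (is_derive1Ml 2%:R (is_derive1X 1 v1)) v1')).
  apply: (is_derive_eq H).
  rewrite dl0 q0 V10 dl'0; move: (V2 s0) (derive1 V1 s0) (derive1 V2 s0).
  by move: (derive1 (derive1 V1) s0) (derive1 (derive1 V2) s0) => /= x y z u v; ring.
have [|d d0 Hd] := near_derive_neq0 E's0 dE'.
  by rewrite mulf_neq0 // ?expf_neq0 // oppr_eq0.
have nM : nbhs s0 M by apply: open_nbhs_nbhs.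
have nB : nbhs s0 (ball s0 d) by exact: nbhsx_ballx.
apply: (@filterS _ (nbhs s0) _ _ _ _ (nbhs_setI nM nB)) => s [Ms Bs].
have [->//|ss0] := eqVneq s s0.
apply/eqP; apply/negPn/negP => /(E'0 _ Ms).
have := Hd (s - s0); rewrite [s0 + _]addrC subrK subr_eq0 => H.
by apply/eqP; apply: H => //; move: Bs; rewrite /ball /= distrC.
Qed.

End PlanarFronts.

(** * Plane and Minkowski vectors *)

Section PlaneVectors.
Context {R : realType}.
Implicit Types (V : normedModType R).
Local Notation smooth := smooth_on_open.

Definition vec2 (a b : R) : 'rV[R]_2 := \row_(j < 2) nth 0 [:: a; b] j.

Lemma vec2_0 a b : vec2 a b 0 0 = a. Proof. by rewrite mxE. Qed.

Lemma vec2_1 a b : vec2 a b 0 1 = b. Proof. by rewrite mxE. Qed.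

Lemma row2_ext (y z : 'rV[R]_2) : y 0 0 = z 0 0 -> y 0 1 = z 0 1 -> y = z.
Proof.
move=> h0 h1; apply/rowP => i.
by case: i => [[|[|//]] Hi]; [move: h0|move: h1]; congr (_ = _); congr (_ _ _); exact: val_inj.
Qed.

Lemma smooth_vec2 V (A : set V) (f g : V -> R) : open A ->
  smooth A f -> smooth A g -> smooth A (fun x => vec2 (f x) (g x)).
Proof.
move=> oA Hf Hg; apply/smooth_row => // -[[|[|//]] Hi].
  by apply: smooth_eq Hf => // x _; rewrite mxE.
by apply: smooth_eq Hg => // x _; rewrite mxE.
Qed.

Lemma smooth_vec3 V (A : set V) (f g h : V -> R) : open A ->
  smooth A f -> smooth A g -> smooth A h -> smooth A (fun x => vec3 (f x) (g x) (h x)).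
Proof.
move=> oA Hf Hg Hh; apply/smooth_row => // -[[|[|[|//]]] Hi].
- by apply: smooth_eq Hf => // x _; rewrite mxE.
- by apply: smooth_eq Hg => // x _; rewrite mxE.
- by apply: smooth_eq Hh => // x _; rewrite mxE.
Qed.

Lemma open_smooth_preimage V (W : normedModType R) (A : set V) (B : set W) (f : V -> W) :
  open A -> open B -> smooth A f -> open (A `&` f @^-1` B).
Proof.
move=> oA oB Hf; rewrite openE => x [Ax Bfx].
rewrite /interior /=; apply: nbhs_setI; first exact: open_nbhs_nbhs.
by have c := smooth_continuous Hf Ax; apply: (c B); exact: open_nbhs_nbhs.
Qed.

Lemma nbhs_open_subset (X : topologicalType) (x : X) (A : set X) : nbhs x A ->
  exists M : set X, [/\ open M, M x & M `<=` A].
Proof. by rewrite nbhsE => -[M [oM Mx] MA]; exists M. Qed.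

Lemma smooth_nbhs V (W : normedModType R) (A : set V) (B : set W) (f : V -> W) x :
  smooth A f -> A x -> open B -> B (f x) -> nbhs x (f @^-1` B).
Proof.
move=> Hf Ax oB Bfx; have c := smooth_continuous Hf Ax.
by apply: (c B); exact: open_nbhs_nbhs.
Qed.

Lemma nbhs_ball_center (x : R) (A : set R) : nbhs x A ->
  exists2 e, 0 < e & forall s, `|s - x| < e -> A s.
Proof.
move=> /nbhs_ballP[e /= e0 H]; exists e => // s h; apply: H.
by rewrite /ball /= distrC.
Qed.

Lemma ball_center_open (x e : R) : open [set s | `|s - x| < e].
Proof.
rewrite (_ : [set s | _] = (fun s => s - x) @^-1` [set s | `|s| < e]) //.
apply: open_comp => [s _|]; last exact: open_centered_ball.
by apply: continuousB; [exact: cvg_id|exact: cst_continuous].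
Qed.

Lemma ball_center_interval (x e : R) : open_interval [set s | `|s - x| < e].
Proof.
split; first exact: ball_center_open.
by move=> a b /=; rewrite !ltr_norml => /andP[h1 h2] /andP[h3 h4] z /andP[h5 h6];
  rewrite ltr_norml; apply/andP; split; lra.
Qed.

Lemma minkC (x y : 'rV[R]_3) : mink x y = mink y x.
Proof. by rewrite /mink; ring. Qed.

Lemma minkDl (x y z : 'rV[R]_3) : mink (x + y) z = mink x z + mink y z.
Proof. by rewrite /mink !mxE; ring. Qed.

Lemma minkZl a (x z : 'rV[R]_3) : mink (a *: x) z = a * mink x z.
Proof. by rewrite /mink !mxE; ring. Qed.

Lemma minkNl (x z : 'rV[R]_3) : mink (- x) z = - mink x z.
Proof. by rewrite /mink !mxE; ring. Qed.

Lemma minkDr (x y z : 'rV[R]_3) : mink z (x + y) = mink z x + mink z y.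
Proof. by rewrite /mink !mxE; ring. Qed.

Lemma minkZr a (x z : 'rV[R]_3) : mink z (a *: x) = a * mink z x.
Proof. by rewrite /mink !mxE; ring. Qed.

Lemma minkNr (x z : 'rV[R]_3) : mink z (- x) = - mink z x.
Proof. by rewrite /mink !mxE; ring. Qed.

Definition minkE := (minkDl, minkDr, minkNl, minkNr, minkZl, minkZr).

Lemma smooth_mink V (A : set V) (f g : V -> 'rV[R]_3) : open A ->
  smooth A f -> smooth A g -> smooth A (fun x => mink (f x) (g x)).
Proof.
move=> oA Hf Hg.
have Hf' := (proj1 (smooth_row _ oA) Hf); have Hg' := (proj1 (smooth_row _ oA) Hg).
apply: smoothD => //; last exact: smoothM.
by apply: smoothD => //; [apply: smoothN => //|]; exact: smoothM.
Qed.

Lemma is_derive_row n (f : R -> 'rV[R]_n) (s : R) v :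
  is_derive s 1 f v <-> forall i, is_derive s 1 (fun s => f s 0 i) (v 0 i).
Proof.
split=> [[df <-] i|H].
  have df' : differentiable f s by exact/derivable1_diffP.
  have [dc dcE] := @differentiable_lincomp R _ _ _ f (fun w => w 0 i) s 1
    (coord_linear i) (@coord_continuous _ _ _ 0 i) df'.
  by apply: DeriveDef => //; exact: diff_derivable.
have df : derivable f s 1.
  apply/derivable_mxP => i j; rewrite (ord1 i).
  by have [] := H j.
apply: DeriveDef => //; rewrite derive_mx //; apply/rowP => j; rewrite mxE.
by have [_] := H j.
Qed.

Lemma is_derive_mink (f g : R -> 'rV[R]_3) (s : R) u v :
  is_derive s 1 f u -> is_derive s 1 g v ->
  is_derive s 1 (fun s => mink (f s) (g s)) (mink u (g s) + mink (f s) v).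
Proof.
move=> /is_derive_row Hf /is_derive_row Hg.
have M i := is_derive1M (Hf i) (Hg i).
have H := is_derive1D (is_derive1D (is_deriveN (M 0)) (M 1)) (M 2).
by apply: (is_derive_eq H); rewrite /mink; ring.
Qed.

Lemma is_derive_minkl (f : R -> 'rV[R]_3) (s : R) u m :
  is_derive s 1 f u -> is_derive s 1 (fun s => mink (f s) m) (mink u m).
Proof.
move=> Hf; apply: (is_derive_eq (is_derive_mink Hf (is_derive_cst m s 1))).
by rewrite /mink !mxE; ring.
Qed.

Lemma is_derive_comp_plane (A : set 'rV[R]_2) (g : 'rV[R]_2 -> R) (f : R -> 'rV[R]_2) (s : R) v :
  smooth A g -> A (f s) -> is_derive s 1 f v ->
  is_derive s 1 (fun s => g (f s))
    (v 0 0 * 'D_(delta_mx 0 0) g (f s) + v 0 1 * 'D_(delta_mx 0 1) g (f s)).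
Proof.
move=> Hg Afs [df <-]; have df' : differentiable f s by exact/derivable1_diffP.
have [dc dcE] := @derive_comp_basis R _ _ 2 (fun i => delta_mx 0 i) (fun i w => w 0 i)
   f g s 1 (@row_basis _ _) df' (smooth_differentiable Hg Afs).
apply: DeriveDef; first exact: diff_derivable.
rewrite dcE big_ord_recl big_ord1.
by rewrite (_ : lift ord0 ord0 = 1 :> 'I_2) //; exact: val_inj.
Qed.

Lemma det2_neq0 (a b c d a' b' c' d' : R) :
  a * a' + b * c' = 1 -> a * b' + b * d' = 0 ->
  c * a' + d * c' = 0 -> c * b' + d * d' = 1 -> a * d - b * c != 0.
Proof.
move=> h1 h2 h3 h4; apply/eqP => det0.
have : (a * d - b * c) * (a' * d' - b' * c') =
  (a * a' + b * c') * (c * b' + d * d') - (a * b' + b * d') * (c * a' + d * c') by ring.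
rewrite det0 h1 h2 h4 !mul0r mulr1 subr0 => /esym/eqP.
by rewrite oner_eq0.
Qed.

Definition partial (F : 'rV[R]_2 -> 'rV[R]_2) (i j : 'I_2) : 'rV[R]_2 -> R :=
  'D_(delta_mx 0 i) (fun z => F z 0 j).

(** The chain rule for [G (F z) = z] writes the identity matrix as a product of two Jacobian
    matrices. *)
Lemma left_inverse_jacobian (A B : set 'rV[R]_2) (F G : 'rV[R]_2 -> 'rV[R]_2) y :
  open A -> open B -> smooth A F -> smooth B G -> (forall z, A z -> B (F z)) ->
  (forall z, A z -> G (F z) = z) -> A y ->
  partial F 0 0 y * partial F 1 1 y - partial F 0 1 y * partial F 1 0 y != 0.
Proof.
move=> oA oB HF HG AB GF Ay; pose d i j := partial F i j y.
rewrite -/(d 0 0) -/(d 1 1) -/(d 0 1) -/(d 1 0).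
have HFj := proj1 (smooth_row _ oA) HF; have HGj := proj1 (smooth_row _ oB) HG.
pose c i j := 'D_(delta_mx 0 i) (fun z => G z 0 j) (F y).
have E (i j : 'I_2) : d i 0 * c 0 j + d i 1 * c 1 j = (i == j)%:R.
  have HGF : 'D_(delta_mx 0 i) ((fun z => G z 0 j) \o F) y = (i == j)%:R.
    rewrite (@near_eq_derive _ _ _ _ (fun z : 'rV[R]_2 => z 0 j : R)); last first.
      have nA : nbhs y A by exact: open_nbhs_nbhs.
      by apply: (@filterS _ (nbhs y) _ A _ _ nA) => z Az; rewrite /= GF.
    have [cl clE] := linear_is_diff y (@coord_linear R 2 j) (@coord_continuous _ _ _ 0 j).
    by rewrite deriveE // clE mxE eqxx eq_sym.
  have [_] := @derive_comp_basis R _ _ 2 (fun i => delta_mx 0 i) (fun i w => w 0 i)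
   F (fun z => G z 0 j) y (delta_mx 0 i) (@row_basis _ _)
   (smooth_differentiable HF Ay) (smooth_differentiable (HGj j) (AB _ Ay)).
  rewrite HGF big_ord_recl big_ord1 (_ : lift ord0 ord0 = 1 :> 'I_2); last exact: val_inj.
  move=> ->; rewrite /d /partial; congr (_ * _ + _ * _).
    have [_ ->//] := @differentiable_lincomp R _ _ _ F (fun w => w 0 0) y (delta_mx 0 i)
      (@coord_linear R 2 0) (@coord_continuous _ _ _ 0 0) (smooth_differentiable HF Ay).
  have [_ ->//] := @differentiable_lincomp R _ _ _ F (fun w => w 0 1) y (delta_mx 0 i)
      (@coord_linear R 2 1) (@coord_continuous _ _ _ 0 1) (smooth_differentiable HF Ay).
exact: det2_neq0 (E 0 0) (E 0 1) (E 1 0) (E 1 1).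
Qed.

End PlaneVectors.

(** * Fronts on a surface with a graph chart *)

Section FrontsOnSurfaces.
Context {R : realType}.
Local Notation smooth := smooth_on_open.

(** Being affine, the chart turns the velocity [dl *: T] into [dl] times the fixed linear image of
    [T], without any derivative of the chart. *)
Definition affine_chart (m1 m2 : 'rV[R]_3) (k1 k2 : R) (x : 'rV[R]_3) : 'rV[R]_2 :=
  vec2 (mink x m1 - k1) (mink x m2 - k2).

Lemma smooth_affine_chart (V : normedModType R) (A : set V) m1 m2 k1 k2 (f : V -> 'rV[R]_3) :
  open A -> smooth A f -> smooth A (fun x => affine_chart m1 m2 k1 k2 (f x)).
Proof.
move=> oA Hf; apply: smooth_vec2 => //; apply: smoothB => //; try exact: smooth_cst.
  by apply: smooth_mink => //; exact: smooth_cst.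
by apply: smooth_mink => //; exact: smooth_cst.
Qed.

(* [P] and [sg] are inverse charts of [S] near [D s0], [P] being the restriction
   of an affine map; [D] is a front with limiting tangent direction [T]. *)
Variables (I N : set R) (S : set 'rV[R]_3) (D T : R -> 'rV[R]_3) (dl : R -> R) (s0 : R).
Variables (m1 m2 : 'rV[R]_3) (k1 k2 : R).
Variables (O : set 'rV[R]_3) (Wd : set 'rV[R]_2) (sg : 'rV[R]_2 -> 'rV[R]_3).
Let P := affine_chart m1 m2 k1 k2.
Hypotheses (oN : open N) (N0 : N s0) (NI : N `<=` I).
Hypotheses (HD : smooth N D) (HT : smooth N T) (Hdl : smooth N dl).
Hypothesis dD : forall s, N s -> is_derive s 1 D (dl s *: T s).
Hypothesis DS : forall s, N s -> S (D s).
Hypotheses (oO : open O) (ODs0 : O (D s0)) (oWd : open Wd) (Hsg : smooth Wd sg).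
Hypothesis chartK : forall x, S x -> O x -> Wd (P x) /\ sg (P x) = x.
Hypothesis sectionK : forall y, Wd y -> [/\ S (sg y), O (sg y) & P (sg y) = y].
Hypotheses (PD0 : P (D s0) = 0) (T01 : mink (T s0) m1 != 0) (T02 : mink (T s0) m2 = 0).
Hypothesis T'02 : dl s0 = 0 -> mink (derive1 T s0) m2 != 0.

Let be s := mink (D s) m1 - k1.
Let ga s := mink (D s) m2 - k2.
Let a s := mink (T s) m1.
Let d s := mink (T s) m2.

Let Hbe : smooth N be.
Proof.
by apply: smoothB => //; [apply: smooth_mink => //|]; exact: smooth_cst.
Qed.

Let Hga : smooth N ga.
Proof.
by apply: smoothB => //; [apply: smooth_mink => //|]; exact: smooth_cst.
Qed.

Let Ha : smooth N a. Proof. by apply: smooth_mink => //; exact: smooth_cst. Qed.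

Let Hd : smooth N d. Proof. by apply: smooth_mink => //; exact: smooth_cst. Qed.

Let dbe s : N s -> is_derive s 1 be (dl s * a s).
Proof.
move=> Ns; have H := is_derive1B (is_derive_minkl m1 (dD Ns)) (is_derive_cst k1 s 1).
by apply: (is_derive_eq H); rewrite minkZl subr0.
Qed.

Let dga s : N s -> is_derive s 1 ga (dl s * d s).
Proof.
move=> Ns; have H := is_derive1B (is_derive_minkl m2 (dD Ns)) (is_derive_cst k2 s 1).
by apply: (is_derive_eq H); rewrite minkZl subr0.
Qed.

Let be0 : be s0 = 0.
Proof. by have := congr1 (fun y : 'rV[R]_2 => y 0 0) PD0; rewrite /P /= vec2_0 mxE. Qed.

Let ga0 : ga s0 = 0.
Proof. by have := congr1 (fun y : 'rV[R]_2 => y 0 1) PD0; rewrite /P /= vec2_1 mxE. Qed.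

Let d'E : derive1 d s0 = mink (derive1 T s0) m2.
Proof. by apply: derive1_val; apply: is_derive_minkl; exact: smooth_is_derive HT N0. Qed.

Lemma front_cusp_sufficient : dl s0 = 0 -> derive1 dl s0 != 0 ->
  locally_diffeo_to_cusp I S D s0.
Proof.
move=> dl0 dl'0.
have d'0 : derive1 d s0 != 0 by rewrite d'E; exact: T'02.
have [e0 [rho [ep [g [k [tau [[e00 rho0 ep1] [Hg Hk k0] nf cover]]]]]]] :=
  front_normal_form oN N0 Hbe Hga Hdl Ha Hd dbe dga be0 ga0 T01 T02 d'0 dl0 dl'0.
have oB : open [set x : R | `|x| < rho] by exact: open_centered_ball.
have oT2 : open (@setT 'rV[R]_2) by exact: openT.
pose A1 := [set: 'rV[R]_2] `&` (fun y => ep * y 0 0) @^-1` [set x : R | `|x| < rho].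
pose A2 := [set: 'rV[R]_2] `&` (fun y => y 0 1) @^-1` [set x : R | `|x| < rho].
have Hep (A : set 'rV[R]_2) i : open A -> smooth A (fun y => ep * y 0 i).
  by move=> oA; apply: smoothM => //; [exact: smooth_cst|exact: smooth_coord].
have oA1 : open A1 by apply: open_smooth_preimage => //; exact: Hep.
have oA2 : open A2 by apply: open_smooth_preimage => //; exact: smooth_coord.
(* [Q] undoes the normal form: it sends [(ep * tau ^ 2, g (tau ^ 2) + tau ^ 3 * k (tau ^ 2))] to
   [(tau ^ 3, tau ^ 2)]. The required diffeomorphism is [Q \o P]. *)
pose Q (y : 'rV[R]_2) := vec2 ((y 0 1 - g (ep * y 0 0)) / k (ep * y 0 0)) (ep * y 0 0).
pose Qi (y : 'rV[R]_2) := vec2 (ep * y 0 1) (g (y 0 1) + y 0 0 * k (y 0 1)).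
have HQ : smooth A1 Q.
  have HgA : smooth A1 (fun y => g (ep * y 0 0)).
    by apply: (smooth_comp oA1 _ (Hep _ 0 oA1) Hg) => y [].
  have HkA : smooth A1 (fun y => k (ep * y 0 0)).
    by apply: (smooth_comp oA1 _ (Hep _ 0 oA1) Hk) => y [].
  apply: smooth_vec2 => //; last exact: Hep.
  apply: smoothM => //; first by apply: smoothB => //; exact: smooth_coord.
  by apply: smoothV => // y [_ /k0].
have HQi : smooth A2 Qi.
  have Hc1 : smooth A2 (fun y => y 0 1) by exact: smooth_coord.
  have HgA : smooth A2 (fun y => g (y 0 1)).
    by apply: (smooth_comp oA2 _ Hc1 Hg) => y [].
  have HkA : smooth A2 (fun y => k (y 0 1)).
    by apply: (smooth_comp oA2 _ Hc1 Hk) => y [].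
  apply: smooth_vec2 => //; first exact: Hep.
  by apply: smoothD => //; apply: smoothM => //; exact: smooth_coord.
have QK y : A1 y -> A2 (Q y) /\ Qi (Q y) = y.
  move=> [_ /= yr]; split; first by split => //=; rewrite /Q vec2_1.
  have kn := k0 _ yr.
  apply: row2_ext; rewrite /Qi /Q ?(vec2_0, vec2_1).
    by rewrite mulrA ep1 mul1r.
  by rewrite divfK // addrC subrK.
have QiK y : A2 y -> A1 (Qi y) /\ Q (Qi y) = y.
  move=> [_ /= yr]; have epK z : ep * (ep * z) = z by rewrite mulrA ep1 mul1r.
  split; first by split => //=; rewrite /Qi vec2_0 epK.
  have kn := k0 _ yr.
  apply: row2_ext; rewrite /Q /Qi ?(vec2_0, vec2_1) epK //.
  by rewrite addrAC subrr add0r mulfK.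
have [e1 e10 He1] : exists2 e1, 0 < e1 & forall s, `|s - s0| < e1 -> N s /\ O (D s).
  apply: nbhs_ball_center; apply: nbhs_setI; first exact: open_nbhs_nbhs.
  exact: smooth_nbhs HD N0 oO ODs0.
have PDE s : P (D s) = vec2 (be s) (ga s) by [].
have nfP s : `|s - s0| < e0 -> A1 (P (D s)) /\ Q (P (D s)) = vec2 (tau s ^+ 3) (tau s ^+ 2).
  move=> se; have [tr beE gaE] := nf _ se.
  have epb : ep * be s = tau s ^+ 2 by rewrite beE mulrA ep1 mul1r.
  have trn : `|tau s ^+ 2| < rho by rewrite ger0_norm // sqr_ge0.
  rewrite PDE; split; first by split => //=; rewrite vec2_0 epb.
  have kn := k0 _ trn.
  apply: row2_ext; rewrite /Q ?(vec2_0, vec2_1) epb //.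
  by rewrite gaE addrAC subrr add0r mulfK.
have tau0 : tau s0 = 0.
  have := nf s0; rewrite subrr normr0 be0 => /(_ e00)[_ + _] => /esym/(congr1 ( *%R ep)).
  by rewrite mulrA ep1 mul1r mulr0 => /eqP; rewrite sqrf_eq0 => /eqP.
have QP0 : Q (P (D s0)) = 0.
  have [|_ ->] := nfP s0; first by rewrite subrr normr0.
  by apply: row2_ext; rewrite ?(vec2_0, vec2_1) mxE tau0 expr0n.
exists (Num.min e0 e1); first by rewrite lt_min e00.
move=> J [oJ _] J0 JI.
pose O' := O `&` P @^-1` A1.
pose W := A2 `&` Qi @^-1` Wd.
have HP (A : set 'rV[R]_3) : open A -> smooth A P.
  by move=> oA; apply: smooth_affine_chart => //; exact: smooth_id.
have oO' : open O' by apply: open_smooth_preimage => //; exact: HP.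
have oW : open W by apply: open_smooth_preimage.
have Hphi : smooth O' (Q \o P).
  by apply: (smooth_comp_row oO' oA1 _ (HP _ oO') HQ) => x [].
have Hpsi : smooth W (sg \o Qi).
  have HQiW : smooth W Qi by apply: smooth_sub HQi => y [].
  by apply: (smooth_comp_row oW oWd _ HQiW Hsg) => y [].
have A1D0 : A1 (P (D s0)) by have [] := nfP s0; rewrite ?subrr ?normr0.
have phiW x : (S `&` O') x -> W (Q (P x)).
  move=> [Sx [ Ox PA]]; have [h1 h2] := QK _ PA; split => //.
  by rewrite /= h2; have [] := chartK Sx Ox.
exists O', W, (Q \o P); split.
- by split => //; split; [exact: DS|split].
- by split => //; rewrite -QP0; apply: phiW; split; [exact: DS|split].
- split.
  + by move=> x [Sx Ox]; exists O', (Q \o P).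
  + exact: phiW.
  exists (sg \o Qi); split.
  + by move=> y Wy; exists W, (sg \o Qi).
  + move=> y [A2y Wdy]; have [h1 h2 h3] := sectionK Wdy.
    split => //; split => //; rewrite /= h3.
    by have [] := QiK _ A2y.
  + move=> x [Sx [ Ox PA]] /=; have [_ ->] := QK _ PA.
    by have [] := chartK Sx Ox.
  + move=> y [A2y Wdy] /=; have [_ _ ->] := sectionK Wdy.
    by have [] := QiK _ A2y.
- by [].
- have [eta eta0 Heta] : exists2 eta, 0 < eta & forall s, `|s - s0| < eta -> J s.
    by apply: nbhs_ball_center; exact: open_nbhs_nbhs.
  (* The neighbourhood of [0] depends on [J]: where [|y 0 1| < c ^ 2], the cusp parameter is below
     [c] and is attained by [tau] at a point of [J]. *)
  have [c c0 Hc] := cover _ eta0.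
  have nb : nbhs (0 : 'rV[R]_2) ([set: 'rV[R]_2] `&` (fun y => y 0 1) @^-1` [set x : R | `|x| < c ^+ 2]).
    apply: open_nbhs_nbhs; split.
      by apply: open_smooth_preimage => //; [exact: open_centered_ball|exact: smooth_coord].
    by split => //=; rewrite mxE normr0 exprn_gt0.
  apply: (@filterS _ (nbhs (0 : 'rV[R]_2)) _ _ _ _ nb) => y [_ /= yc]; split.
    move=> [x [[s Js Dsx] _] <-]; have [_] := JI _ Js.
    rewrite /= lt_min -Dsx => /andP[se0 _]; have [_ ->] := nfP _ se0.
    by rewrite /cusp /= vec2_0 vec2_1 -!exprM.
  rewrite /cusp /= => yE.
  (* Rational parametrization of the cusp: [u = y 0 0 / y 0 1] away from the vertex. *)
  have [u [u3 u2]] : exists u, u ^+ 3 = y 0 0 /\ u ^+ 2 = y 0 1.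
    have [y1|y1] := eqVneq (y 0 1) 0.
      exists 0; move: yE; rewrite y1 !expr0n /= => /eqP.
      by rewrite sqrf_eq0 => /eqP ->.
    exists (y 0 0 / y 0 1); rewrite !expr_div_n.
    have -> : y 0 0 ^+ 3 = y 0 0 * y 0 1 ^+ 3 by rewrite exprS yE.
    by rewrite yE; split; field.
  have uc : `|u| < c.
    rewrite -(ltr_pXn2r (n := 2)) ?nnegrE ?(ltW c0) //.
    by rewrite -normrX u2.
  have [s [seta se0 tauE]] := Hc _ uc.
  have Js := Heta _ seta; have [Is] := JI _ Js.
  rewrite /= lt_min => /andP[_ se1]; have [Ns Os] := He1 _ se1.
  have [A1s QE] := nfP _ se0.
  exists (D s); last by rewrite QE tauE u3 u2; apply: row2_ext; rewrite ?(vec2_0, vec2_1).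
  by split; [exists s|split; [exact: DS|split]].
Qed.

(** Composing the given diffeomorphism with the section [sg] yields a planar front satisfying
    [p ^ 2 = q ^ 3]. An invertible Jacobian preserves the front condition, so the planar dichotomy
    applies, and its first alternative is excluded because the cusp is not a point. *)
Lemma front_cusp_necessary : locally_diffeo_to_cusp I S D s0 ->
  dl s0 = 0 /\ derive1 dl s0 != 0.
Proof.
move=> [e e0 He].
have cuspJ e2 : 0 < e2 -> (forall s, `|s - s0| < e2 -> N s) ->
    exists (O : set 'rV[R]_3) (W : set 'rV[R]_2) (phi : 'rV[R]_3 -> 'rV[R]_2),
        [/\ open O /\ (S `&` O) (D s0),
            open W /\ W 0,
            diffeomorphism (S `&` O) W phi,
            phi (D s0) = 0 &
            \forall y \near (0 : 'rV[R]_2),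
              (phi @` (D @` [set s | `|s - s0| < Num.min e e2] `&` (S `&` O))) y <-> cusp y].
  move=> e20 H; apply: He; first exact: ball_center_interval.
    by rewrite /= subrr normr0 lt_min e0.
  by move=> s /=; rewrite lt_min => /andP[h1 /H/NI h2].
have [nu nu0 Hnu] : exists2 nu, 0 < nu & forall s, `|s - s0| < nu -> N s.
  by apply: nbhs_ball_center; exact: open_nbhs_nbhs.
(* If [dl] vanishes near [s0] then [D] is constant there and its image is a
   point, whereas the cusp has points other than [0] arbitrarily close to [0]. *)
suff [dl0|//] : (\forall s \near s0, dl s = 0) \/ (dl s0 = 0 /\ derive1 dl s0 != 0).
  exfalso.
  have [r r0 Hr] : exists2 r, 0 < r & forall s, `|s - s0| < r -> N s /\ dl s = 0.
    apply: nbhs_ball_center; apply: nbhs_setI => //; exact: open_nbhs_nbhs.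
  have Dcst s : `|s - s0| < r -> D s = D s0.
    move=> sr; apply/rowP => i; apply/eqP; rewrite -subr_eq0 -normr_le0.
    have := @MVT_bound R (fun t => D t 0 i) (fun=> 0) s0 s 0.
    rewrite mul0r; apply; last by move=> t _; rewrite normr0.
    move=> t ts; have [Nt dlt] := Hr _ (le_lt_trans ts sr).
    have := proj1 (is_derive_row _ _ _) (dD Nt) i.
    by rewrite dlt scale0r mxE.
  have [|O2 [W [phi [_ _ _ phi0 nb]]]] := cuspJ r r0; first by move=> s /Hr[].
  have [c c0 Hc] : exists2 c, 0 < c & forall u, `|u - 0| < c ->
      (phi @` (D @` [set s | `|s - s0| < Num.min e r] `&` (S `&` O2))) (vec2 (u ^+ 3) (u ^+ 2)).
    apply: nbhs_ball_center.
    have HF : smooth setT (fun u : R => vec2 (u ^+ 3) (u ^+ 2)).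
      by apply: smooth_vec2; [exact: openT| |]; apply: smoothX; (try exact: openT); exact: smooth_id.
    have F0 : vec2 ((0 : R) ^+ 3) (0 ^+ 2) = 0.
      by apply: row2_ext; rewrite ?(vec2_0, vec2_1) mxE expr0n.
    have cF := smooth_continuous HF (Logic.I : setT (0 : R)).
    have := cF _; rewrite /= F0 => /(_ _ nb).
    apply: (@filterS _ (nbhs (0 : R))) => u /= h; apply/h.
    by rewrite /cusp /= vec2_0 vec2_1 -!exprM.
  have c2 : `|c / 2 - 0| < c by rewrite subr0 ger0_norm ?ltr_pdivrMr ?ltr_pMr ?ltr1n // divr_ge0 // ltW.
  have [x [[s /= sr <-] _] phiE] := Hc _ c2.
  move: sr; rewrite lt_min => /andP[_ /Dcst Ds].
  have := congr1 (fun y : 'rV[R]_2 => y 0 1) phiE.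
  rewrite Ds phi0 vec2_1 mxE => /esym/eqP; rewrite sqrf_eq0.
  by rewrite gt_eqF // divr_gt0.
have [ O2 [W [phi [[oO2 [_ O2D]] [oW W0] [sphi phiW [psi [spsi psiW psiK phiK]]] phi0 nb]]]] := cuspJ nu nu0 Hnu.
have [ O3 [F [oO3 O3D HF FE]]] := sphi (D s0) (conj (DS N0) O2D).
have [ O4 [G [oO4 O40 HG GE]]] := spsi 0 W0.
have [Wd0 sg0] : Wd 0 /\ sg 0 = D s0.
  by have := chartK (DS N0) ODs0; rewrite PD0.
have oO23 : open (O2 `&` O3) by exact: openI.
(* [F] and [G] are smooth extensions of [phi] and of its inverse to open sets of the ambient spaces.
   [Om] is cut out so that on it [F \o sg] equals [phi \o sg] and has the smooth left inverse
   [P \o G]. *)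
pose Om1 := Wd `&` sg @^-1` (O2 `&` O3).
have oOm1 : open Om1 by apply: open_smooth_preimage.
have HPhi1 : smooth Om1 (fun y => F (sg y)).
  have Hsg1 : smooth Om1 sg by apply: smooth_sub Hsg => y [].
  by apply: (smooth_comp_row oOm1 oO3 _ Hsg1 HF) => y [_ []].
pose Om := Om1 `&` (fun y => F (sg y)) @^-1` O4.
have oOm : open Om by apply: open_smooth_preimage.
have HPhi : smooth Om (fun y => F (sg y)) by apply: smooth_sub HPhi1 => y [].
have Om1E y : Om1 y -> (S `&` O2) (sg y) /\ F (sg y) = phi (sg y).
  move=> [Wy [ O2y O3y]]; have [Sy _ _] := sectionK Wy.
  have SO : (S `&` O2) (sg y) by [].
  by split => //; exact: FE.
have Om0 : Om 0.
  have h : Om1 0 by split => //=; rewrite sg0.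
  by split => //=; have [_ ->] := Om1E _ h; rewrite sg0 phi0.
have PhiK y : Om y -> P (G (F (sg y))) = y.
  move=> [ Om1y O4y]; have [SOy FEy] := Om1E _ Om1y.
  have Wy := phiW _ SOy.
  rewrite GE ?FEy // ?psiK //; last by move: O4y; rewrite /= FEy.
  by have [Wdy _] := Om1y; have [_ _] := sectionK Wdy.
have HPG : smooth O4 (fun y => P (G y)) by exact: smooth_affine_chart.
have jac := left_inverse_jacobian oOm oO4 HPhi HPG (fun z Oz => proj2 Oz) PhiK Om0.
pose Phi y := F (sg y).
pose p s := Phi (P (D s)) 0 0.
pose q s := Phi (P (D s)) 0 1.
have HPD : smooth N (fun s => P (D s)) by exact: smooth_affine_chart.
have [M [oM M0 HM]] : exists M : set 'rV[R]_2, [/\ open M, M 0 & forall y, M y ->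
     ((phi @` (D @` [set s | `|s - s0| < Num.min e nu] `&` (S `&` O2))) y <-> cusp y)].
  have [M [oM M0 HM]] := nbhs_open_subset nb.
  by exists M; split => // y /HM.
pose N1 := (N `&` D @^-1` O) `&` [set s | `|s - s0| < Num.min e nu].
have oN1 : open N1.
  by apply: openI; [exact: open_smooth_preimage|exact: ball_center_open].
have HPD1 : smooth N1 (fun s => P (D s)) by apply: smooth_sub HPD => s [[]].
pose N2 := N1 `&` (fun s => P (D s)) @^-1` Om.
have oN2 : open N2 by exact: open_smooth_preimage.
have HPD2 : smooth N2 (fun s => P (D s)) by apply: smooth_sub HPD1 => s [].
have HE : smooth N2 (fun s => Phi (P (D s))).
  by apply: (smooth_comp_row oN2 oOm _ HPD2 HPhi) => s [].
pose N3 := N2 `&` (fun s => Phi (P (D s))) @^-1` M.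
have oN3 : open N3 by exact: open_smooth_preimage.
have Phi0 : Phi 0 = 0 by rewrite /Phi; have [/Om1E[_ ->] _] := Om0; rewrite sg0.
have N30 : N3 s0.
  split; last by rewrite /= PD0 Phi0.
  split; last by rewrite /= PD0.
  by split; [split|rewrite /= subrr normr0 lt_min e0].
have N3N : N3 `<=` N by move=> s [[[[]]]].
have HE3 : smooth N3 (fun s => Phi (P (D s))) by apply: smooth_sub HE => s [].
have HPD3 : smooth N3 (fun s => P (D s)) by apply: smooth_sub HPD2 => s [].
have HEj := proj1 (smooth_row _ oN3) HE3.
(* The image of the chart direction [(a, d)] under the Jacobian of [Phi], so that the transformed
   front has velocity [dl * V]. *)
pose V (j : 'I_2) s := a s * partial Phi 0 j (P (D s)) + d s * partial Phi 1 j (P (D s)).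
have dPD s : N s -> is_derive s 1 (fun s => P (D s)) (vec2 (dl s * a s) (dl s * d s)).
  move=> Ns; apply/is_derive_row => -[[|[|//]] Hi].
    have -> : (fun s => P (D s) 0 (Ordinal Hi)) = be by apply/funext => t; rewrite mxE.
    by rewrite mxE; exact: dbe.
  have -> : (fun s => P (D s) 0 (Ordinal Hi)) = ga by apply/funext => t; rewrite mxE.
  by rewrite mxE; exact: dga.
have HPhij j : smooth Om (fun y => Phi y 0 j) by exact: (proj1 (smooth_row _ oOm) HPhi).
have Hpart i j : smooth Om (partial Phi i j) by exact: smooth_derive.
have N3Om s : N3 s -> Om (P (D s)) by move=> [[]].
have dE j s : N3 s -> is_derive s 1 (fun s => Phi (P (D s)) 0 j) (dl s * V j s).
  move=> Ns; have H := @is_derive_comp_plane R Om _ (fun s => P (D s)) s _ (HPhij j) (N3Om _ Ns)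
    (dPD _ (N3N _ Ns)).
  have E (x y z u v : R) : x * y * u + x * z * v = x * (y * u + z * v) by ring.
  by apply: (is_derive_eq H); rewrite vec2_0 vec2_1 E.
have HpartD i j : smooth N3 (fun s => partial Phi i j (P (D s))).
  exact: (smooth_comp_rowR oN3 N3Om HPD3 (Hpart i j)).
have subN (f : R -> R) : smooth N f -> smooth N3 f by exact: smooth_sub.
have HV j : smooth N3 (V j).
  by apply: smoothD => //; apply: smoothM => //; exact: subN.
have V0E j : V j s0 = a s0 * partial Phi 0 j 0.
  by rewrite /V PD0 /d T02 mul0r addr0.
apply: (@cusp_front_derivative _ N3 s0 p q dl (V 0) (V 1) oN3 N30 (HEj 0) (HEj 1) (subN _ Hdl) (HV 0) (HV 1)).
- move=> s Ns; have [[[[Ns' Os] sJ] Oms] Ms] := Ns.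
  have [Wds sgs] := chartK (DS Ns') Os.
  have [ Oms1 _] := Oms; have [SOs FEs] := Om1E _ Oms1.
  have : cusp (Phi (P (D s))).
    apply/HM => //; exists (D s); last by rewrite /Phi FEs sgs.
    by split; [exists s|rewrite -sgs].
  by [].
- by rewrite /p PD0 Phi0 mxE.
- by rewrite /q PD0 Phi0 mxE.
- rewrite !V0E !mulf_eq0 !negb_or (T01 : a s0 != 0) /=.
  rewrite -negb_and; apply/negP => /andP[/eqP h1 /eqP h2].
  by move: jac; rewrite -/Phi h1 h2 !mul0r subrr eqxx.
- move=> dl0.
  (* The curve is stationary at a zero of [dl], so the partial derivatives of [Phi] along it have
     derivative [0]. Hence [V'] is the image of [(a', d')], and the determinant of [V, V'] is
     [a * d'] times the Jacobian determinant. *)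
  have dpart i j : is_derive s0 1 (fun s => partial Phi i j (P (D s))) 0.
    have H := @is_derive_comp_plane R Om _ (fun s => P (D s)) s0 _ (Hpart i j) (N3Om _ N30)
      (dPD _ N0).
    by apply: (is_derive_eq H); rewrite vec2_0 vec2_1 dl0 !mul0r addr0.
  have V'E j : derive1 (V j) s0 = derive1 a s0 * partial Phi 0 j 0 + derive1 d s0 * partial Phi 1 j 0.
    apply: derive1_val.
    have H := is_derive1D (is_derive1M (smooth_is_derive Ha N0) (dpart 0 j))
                          (is_derive1M (smooth_is_derive Hd N0) (dpart 1 j)).
    have E (x y z u v1 v2 : R) : x * u + y * 0 + (z * v1 + v2 * 0) = x * u + z * v1 by ring.
    by apply: (is_derive_eq H); rewrite PD0 E.
  rewrite !V'E !V0E.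
  have E (x x' y' p00 p01 p10 p11 : R) :
    x * p00 * (x' * p01 + y' * p11) - x * p01 * (x' * p00 + y' * p10) =
    x * y' * (p00 * p11 - p01 * p10) by ring.
  by rewrite E mulf_neq0 // mulf_neq0 // d'E; exact: T'02.
Qed.

End FrontsOnSurfaces.

(** * Lorentz frames and their charts *)

Section MovingFrames.
Context {R : realType}.
Implicit Types (x : 'rV[R]_3).
Local Notation smooth := smooth_on_open.

Lemma sum_ord3 (F : 'I_3 -> R) : \sum_(i < 3) F i = F 0 + F 1 + F 2.
Proof.
rewrite !big_ord_recl big_ord0 addr0 addrA.
by congr (F _ + F _ + F _); exact: val_inj.
Qed.

Definition lorentz_frame (e1 e2 e3 : 'rV[R]_3) (ep1 ep2 ep3 : R) : Prop :=
  [/\ mink e1 e1 = ep1, mink e2 e2 = ep2 & mink e3 e3 = ep3] /\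
  [/\ mink e1 e2 = 0, mink e1 e3 = 0 & mink e2 e3 = 0].

(** The frame relations say [A *m B = 1] for the matrix [A] with rows the frame vectors and [B] its
    metric transpose. For square matrices this gives [B *m A = 1], which is the expansion. *)
Lemma lorentz_frame_expand (e1 e2 e3 : 'rV[R]_3) (ep1 ep2 ep3 : R) x :
  ep1 * ep1 = 1 -> ep2 * ep2 = 1 -> ep3 * ep3 = 1 ->
  lorentz_frame e1 e2 e3 ep1 ep2 ep3 ->
  x = (ep1 * mink x e1) *: e1 + (ep2 * mink x e2) *: e2 + (ep3 * mink x e3) *: e3.
Proof.
move=> h1 h2 h3 [[f11 f22 f33] [f12 f13 f23]].
pose e (i : 'I_3) := nth 0 [:: e1; e2; e3] i.
pose ep (i : 'I_3) := nth 0 [:: ep1; ep2; ep3] i.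
pose G (j : 'I_3) : R := nth 0 [:: -1; 1; 1] j.
have mE (y z : 'rV[R]_3) : \sum_(j < 3) y 0 j * G j * z 0 j = mink y z.
  by rewrite sum_ord3 /G /mink /=; ring.
pose A : 'M[R]_3 := \matrix_(i, j) e i 0 j.
pose B : 'M[R]_3 := \matrix_(j, i) (G j * e i 0 j * ep i).
have AB : A *m B = 1%:M.
  apply/matrixP => i k; rewrite !mxE.
  have -> : \sum_j A i j * B j k = mink (e i) (e k) * ep k.
    by rewrite -mE mulr_suml; apply: eq_bigr => j _; rewrite !mxE; ring.
  case: i => [[|[|[|//]]] Hi]; case: k => [[|[|[|//]]] Hk];
    rewrite /e /ep -val_eqE /= ?f11 ?f22 ?f33 ?h1 ?h2 ?h3 ?f12 ?f13 ?f23 ?mul0r //;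
    by rewrite minkC ?f12 ?f13 ?f23 mul0r.
have BA := mulmx1C AB.
have cE : x *m B *m A = x by rewrite -mulmxA BA mulmx1.
have bE i : (x *m B) 0 i = mink x (e i) * ep i.
  by rewrite mxE -mE mulr_suml; apply: eq_bigr => j _; rewrite !mxE; ring.
apply/rowP => l; rewrite -[in LHS]cE mxE sum_ord3 !bE !mxE /e /ep /=.
by ring.
Qed.

Section FrameCharts.
Variables (D0 T0 B0 : 'rV[R]_3) (eD eT eB : R).
Hypotheses (eD1 : eD * eD = 1) (eT1 : eT * eT = 1) (eB1 : eB * eB = 1).
Hypothesis fr : lorentz_frame D0 T0 B0 eD eT eB.

(* With [y0], [y1] the coordinates along [T0], [B0], the coordinate [r] along [D0]
   of a point of the quadric [mink x x = eD] satisfies [r ^ 2 = quadric_height y]. *)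
Definition quadric_height (y : 'rV[R]_2) : R :=
  1 - eD * eT * y 0 0 ^+ 2 - eD * eB * y 0 1 ^+ 2.

Definition quadric_section (y : 'rV[R]_2) : 'rV[R]_3 :=
  Num.sqrt (quadric_height y) *: D0 + y 0 0 *: T0 + y 0 1 *: B0.

(* Light cone in the coordinates [1 + y1], [y0] along the null vector [D0 + B0]
   and [T0]; the coordinate along [D0 - B0] is then determined. *)
Definition cone_section (y : 'rV[R]_2) : 'rV[R]_3 :=
  (1 + y 0 1) *: (D0 + B0) + y 0 0 *: T0
  + (- (eD * eT / 4) * y 0 0 ^+ 2 / (1 + y 0 1)) *: (D0 - B0).

Lemma open_half_space (m : 'rV[R]_3) (k : R) : open [set x | 0 < mink x m - k].
Proof.
have -> : [set x | 0 < mink x m - k] =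
    setT `&` (fun x => mink x m - k) @^-1` [set r | 0 < r].
  by apply/seteqP; split => x //= [].
apply: open_smooth_preimage; [exact: openT|exact: open_gt|].
apply: smoothB; [exact: openT| |exact: smooth_cst].
by apply: smooth_mink; [exact: openT|exact: smooth_id|exact: smooth_cst].
Qed.

Lemma smooth_quadric_height (A : set 'rV[R]_2) : open A -> smooth A quadric_height.
Proof.
move=> oA; have Hc (c : R) : smooth A (fun=> c) by exact: smooth_cst.
have Hy i : smooth A (fun y => y 0 i ^+ 2) by apply: smoothX => //; exact: smooth_coord.
have H0 := smoothM oA (Hc (eD * eT)) (Hy 0); have H1 := smoothM oA (Hc (eD * eB)) (Hy 1).
exact: smoothB oA (smoothB oA (Hc 1) H0) H1.
Qed.

Lemma open_positive (f : 'rV[R]_2 -> R) : smooth setT f -> open [set y | 0 < f y].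
Proof.
move=> Hf; have -> : [set y | 0 < f y] = setT `&` f @^-1` [set r | 0 < r].
  by apply/seteqP; split => x //= [].
exact: open_smooth_preimage openT (@open_gt _ 0) Hf.
Qed.

Lemma smooth_quadric_section : smooth [set y | 0 < quadric_height y] quadric_section.
Proof.
have oA : open [set y | 0 < quadric_height y].
  by apply: open_positive; apply: smooth_quadric_height; exact: openT.
have Hc (v : 'rV[R]_3) : smooth [set y | 0 < quadric_height y] (fun=> v) by exact: smooth_cst.
apply: smoothD => //; last by apply: smoothZ => //; exact: smooth_coord.
apply: smoothD => //; last by apply: smoothZ => //; exact: smooth_coord.
apply: smoothZ => //; apply: smooth_sqrt => //; exact: smooth_quadric_height.
Qed.

Lemma smooth_cone_section : smooth [set y : 'rV[R]_2 | 0 < 1 + y 0 1] cone_section.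
Proof.
have Hl (A : set 'rV[R]_2) : open A -> smooth A (fun y => 1 + y 0 1).
  by move=> oA; apply: smoothD => //; [exact: smooth_cst|exact: smooth_coord].
have oA : open [set y : 'rV[R]_2 | 0 < 1 + y 0 1].
  by apply: open_positive; apply: Hl; exact: openT.
have Hc (v : 'rV[R]_3) : smooth [set y : 'rV[R]_2 | 0 < 1 + y 0 1] (fun=> v).
  exact: smooth_cst.
apply: smoothD => //; first apply: smoothD => //.
- by apply: smoothZ => //; exact: Hl.
- by apply: smoothZ => //; exact: smooth_coord.
apply: smoothZ => //; apply: smoothM => //; last first.
  apply: smoothV => //; last exact: Hl.
  by move=> y /= y1; rewrite gt_eqF.
apply: smoothM => //; first exact: smooth_cst.
by apply: smoothX => //; exact: smooth_coord.
Qed.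

(** The factors [eT] and [eB] make the pairings the coordinates along [T0] and [B0]. When
    [eB = - eD], pairing with [(eD / 2) *: (D0 - B0)] extracts the coefficient of the null vector
    [D0 + B0]; the shift by [1] places [D0 + B0] at the origin. *)
Let Pq := affine_chart (eT *: T0) (eB *: B0) 0 0.
Let Pc := affine_chart (eT *: T0) ((eD / 2) *: (D0 - B0)) 0 1.

(** The frame expansion identifies the squared coordinate along [D0] with [quadric_height]; the half
    space selects the positive root. *)
Lemma quadric_chartK x : mink x x = eD -> 0 < mink x (eD *: D0) - 0 ->
  0 < quadric_height (Pq x) /\ quadric_section (Pq x) = x.
Proof.
move=> xx; rewrite subr0 minkZr => a0.
have xE := lorentz_frame_expand x eD1 eT1 eB1 fr.
move: fr => [[f11 f22 f33] [f12 f13 f23]].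
have hE : quadric_height (Pq x) = (eD * mink x D0) ^+ 2.
  have : mink x x = eD * (eD * mink x D0) ^+ 2 + eT * (eT * mink x T0) ^+ 2
      + eB * (eB * mink x B0) ^+ 2.
    rewrite {1 2}xE !minkE f11 f22 f33 f12 f13 f23.
    by rewrite ![mink T0 _]minkC ![mink B0 _]minkC f12 f13 f23; ring.
  rewrite xx /quadric_height /Pq vec2_0 vec2_1 !subr0 !minkZr => h.
  have -> : (eD * mink x D0) ^+ 2 = eD * (eD - eT * (eT * mink x T0) ^+ 2 - eB * (eB * mink x B0) ^+ 2).
    have -> : eD - eT * (eT * mink x T0) ^+ 2 - eB * (eB * mink x B0) ^+ 2 =
      eD * (eD * mink x D0) ^+ 2 by lra.
    by rewrite mulrA eD1 mul1r.
  by rewrite mulrBr mulrBr eD1; ring.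
split; first by rewrite hE exprn_gt0.
rewrite /quadric_section hE sqrtr_sqr gtr0_norm // /Pq vec2_0 vec2_1 !subr0 !minkZr.
by rewrite -xE.
Qed.

Lemma quadric_sectionK y : 0 < quadric_height y ->
  [/\ mink (quadric_section y) (quadric_section y) = eD,
      0 < mink (quadric_section y) (eD *: D0) - 0 & Pq (quadric_section y) = y].
Proof.
move=> h0; have sq := sqr_sqrtr (ltW h0); have s0 : 0 < Num.sqrt (quadric_height y).
  by rewrite sqrtr_gt0.
move: fr => [[f11 f22 f33] [f12 f13 f23]].
rewrite /Pq /affine_chart /quadric_section; move: (Num.sqrt _) sq s0 => r sq r0.
have f21 : mink T0 D0 = 0 by rewrite minkC.
have f31 : mink B0 D0 = 0 by rewrite minkC.
have f32 : mink B0 T0 = 0 by rewrite minkC.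
rewrite !minkE f11 f22 f33 f12 f13 f23 f21 f31 f32; split.
- transitivity (r ^+ 2 * eD + eT * y 0 0 ^+ 2 + eB * y 0 1 ^+ 2); first by ring.
  rewrite sq /quadric_height.
  transitivity (eD + (1 - eD * eD) * (eT * y 0 0 ^+ 2 + eB * y 0 1 ^+ 2)); first by ring.
  by rewrite eD1; ring.
- by rewrite (_ : _ - 0 = (eD * eD) * r); [rewrite eD1 mul1r|ring].
- apply: row2_ext; rewrite ?(vec2_0, vec2_1).
    by transitivity (eT * eT * y 0 0); [ring|rewrite eT1 mul1r].
  by transitivity (eB * eB * y 0 1); [ring|rewrite eB1 mul1r].
Qed.

Hypothesis eBD : eB = - eD.

(** With [al], [nu] the coefficients along [D0 + B0], [D0 - B0] and [be] that along [T0], nullity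
    reads [4 * eD * al * nu + eT * be ^ 2 = 0]. It is linear in [nu], and the half space ensures
    [al > 0]. *)
Lemma cone_chartK x : LCstar x -> 0 < mink x ((eD / 2) *: (D0 - B0)) - 0 ->
  0 < 1 + Pc x 0 1 /\ cone_section (Pc x) = x.
Proof.
move=> [_ xx]; rewrite subr0 => a0.
have xE := lorentz_frame_expand x eD1 eT1 eB1 fr.
move: fr => [[f11 f22 f33] [f12 f13 f23]].
rewrite /cone_section /Pc vec2_0 vec2_1.
have -> : 1 + (mink x ((eD / 2) *: (D0 - B0)) - 1) = mink x ((eD / 2) *: (D0 - B0)) by ring.
split => //.
have f21 : mink T0 D0 = 0 by rewrite minkC.
have f31 : mink B0 D0 = 0 by rewrite minkC.
have f32 : mink B0 T0 = 0 by rewrite minkC.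
set p := mink x D0; set q := mink x T0; set r := mink x B0.
have h : eD * (p ^+ 2 - r ^+ 2) + eT * q ^+ 2 = 0.
  rewrite -[RHS]xx {1 2}xE !minkE f11 f22 f33 f12 f13 f23 f21 f31 f32 -/p -/q -/r.
  have -> : eT * q ^+ 2 = (eT * eT) * eT * q ^+ 2 by rewrite eT1 mul1r.
  have -> : eD * (p ^+ 2 - r ^+ 2) = (eD * eD) * eD * (p ^+ 2 - r ^+ 2) by rewrite eD1 mul1r.
  by rewrite eBD; ring.
have aE : mink x ((eD / 2) *: (D0 - B0)) = eD / 2 * (p - r) by rewrite !minkE.
move: a0; rewrite !aE => a0.
have nuE : - (eD * eT / 4) * (mink x (eT *: T0) - 0) ^+ 2 / (eD / 2 * (p - r)) = eD / 2 * (p + r).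
  have al0 : eD / 2 * (p - r) != 0 by rewrite gt_eqF.
  apply: (canLR (mulfK al0)); rewrite subr0 minkZr -/q.
  have -> : - (eD * eT / 4) * (eT * q) ^+ 2 = - ((eT * eT) * (eD / 4 * (eT * q ^+ 2))) by ring.
  have -> : eT * q ^+ 2 = - (eD * (p ^+ 2 - r ^+ 2)) by move: h; lra.
  by rewrite eT1; field.
rewrite nuE subr0 minkZr -/q [RHS]xE -/p -/q -/r eBD.
by apply/rowP => i; rewrite !mxE; field.
Qed.

Lemma cone_sectionK (y : 'rV[R]_2) : 0 < 1 + y 0 1 ->
  [/\ LCstar (cone_section y),
      0 < mink (cone_section y) ((eD / 2) *: (D0 - B0)) - 0 & Pc (cone_section y) = y].
Proof.
move=> y1; move: fr => [[f11 f22 f33] [f12 f13 f23]].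
have f21 : mink T0 D0 = 0 by rewrite minkC.
have f31 : mink B0 D0 = 0 by rewrite minkC.
have f32 : mink B0 T0 = 0 by rewrite minkC.
have yn0 : 1 + y 0 1 != 0 by rewrite gt_eqF.
have aE : mink (cone_section y) ((eD / 2) *: (D0 - B0)) = 1 + y 0 1.
  rewrite /cone_section !minkE f11 f33 f13 f23 f21 f31 eBD.
  move: (- _ * _ / _) => nu.
  transitivity (eD * eD * (1 + y 0 1)); first by field.
  by rewrite eD1 mul1r.
split.
- split.
    by move=> h; move: y1; rewrite -aE h /mink !mxE !mul0r oppr0 !addr0 ltxx.
  rewrite /cone_section !minkE f11 f22 f33 f12 f13 f23 f21 f31 f32 eBD.
  move: (1 + y 0 1) yn0 => al al0.
  transitivity ((1 - eD * eD) * eT * y 0 0 ^+ 2); first by field.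
  by rewrite eD1 subrr !mul0r.
- by rewrite subr0 aE.
- apply: row2_ext; rewrite /Pc /affine_chart ?(vec2_0, vec2_1) ?aE; last by ring.
  rewrite /cone_section !minkE f22 f12 f32.
  by transitivity (eT * eT * y 0 0); [ring|rewrite eT1 mul1r].
Qed.

End FrameCharts.

Lemma frame_vector_neq0 (v : 'rV[R]_3) (ep : R) : ep * ep = 1 -> mink v v = ep -> v != 0.
Proof.
move=> ep1 vv; apply/eqP => v0; move: ep1; rewrite -vv v0 /mink !mxE !mul0r.
by rewrite oppr0 !addr0 mul0r => /esym/eqP; rewrite oner_eq0.
Qed.

Lemma nonsingular_moving (D T : R -> 'rV[R]_3) (dl : R -> R) (s0 : R) :
  is_derive s0 1 D (dl s0 *: T s0) -> T s0 != 0 -> nonsingular_at D s0 <-> dl s0 <> 0.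
Proof.
move=> dD T0; rewrite /nonsingular_at derive1E.
have [_ ->] := dD; split=> h h'; apply: h; first by rewrite h' scale0r.
by apply/eqP; move: h' => /eqP; rewrite scaler_eq0 (negbTE T0) orbF.
Qed.

(** * Singularities of curves carried by a moving frame *)

Section Moving.
Variables (I N : set R) (D T B : R -> 'rV[R]_3) (dl z : R -> R) (s0 : R) (eD eT eB : R).
Hypotheses (eD1 : eD * eD = 1) (eT1 : eT * eT = 1) (eB1 : eB * eB = 1).
Hypotheses (oN : open N) (N0 : N s0) (NI : N `<=` I).
Hypotheses (HD : smooth N D) (HT : smooth N T) (HB : smooth N B).
Hypotheses (Hdl : smooth N dl) (Hz : smooth N z).
Hypothesis fr : forall s, N s -> lorentz_frame (D s) (T s) (B s) eD eT eB.
Hypothesis dD : forall s, N s -> is_derive s 1 D (dl s *: T s).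
Hypothesis dB : forall s, N s -> is_derive s 1 B (z s *: T s).
Hypothesis z0 : z s0 != 0.

(** Differentiate [mink (T s) (E s) = 0]. For [E = B] and [E = D] this yields the components of [T']
    that decide the front condition. *)
Let orth_derive (E : R -> 'rV[R]_3) w : (forall s, N s -> mink (T s) (E s) = 0) ->
  is_derive s0 1 E (w *: T s0) -> mink (derive1 T s0) (E s0) = - (w * eT).
Proof.
move=> orth dE.
have H1 := is_derive_mink (smooth_is_derive HT N0) dE.
have H2 : is_derive s0 1 (fun s => mink (T s) (E s)) 0.
  apply: (@is_derive1_eq_near _ (fun=> 0)).
  have nN : nbhs s0 N by exact: open_nbhs_nbhs.
  by apply: (@filterS _ (nbhs s0) _ N _ _ nN) => s Ns; rewrite orth.
have := derive1_val H1; rewrite (derive1_val H2) minkZr.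
have [[_ -> _] _] := fr N0.
by move=> /esym/eqP; rewrite addr_eq0 => /eqP.
Qed.

Let TD s : N s -> mink (T s) (D s) = 0.
Proof. by move=> /fr[_ [h _ _]]; rewrite minkC. Qed.

Let TB s : N s -> mink (T s) (B s) = 0.
Proof. by move=> /fr[_ [_ _ h]]. Qed.

Lemma moving_frame_quadric :
  (nonsingular_at D s0 <-> dl s0 <> 0) /\
  (locally_diffeo_to_cusp I [set x | mink x x = eD] D s0 <->
    dl s0 = 0 /\ derive1 dl s0 <> 0).
Proof.
have fr0 := fr N0; have [[f11 f22 f33] [f12 f13 f23]] := fr0.
split; first by apply: nonsingular_moving (dD N0) _; exact: frame_vector_neq0 f22.
have DS s : N s -> [set x | mink x x = eD] (D s) by move=> /fr[[]].
have ODs0 : [set x | 0 < mink x (eD *: D s0) - 0] (D s0).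
  by rewrite /= minkZr f11 eD1 subr0.
have PD0 : affine_chart (eT *: T s0) (eB *: B s0) 0 0 (D s0) = 0.
  by apply: row2_ext; rewrite ?(vec2_0, vec2_1) mxE minkZr ?f12 ?f13 mulr0 subr0.
have T01 : mink (T s0) (eT *: T s0) != 0 by rewrite minkZr f22 eT1 oner_eq0.
have T02 : mink (T s0) (eB *: B s0) = 0 by rewrite minkZr f23 mulr0.
have eT0 : eT != 0 by apply/eqP => h; move: eT1; rewrite h mul0r => /esym/eqP; rewrite oner_eq0.
have eB0 : eB != 0 by apply/eqP => h; move: eB1; rewrite h mul0r => /esym/eqP; rewrite oner_eq0.
have T'02 : dl s0 = 0 -> mink (derive1 T s0) (eB *: B s0) != 0.
  by move=> _; rewrite minkZr (orth_derive TB (dB N0)) !(mulf_neq0, oppr_eq0).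
have oWd : open [set y | 0 < quadric_height eD eT eB y].
  by apply: open_positive; apply: smooth_quadric_height; exact: openT.
have Hs := smooth_quadric_section (D s0) (T s0) (B s0) eD eT eB.
have oO := @open_half_space (eD *: D s0) 0.
have CK := fun x (Sx : mink x x = eD) => quadric_chartK eD1 eT1 eB1 fr0 Sx.
have SK := quadric_sectionK eD1 eT1 eB1 fr0.
split=> [/(front_cusp_necessary oN N0 NI HD HT Hdl dD DS oO ODs0 oWd Hs CK SK PD0 T01 T02 T'02)|].
  by move=> [h1 /eqP h2].
move=> [h1 /eqP h2].
exact: (front_cusp_sufficient I oN N0 HD HT Hdl dD DS oO ODs0 oWd Hs CK SK PD0 T01 T02 T'02 h1 h2).
Qed.

Lemma moving_frame_cone : eB = - eD ->
  let L s := D s + B s in let dL s := dl s + z s in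
  (nonsingular_at L s0 <-> dL s0 <> 0) /\
  (locally_diffeo_to_cusp I (@LCstar R) L s0 <-> dL s0 = 0 /\ derive1 dL s0 <> 0).
Proof.
move=> eBD L dL.
have fr0 := fr N0; have [[f11 f22 f33] [f12 f13 f23]] := fr0.
have f21 : mink (T s0) (D s0) = 0 by rewrite minkC.
have f31 : mink (B s0) (D s0) = 0 by rewrite minkC.
have f32 : mink (B s0) (T s0) = 0 by rewrite minkC.
have dLs s : N s -> is_derive s 1 L (dL s *: T s).
  by move=> Ns; rewrite /dL scalerDl; apply: is_deriveD; [exact: dD|exact: dB].
split; first by apply: (@nonsingular_moving L T dL) (dLs _ N0) _; exact: frame_vector_neq0 f22.
have HL : smooth N L by exact: smoothD.
have HdL : smooth N dL by exact: smoothD.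
have eT0 : eT != 0 by apply/eqP => h; move: eT1; rewrite h mul0r => /esym/eqP; rewrite oner_eq0.
have eD0 : eD != 0 by apply/eqP => h; move: eD1; rewrite h mul0r => /esym/eqP; rewrite oner_eq0.
have LS s : N s -> @LCstar R (L s).
  move=> Ns; have [[g11 _ g33] [_ g13 _]] := fr Ns.
  split.
    move=> h; have : mink (L s) (D s) = 0 by rewrite h /mink !mxE !mul0r oppr0 !addr0.
    by rewrite minkDl g11 (minkC (B s)) g13 addr0; apply/eqP.
  by rewrite !minkE g11 g33 (minkC (B s)) g13 eBD; ring.
have aE : mink (L s0) ((eD / 2) *: (D s0 - B s0)) = 1.
  rewrite !minkE f11 f33 f13 f31 eBD.
  have -> : eD / 2 * (eD + 0 - (0 + - eD)) = eD * eD by field.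
  by rewrite eD1.
have ODs0 : [set x | 0 < mink x ((eD / 2) *: (D s0 - B s0)) - 0] (L s0).
  by rewrite /= aE subr0.
have PD0 : affine_chart (eT *: T s0) ((eD / 2) *: (D s0 - B s0)) 0 1 (L s0) = 0.
  apply: row2_ext; rewrite ?(vec2_0, vec2_1) mxE ?aE ?subrr //.
  by rewrite minkZr minkDl f12 f32 addr0 mulr0 subr0.
have T01 : mink (T s0) (eT *: T s0) != 0 by rewrite minkZr f22 eT1 oner_eq0.
have T02 : mink (T s0) ((eD / 2) *: (D s0 - B s0)) = 0.
  by rewrite !minkE f21 f23 oppr0 addr0 mulr0.
(* At a zero of [dl + z] one has [dl = - z]: the pairings of [T'] with [D] and with [B] are
   opposite, so that with [D - B] doubles one of them instead of vanishing. *)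
have T'02 : dL s0 = 0 -> mink (derive1 T s0) ((eD / 2) *: (D s0 - B s0)) != 0.
  move=> h; rewrite !minkE (orth_derive TB (dB N0)) (orth_derive TD (dD N0)).
  have -> : dl s0 = - z s0 by apply/eqP; rewrite -addr_eq0; apply/eqP.
  have -> : eD / 2 * (- (- z s0 * eT) - - (z s0 * eT)) = eD * (z s0 * eT) by field.
  by rewrite !mulf_neq0.
have oWd : open [set y : 'rV[R]_2 | 0 < 1 + y 0 1].
  apply: open_positive; apply: smoothD; [exact: openT|exact: smooth_cst|exact: smooth_coord].
have Hs := smooth_cone_section (D s0) (T s0) (B s0) eD eT.
have oO := @open_half_space ((eD / 2) *: (D s0 - B s0)) 0.
have CK := fun x (Sx : LCstar x) => cone_chartK eD1 eT1 eB1 fr0 eBD Sx.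
have SK := cone_sectionK eD1 eT1 fr0 eBD.
split=> [/(front_cusp_necessary oN N0 NI HL HT HdL dLs LS oO ODs0 oWd Hs CK SK PD0 T01 T02 T'02)|].
  by move=> [h1 /eqP h2].
move=> [h1 /eqP h2].
exact: (front_cusp_sufficient I oN N0 HL HT HdL dLs LS oO ODs0 oWd Hs CK SK PD0 T01 T02 T'02 h1 h2).
Qed.

End Moving.
End MovingFrames.

(** * Darboux frames *)

Section RotatedFrames.
Context {R : realType}.
Local Notation smooth := smooth_on_open.

(* [th] is the derivative of the circular or hyperbolic angle of the vector
   [(ka, ta)], whose norm is [rho]. *)
Lemma derive1_normalized (A : set R) (ka ta rho : R -> R) (s1 s2 : R) s : open A -> A s ->
  smooth A ka -> smooth A ta -> smooth A rho -> (forall s, A s -> rho s != 0) ->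
  (forall s, A s -> rho s ^+ 2 = s1 * ka s ^+ 2 + s2 * ta s ^+ 2) ->
  let th := (ka s * derive1 ta s - derive1 ka s * ta s) / rho s ^+ 2 in
  is_derive s 1 (fun s => (rho s)^-1 * ta s) (s1 * ((rho s)^-1 * ka s) * th) /\
  is_derive s 1 (fun s => (rho s)^-1 * ka s) (- s2 * ((rho s)^-1 * ta s) * th).
Proof.
move=> oA As Hka Hta Hrho rho0 rho2 th.
have dka := smooth_is_derive Hka As; have dta := smooth_is_derive Hta As.
have drho := smooth_is_derive Hrho As.
have H1 := is_derive1X 2 drho.
have H2 : is_derive s 1 (fun s => rho s ^+ 2)
    (s1 * (2%:R * ka s ^+ 1 * derive1 ka s) + s2 * (2%:R * ta s ^+ 1 * derive1 ta s)).
  apply: (@is_derive1_eq_near _ (fun s => s1 * ka s ^+ 2 + s2 * ta s ^+ 2)).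
    have nA : nbhs s A by exact: open_nbhs_nbhs.
    by apply: (@filterS _ (nbhs s) _ A _ _ nA) => t At; rewrite rho2.
  exact: is_derive1D (is_derive1Ml _ (is_derive1X 2 dka)) (is_derive1Ml _ (is_derive1X 2 dta)).
have E : rho s * derive1 rho s = s1 * ka s * derive1 ka s + s2 * ta s * derive1 ta s.
  by have := derive1_val H1; rewrite (derive1_val H2) /= !expr1; lra.
have r0 := rho0 _ As; have r2 := rho2 _ As.
have dV := is_derive1V r0 drho.
rewrite /th; move: (derive1 rho s) (derive1 ka s) (derive1 ta s) E dka dta dV => r' k' t' E dka dta dV.
have r'E : r' = (s1 * ka s * k' + s2 * ta s * t') / rho s.
  by rewrite -E mulrAC divff // mul1r.
split.
  apply: (is_derive_eq (is_derive1M dV dta)); rewrite r'E.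
  have -> : (rho s)^-1 * t' = t' * rho s ^+ 2 / rho s ^+ 3 by field.
  by rewrite [in X in _ + X]r2; field.
apply: (is_derive_eq (is_derive1M dV dka)); rewrite r'E.
have -> : (rho s)^-1 * k' = k' * rho s ^+ 2 / rho s ^+ 3 by field.
by rewrite [in X in _ + X]r2; field.
Qed.

Lemma is_derive_scale (f : R -> R) (g : R -> 'rV[R]_3) (s l : R) v :
  is_derive s 1 f l -> is_derive s 1 g v ->
  is_derive s 1 (fun s => f s *: g s) (l *: g s + f s *: v).
Proof.
move=> Hf /is_derive_row Hg; apply/is_derive_row => i.
have -> : (fun s => (f s *: g s) 0 i) = fun s => f s * g s 0 i.
  by apply/funext => t; rewrite mxE.
by apply: (is_derive_eq (is_derive1M Hf (Hg i))); rewrite !mxE.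
Qed.

Lemma is_derive_rowB (f g : R -> 'rV[R]_3) (s : R) u v :
  is_derive s 1 f u -> is_derive s 1 g v -> is_derive s 1 (fun s => f s - g s) (u - v).
Proof. by move=> Hf Hg; exact: is_deriveB. Qed.

Lemma smooth_rowB (A : set R) (f g : R -> 'rV[R]_3) : open A ->
  smooth A f -> smooth A g -> smooth A (fun s => f s - g s).
Proof.
move=> oA Hf Hg; apply: (@smooth_eq _ _ _ _ (fun s => f s + (-1) *: g s)) => //.
  by move=> s _; rewrite scaleN1r.
by apply: smoothD => //; apply: smoothZ => //; exact: smooth_cst.
Qed.

(** * Rectifying and osculating directions as moving frames *)

Section Darboux.
Variables (I : set R) (t n b : R -> 'rV[R]_3) (kn kg tau : R -> R).
Hypothesis oI : open I.
Hypotheses (Ht : smooth I t) (Hn : smooth I n) (Hb : smooth I b).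
Hypotheses (Hkn : smooth I kn) (Hkg : smooth I kg) (Htau : smooth I tau).
Hypothesis fr : forall s, I s -> lorentz_frame (t s) (n s) (b s) 1 (-1) 1.
Hypothesis dt : forall s, I s -> is_derive s 1 t (kn s *: n s + kg s *: b s).
Hypothesis dn : forall s, I s -> is_derive s 1 n (kn s *: t s + tau s *: b s).
Hypothesis db : forall s, I s -> is_derive s 1 b (- kg s *: t s + tau s *: n s).

Variables (N : set R) (rho dl : R -> R) (s0 : R).
Hypotheses (oN : open N) (N0 : N s0) (NI : N `<=` I).
Hypotheses (Hrho : smooth N rho) (rho0 : forall s, N s -> rho s != 0).

Let subN (V : normedModType R) (f : R -> V) : smooth I f -> smooth N f.
Proof. exact: smooth_sub. Qed.

Definition rectifying_direction s := (rho s)^-1 *: (tau s *: t s - kg s *: n s).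

Definition osculating_direction s := (rho s)^-1 *: (tau s *: t s - kn s *: b s).

(** [TR] is [b'] divided by [rho], just as [TO] is [n'] divided by [rho]; this is the relation
    [B' = rho T] of the moving frame. *)
Let TR s := (rho s)^-1 *: (tau s *: n s - kg s *: t s).

Let TO s := (rho s)^-1 *: (kn s *: t s + tau s *: b s).

Let smooth_comb (f g : R -> R) (u v : R -> 'rV[R]_3) :
  smooth I f -> smooth I g -> smooth I u -> smooth I v ->
  smooth N (fun s => (rho s)^-1 *: (f s *: u s - g s *: v s)).
Proof.
move=> Hf Hg Hu Hv; apply: smoothZ => //; first exact: smoothV.
by apply: smooth_rowB => //; apply: smoothZ => //; exact: subN.
Qed.

(** The sign [ep] is the causal character of the direction: [-1] in the timelike case, where
    [rho ^ 2] is [kg ^ 2 - tau ^ 2], and [1] in the spacelike case, where it is the opposite. *)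
Lemma rectifying_frame ep : ep * ep = 1 ->
  (forall s, N s -> rho s ^+ 2 = - ep * kg s ^+ 2 + ep * tau s ^+ 2) ->
  (forall s, N s -> dl s = kn s + ep *
    ((kg s * derive1 tau s - derive1 kg s * tau s) / rho s ^+ 2)) ->
  [/\ smooth N rectifying_direction, smooth N TR,
    forall s, N s -> lorentz_frame (rectifying_direction s) (TR s) (b s) ep (- ep) 1,
    forall s, N s -> is_derive s 1 rectifying_direction (dl s *: TR s) &
    forall s, N s -> is_derive s 1 b (rho s *: TR s)].
Proof.
move=> ep1 rho2 dlE; split.
- exact: smooth_comb.
- exact: smooth_comb.
- move=> s Ns; have r0 := rho0 Ns; have r2 := rho2 _ Ns.
  have [[f11 f22 f33] [f12 f13 f23]] := fr (NI Ns).
  have f21 : mink (n s) (t s) = 0 by rewrite minkC.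
  have key : (rho s)^-1 ^+ 2 * (tau s ^+ 2 - kg s ^+ 2) = ep.
    have -> : tau s ^+ 2 - kg s ^+ 2 = ep * rho s ^+ 2.
      by rewrite r2 mulrDr !mulrA mulrN ep1; ring.
    by field.
  rewrite /rectifying_direction /TR; split; split; rewrite ?minkE ?f11 ?f22 ?f33 ?f12 ?f13 ?f23 ?f21.
  + by rewrite -[RHS]key; ring.
  + by rewrite -[in RHS]key; ring.
  + by [].
  + by ring.
  + by ring.
  + by ring.
- move=> s Ns; have r0 := rho0 Ns; have Is := NI Ns.
  have [h1 h2] := derive1_normalized oN Ns (subN Hkg) (subN Htau) Hrho rho0 rho2.
  have -> : rectifying_direction = fun s => ((rho s)^-1 * tau s) *: t s - ((rho s)^-1 * kg s) *: n s.
    by apply/funext => u; rewrite /rectifying_direction scalerBr !scalerA.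
  apply: (is_derive_eq (is_derive_rowB (is_derive_scale h1 (dt Is)) (is_derive_scale h2 (dn Is)))).
  rewrite dlE // /TR; move: (_ / rho s ^+ 2) => th.
  by apply/rowP => i; rewrite !mxE; ring.
- move=> s Ns; apply: (is_derive_eq (db (NI Ns))); rewrite /TR scalerA divff ?scale1r; last exact: rho0.
  by rewrite scaleNr addrC.
Qed.

Lemma osculating_frame :
  (forall s, N s -> rho s ^+ 2 = kn s ^+ 2 + tau s ^+ 2) ->
  (forall s, N s -> dl s = kg s +
    (kn s * derive1 tau s - derive1 kn s * tau s) / rho s ^+ 2) ->
  [/\ smooth N osculating_direction, smooth N TO,
    forall s, N s -> lorentz_frame (osculating_direction s) (TO s) (n s) 1 1 (-1),
    forall s, N s -> is_derive s 1 osculating_direction (dl s *: TO s) &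
    forall s, N s -> is_derive s 1 n (rho s *: TO s)].
Proof.
move=> rho2 dlE; split.
- exact: smooth_comb.
- apply: smoothZ => //; first exact: smoothV.
  by apply: smoothD => //; apply: smoothZ => //; exact: subN.
- move=> s Ns; have r0 := rho0 Ns; have r2 := rho2 _ Ns.
  have [[f11 f22 f33] [f12 f13 f23]] := fr (NI Ns).
  have f31 : mink (b s) (t s) = 0 by rewrite minkC.
  have f32 : mink (b s) (n s) = 0 by rewrite minkC.
  have key : (rho s)^-1 ^+ 2 * (kn s ^+ 2 + tau s ^+ 2) = 1 by rewrite -r2; field.
  rewrite /osculating_direction /TO; split; split;
    rewrite ?minkE ?f11 ?f22 ?f33 ?f12 ?f13 ?f23 ?f31 ?f32.
  + by rewrite -[RHS]key; ring.
  + by rewrite -[RHS]key; ring.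
  + by [].
  + by ring.
  + by ring.
  + by ring.
- move=> s Ns; have r0 := rho0 Ns; have Is := NI Ns.
  have rho2' : forall s, N s -> rho s ^+ 2 = 1 * kn s ^+ 2 + 1 * tau s ^+ 2.
    by move=> u Nu; rewrite !mul1r rho2.
  have [h1 h2] := derive1_normalized oN Ns (subN Hkn) (subN Htau) Hrho rho0 rho2'.
  have -> : osculating_direction = fun s => ((rho s)^-1 * tau s) *: t s - ((rho s)^-1 * kn s) *: b s.
    by apply/funext => u; rewrite /osculating_direction scalerBr !scalerA.
  apply: (is_derive_eq (is_derive_rowB (is_derive_scale h1 (dt Is)) (is_derive_scale h2 (db Is)))).
  rewrite dlE // /TO; move: (_ / rho s ^+ 2) => th.
  by apply/rowP => i; rewrite !mxE; ring.
- move=> s Ns; apply: (is_derive_eq (dn (NI Ns))).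
  by rewrite /TO scalerA divff ?scale1r //; exact: rho0.
Qed.

End Darboux.
End RotatedFrames.

(** * Unit normal and Darboux equations of a curve on a spacelike surface *)

Section SurfaceCurves.
Context {R : realType}.
Local Notation smooth := smooth_on_open.

Lemma mink_wedge (a b : 'rV[R]_3) :
  mink (wedge a b) (wedge a b) = mink a b ^+ 2 - mink a a * mink b b.
Proof. by rewrite /wedge /mink !mxE /=; ring. Qed.

Lemma mink_wedgel (a b : 'rV[R]_3) : mink (wedge a b) a = 0.
Proof. by rewrite /wedge /mink !mxE /=; ring. Qed.

Lemma mink_wedger (a b : 'rV[R]_3) : mink (wedge a b) b = 0.
Proof. by rewrite /wedge /mink !mxE /=; ring. Qed.

Lemma smooth_wedge (V : normedModType R) (A : set V) (f g : V -> 'rV[R]_3) : open A ->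
  smooth A f -> smooth A g -> smooth A (fun x => wedge (f x) (g x)).
Proof.
move=> oA Hf Hg.
have Hf' := proj1 (smooth_row _ oA) Hf; have Hg' := proj1 (smooth_row _ oA) Hg.
have M i j k l : smooth A (fun x => f x 0 i * g x 0 j - f x 0 k * g x 0 l).
  exact: smoothB oA (smoothM oA (Hf' i) (Hg' j)) (smoothM oA (Hf' k) (Hg' l)).
by apply: smooth_vec3 => //; apply: smoothN.
Qed.

Variables (U : set 'rV[R]_2) (X : 'rV[R]_2 -> 'rV[R]_3).
Hypothesis hX : spacelike_surface U X.

Let oU : open U. Proof. by case: hX. Qed.

Let HX : smooth U X. Proof. by case: hX => _ []. Qed.

Let X1 := 'D_(delta_mx 0 0) X.
Let X2 := 'D_(delta_mx 0 1) X.

Lemma tangent_basis u v : U u -> 'D_v X u = v 0 0 *: X1 u + v 0 1 *: X2 u.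
Proof.
move=> Uu; have dX := smooth_differentiable HX Uu.
rewrite /X1 /X2 !deriveE // [in LHS](row_basis v) linear_sum big_ord_recl big_ord1.
by rewrite (_ : lift ord0 ord0 = 1 :> 'I_2) ?linearZ //; exact: val_inj.
Qed.

Lemma tangent_spacelike u v : U u -> v != 0 -> 0 < mink ('D_v X u) ('D_v X u).
Proof. by move=> Uu /eqP v0; case: hX => _ _ /(_ u v Uu v0) []. Qed.

Let w u := wedge (X1 u) (X2 u).

(* Gram determinant of the spacelike tangent plane. *)
Lemma normal_timelike u : U u -> mink (w u) (w u) < 0.
Proof.
move=> Uu; have sp v0 v1 : (v0 != 0) || (v1 != 0) ->
    0 < v0 ^+ 2 * mink (X1 u) (X1 u) + 2 * v0 * v1 * mink (X1 u) (X2 u) + v1 ^+ 2 * mink (X2 u) (X2 u).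
  move=> v; have : vec2 v0 v1 != 0.
    apply: contraTN v => /eqP h; rewrite negb_or !negbK.
    have := congr1 (fun y : 'rV[R]_2 => y 0 0) h; have := congr1 (fun y : 'rV[R]_2 => y 0 1) h.
    by rewrite vec2_0 vec2_1 !mxE => -> ->; rewrite eqxx.
  move=> /(tangent_spacelike Uu); rewrite (tangent_basis _ Uu) vec2_0 vec2_1.
  move: (X1 u) (X2 u) => a b; rewrite !minkE (minkC b).
  by congr (_ < _); ring.
rewrite /w mink_wedge.
have := sp 1 0; rewrite oner_eq0 => /(_ isT).
(* On the vector with coordinates [(- F, E)] the first fundamental form takes the value
   [E * (E * G - F ^ 2)]. *)
have := sp (- mink (X1 u) (X2 u)) (mink (X1 u) (X1 u)).
move: (X1 u) (X2 u) => a b; move: (mink a b) (mink a a) (mink b b) => F E G H.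
rewrite expr1n expr0n /= !mul1r !mul0r !mulr0 mul0r !addr0 => E0.
have := H; rewrite (gt_eqF E0) orbT => /(_ isT).
have -> : (- F) ^+ 2 * E + 2 * - F * E * F + E ^+ 2 * G = E * (E * G - F ^+ 2) by ring.
by rewrite pmulr_rgt0 // => h; lra.
Qed.

Let n0 u := (mnorm (w u))^-1 *: w u.

Let mnorm_w u : U u -> mnorm (w u) = Num.sqrt (- mink (w u) (w u)).
Proof. by move=> Uu; rewrite /mnorm ltr0_norm // normal_timelike. Qed.

Let n0_unit u : U u -> mink (n0 u) (n0 u) = -1.
Proof.
move=> Uu; have h := normal_timelike Uu; rewrite /n0 !minkE mnorm_w //.
have s2 := sqr_sqrtr (ltW (_ : 0 < - mink (w u) (w u))).
have {}s2 : Num.sqrt (- mink (w u) (w u)) ^+ 2 = - mink (w u) (w u).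
  by apply: s2; rewrite oppr_gt0.
have r0 : Num.sqrt (- mink (w u) (w u)) != 0 by rewrite gt_eqF // sqrtr_gt0 oppr_gt0.
move: (Num.sqrt _) r0 s2 => r r0 s2.
have -> : mink (w u) (w u) = - r ^+ 2 by rewrite s2 opprK.
by field.
Qed.

Let unit_normalE u : unit_normal X u = if mink (n0 u) (delta_mx 0 0) < 0 then n0 u else - n0 u.
Proof. by []. Qed.

Lemma unit_normal_unit u : U u -> mink (unit_normal X u) (unit_normal X u) = -1.
Proof.
move=> Uu; rewrite unit_normalE; case: ifP => _; first exact: n0_unit.
by rewrite minkNl minkNr opprK n0_unit.
Qed.

Lemma unit_normal_orth u v : U u -> mink (unit_normal X u) ('D_v X u) = 0.
Proof.
move=> Uu; have h : mink (w u) ('D_v X u) = 0.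
  rewrite (tangent_basis _ Uu) /w; move: (X1 u) (X2 u) => a b.
  by rewrite !minkE mink_wedgel mink_wedger !mulr0 addr0.
by rewrite unit_normalE; case: ifP => _; rewrite ?minkNl /n0 minkZl h mulr0 ?oppr0.
Qed.

(** The time component of a unit timelike vector never vanishes, so the sign chosen in [unit_normal]
    is locally constant. *)
Lemma smooth_unit_normal : smooth U (unit_normal X).
Proof.
have Hw : smooth U w.
  by apply: smooth_wedge => //; exact: smooth_derive.
have Hww : smooth U (fun u => - mink (w u) (w u)).
  by apply: smoothN => //; exact: smooth_mink.
have Hn0 : smooth U n0.
  apply: smoothZ => //.
  apply: (@smooth_eq _ _ _ _ (fun u => (Num.sqrt (- mink (w u) (w u)))^-1)) => //.
    by move=> u Uu; rewrite mnorm_w.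
  apply: smoothV => //.
    by move=> u Uu; rewrite gt_eqF // sqrtr_gt0 oppr_gt0 normal_timelike.
  by apply: smooth_sqrt => // u Uu; rewrite oppr_gt0 normal_timelike.
have Hh : smooth U (fun u => mink (n0 u) (delta_mx 0 0)).
  by apply: smooth_mink => //; exact: smooth_cst.
have h0 u : U u -> mink (n0 u) (delta_mx 0 0) != 0.
  move=> /n0_unit; move: (n0 u) => v vv; apply: contra_eq_neq vv => h.
  have v0 : v 0 0 = 0 by move: h; rewrite /mink !mxE /=; lra.
  rewrite /mink v0 mul0r oppr0 add0r gt_eqF //.
  by have := sqr_ge0 (v 0 1); have := sqr_ge0 (v 0 2); rewrite !expr2; lra.
apply: smooth_local => u Uu; have [lt|ge] := ltP (mink (n0 u) (delta_mx 0 0)) 0.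
  pose A := U `&` (fun u => mink (n0 u) (delta_mx 0 0)) @^-1` [set r | r < 0].
  have oA : open A by apply: open_smooth_preimage => //; exact: open_lt.
  exists A => //; apply: (@smooth_eq _ _ _ _ n0) => //.
    by move=> y [_ /= h]; rewrite unit_normalE h.
  by apply: smooth_sub Hn0 => y [].
have gt : 0 < mink (n0 u) (delta_mx 0 0) by rewrite lt_neqAle ge eq_sym h0.
pose A := U `&` (fun u => mink (n0 u) (delta_mx 0 0)) @^-1` [set r | 0 < r].
have oA : open A by apply: open_smooth_preimage => //; exact: open_gt.
exists A => //; apply: (@smooth_eq _ _ _ _ (fun u => (-1) *: n0 u)) => //.
  by move=> y [_ /= h]; rewrite unit_normalE ltNge (ltW h) scaleN1r.
apply: smoothZ => //; first exact: smooth_cst.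
by apply: smooth_sub Hn0 => y [].
Qed.

Variables (I : set R) (c : R -> 'rV[R]_2).
Hypothesis oI : open I.
Hypothesis hc : curve_in U I c.
Hypothesis hunit : forall s, I s -> mnorm (derive1 (X \o c) s) = 1.

Let Hc : smooth I c. Proof. by case: hc. Qed.

Let cU s : I s -> U (c s). Proof. by case: hc => _ h _; exact: h. Qed.

Let t := darboux_t X c.
Let n := darboux_n X c.
Let b := darboux_b X c.

Lemma smooth_darboux : [/\ smooth I t, smooth I n & smooth I b].
Proof.
have Ht : smooth I t by apply: smooth_derive1; exact: smooth_comp_row Hc HX.
have Hn : smooth I n by exact: smooth_comp_row Hc smooth_unit_normal.
by split => //; exact: smooth_wedge.
Qed.

Lemma smooth_curvatures :
  [/\ smooth I (kappa_n X c), smooth I (kappa_g X c) & smooth I (tau_g X c)].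
Proof.
have [Ht Hn Hb] := smooth_darboux.
split.
- by apply: smoothN => //; apply: smooth_mink => //; exact: smooth_derive1.
- by apply: smooth_mink => //; exact: smooth_derive1.
- by apply: smoothN => //; apply: smooth_mink => //; exact: smooth_derive1.
Qed.

Lemma darboux_tE s : I s -> t s = 'D_(derive1 c s) X (c s).
Proof.
move=> Is; have dc := smooth_differentiable Hc Is.
have dX := smooth_differentiable HX (cU Is).
rewrite /t /darboux_t !derive1E' //; last exact: differentiable_comp.
by rewrite diff_comp //= deriveE.
Qed.

Lemma darboux_frame s : I s -> lorentz_frame (t s) (n s) (b s) 1 (-1) 1.
Proof.
move=> Is; have Us := cU Is.
have c'0 : derive1 c s != 0 by case: hc => _ _ h; apply/eqP; exact: h.
have tn : mink (t s) (n s) = 0 by rewrite darboux_tE // minkC unit_normal_orth.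
have nn : mink (n s) (n s) = -1 by exact: unit_normal_unit.
have tt : mink (t s) (t s) = 1.
  have tp : 0 < mink (t s) (t s) by rewrite darboux_tE //; exact: tangent_spacelike.
  have := hunit Is; rewrite -/(t s) /mnorm (gtr0_norm tp) => h.
  by rewrite -[LHS](sqr_sqrtr (ltW tp)) h expr1n.
split; split=> //; rewrite /b /darboux_b -/(t s) -/(n s).
- by rewrite mink_wedge tt nn tn expr0n /= sub0r mul1r opprK.
- by rewrite minkC mink_wedgel.
- by rewrite minkC mink_wedger.
Qed.

(** Differentiated constancy of [mink f g]: it leaves three independent coefficients in the frame
    equations, namely the three curvatures. *)
Let skew (f g : R -> 'rV[R]_3) k s : smooth I f -> smooth I g ->
  (forall s, I s -> mink (f s) (g s) = k) -> I s ->
  mink (derive1 f s) (g s) = - mink (derive1 g s) (f s).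
Proof.
move=> Hf Hg fg Is.
have H := is_derive_mink (smooth_is_derive Hf Is) (smooth_is_derive Hg Is).
have H2 : is_derive s 1 (fun s => mink (f s) (g s)) 0.
  apply: (@is_derive1_eq_near _ (fun=> k)).
  have nI : nbhs s I by exact: open_nbhs_nbhs.
  by apply: (@filterS _ (nbhs s) _ I _ _ nI) => u Iu; rewrite fg.
have := derive1_val H; rewrite (derive1_val H2) (minkC (f s)) => /esym/eqP.
by rewrite addr_eq0 => /eqP.
Qed.

Let skew0 (f : R -> 'rV[R]_3) k s : smooth I f ->
  (forall s, I s -> mink (f s) (f s) = k) -> I s -> mink (derive1 f s) (f s) = 0.
Proof. by move=> Hf ff Is; have := skew Hf Hf ff Is; lra. Qed.

Let one2 : (1 : R) * 1 = 1. Proof. by rewrite mulr1. Qed.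

Let mone2 : (-1 : R) * -1 = 1. Proof. by rewrite mulrNN mulr1. Qed.

Let expand s x : I s ->
  x = mink x (t s) *: t s - mink x (n s) *: n s + mink x (b s) *: b s.
Proof.
move=> Is.
have := lorentz_frame_expand x one2 mone2 one2 (darboux_frame Is).
by rewrite !mul1r mulN1r scaleNr.
Qed.

Lemma darboux_equations s : I s ->
  [/\ is_derive s 1 t (kappa_n X c s *: n s + kappa_g X c s *: b s),
      is_derive s 1 n (kappa_n X c s *: t s + tau_g X c s *: b s) &
      is_derive s 1 b (- kappa_g X c s *: t s + tau_g X c s *: n s)].
Proof.
move=> Is; have [Ht Hn Hb] := smooth_darboux.
have tt u : I u -> mink (t u) (t u) = 1 by move=> /darboux_frame[[]].
have nn u : I u -> mink (n u) (n u) = -1 by move=> /darboux_frame[[]].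
have bb u : I u -> mink (b u) (b u) = 1 by move=> /darboux_frame[[]].
have nt u : I u -> mink (n u) (t u) = 0 by move=> /darboux_frame[_ [h _ _]]; rewrite minkC.
have bt u : I u -> mink (b u) (t u) = 0 by move=> /darboux_frame[_ [_ h _]]; rewrite minkC.
have nb u : I u -> mink (n u) (b u) = 0 by move=> /darboux_frame[_ [_ _ h]].
rewrite /kappa_n /kappa_g /tau_g -/t -/b -/(n s).
split.
- apply: (is_derive_eq (smooth_is_derive Ht Is)).
  by rewrite [LHS](expand _ Is) (skew0 Ht tt Is) scale0r sub0r scaleNr.
- apply: (is_derive_eq (smooth_is_derive Hn Is)).
  rewrite [LHS](expand _ Is) (skew0 Hn nn Is) scale0r subr0.
  by rewrite (skew Hn Ht nt Is) (skew Hn Hb nb Is).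
- apply: (is_derive_eq (smooth_is_derive Hb Is)).
  by rewrite [LHS](expand _ Is) (skew0 Hb bb Is) scale0r addr0 (skew Hb Ht bt Is) !scaleNr.
Qed.

End SurfaceCurves.

(** * The five evolute-type curves of a unit speed curve *)

Unset Implicit Arguments.

Theorem theorem3p1 (R : realType) (U : set 'rV[R]_2)
    (X : 'rV[R]_2 -> 'rV[R]_3) (I : set R) (c : R -> 'rV[R]_2) (s0 : R)
    (hX : spacelike_surface U X)
    (hI : open_interval I)
    (hc : curve_in U I c)
    (hunit : forall s, I s -> mnorm (derive1 (X \o c) s) = 1)
    (ht' : forall s, I s -> mnorm (derive1 (darboux_t X c) s) <> 0)
    (hb' : forall s, I s -> mnorm (derive1 (darboux_b X c) s) <> 0)
    (hs0 : I s0) :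
  [/\ (* A *)
      tau_g X c s0 ^+ 2 < kappa_g X c s0 ^+ 2 ->
        (nonsingular_at (DTr X c) s0 <-> deltaTr X c s0 <> 0) /\
        (locally_diffeo_to_cusp I (@H2 R) (DTr X c) s0 <->
          deltaTr X c s0 = 0 /\ derive1 (deltaTr X c) s0 <> 0),
      (* B *)
      kappa_g X c s0 ^+ 2 < tau_g X c s0 ^+ 2 ->
        (nonsingular_at (DSr X c) s0 <-> deltaSr X c s0 <> 0) /\
        (locally_diffeo_to_cusp I (@S21 R) (DSr X c) s0 <->
          deltaSr X c s0 = 0 /\ derive1 (deltaSr X c) s0 <> 0),
      (* C *)
      tau_g X c s0 ^+ 2 < kappa_g X c s0 ^+ 2 ->
        (nonsingular_at (DLr X c) s0 <-> deltaLr X c s0 <> 0) /\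
        (locally_diffeo_to_cusp I (@LCstar R) (DLr X c) s0 <->
          deltaLr X c s0 = 0 /\ derive1 (deltaLr X c) s0 <> 0),
      (* D *)
      (forall s, I s -> (kappa_n X c s, tau_g X c s) <> (0, 0)) ->
        (nonsingular_at (DSo X c) s0 <-> deltaSo X c s0 <> 0) /\
        (locally_diffeo_to_cusp I (@S21 R) (DSo X c) s0 <->
          deltaSo X c s0 = 0 /\ derive1 (deltaSo X c) s0 <> 0) &
      (* E *)
      (forall s, I s -> (kappa_n X c s, tau_g X c s) <> (0, 0)) ->
        (nonsingular_at (DLo X c) s0 <-> deltaLo X c s0 <> 0) /\
        (locally_diffeo_to_cusp I (@LCstar R) (DLo X c) s0 <->
          deltaLo X c s0 = 0 /\ derive1 (deltaLo X c) s0 <> 0)].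
Proof.
have oI : open I by case: hI.
have [Ht Hn Hb] := smooth_darboux hX oI hc.
have [Hkn Hkg Htau] := smooth_curvatures hX oI hc.
have fr := @darboux_frame R U X hX I c hc hunit.
have dfr := @darboux_equations R U X hX I c oI hc hunit.
have dt s (Is : I s) : is_derive s 1 (darboux_t X c) _ := let: And3 h _ _ := dfr s Is in h.
have dn s (Is : I s) : is_derive s 1 (darboux_n X c) _ := let: And3 _ h _ := dfr s Is in h.
have db s (Is : I s) : is_derive s 1 (darboux_b X c) _ := let: And3 _ _ h := dfr s Is in h.
have one2 : (1 : R) * 1 = 1 by rewrite mulr1.
have mone2 : (-1 : R) * -1 = 1 by rewrite mulrNN mulr1.
have mmone2 : (- -1 : R) * - -1 = 1 by rewrite opprK mulr1.
have Hk2 (f : R -> R) : smooth_on_open I f -> smooth_on_open I (fun s => f s ^+ 2).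
  by move=> Hf; exact: smoothX.
have Hkg2 := Hk2 _ Hkg; have Htau2 := Hk2 _ Htau; have Hkn2 := Hk2 _ Hkn.
have num (k : R -> R) : smooth_on_open I k ->
    smooth_on_open I (fun s => k s * derive1 (tau_g X c) s - derive1 k s * tau_g X c s).
  move=> Hk; have H1 := smoothM oI Hk (smooth_derive1 Htau).
  exact: smoothB oI H1 (smoothM oI (smooth_derive1 Hk) Htau).
(* In (A), (B) and (C) the inequality is given at [s0] only; the frame is built on the open set
   where the radicand stays positive. *)
have pos_set (q : R -> R) : smooth_on_open I q -> exists N : set R,
    [/\ open N, N `<=` I, forall s, N s -> 0 < q s & forall s, I s -> 0 < q s -> N s].
  move=> Hq; exists (I `&` q @^-1` [set r | 0 < r]); split.
  - by apply: open_smooth_preimage => //; exact: open_gt.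
  - by move=> s [].
  - by move=> s [].
  - by move=> s Is qs; split.
(* One frame serves both statements: (A) concerns its first vector, (C) the null sum of that vector
   with [b]. Its coefficient [rho] is the square root by which [deltaLr] exceeds [deltaTr]. *)
have A_and_C : tau_g X c s0 ^+ 2 < kappa_g X c s0 ^+ 2 ->
   ((nonsingular_at (DTr X c) s0 <-> deltaTr X c s0 <> 0) /\
        (locally_diffeo_to_cusp I (@H2 R) (DTr X c) s0 <->
          deltaTr X c s0 = 0 /\ derive1 (deltaTr X c) s0 <> 0)) /\
   ((nonsingular_at (DLr X c) s0 <-> deltaLr X c s0 <> 0) /\
        (locally_diffeo_to_cusp I (@LCstar R) (DLr X c) s0 <->
          deltaLr X c s0 = 0 /\ derive1 (deltaLr X c) s0 <> 0)).
  move=> lt.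
  have Hq : smooth_on_open I (fun s => kappa_g X c s ^+ 2 - tau_g X c s ^+ 2) by exact: smoothB.
  have [N [oN NI qpos posN]] := pos_set _ Hq.
  have N0 : N s0 by apply: posN => //; rewrite subr_gt0.
  have HqN := smooth_sub NI Hq.
  pose rho s := Num.sqrt (kappa_g X c s ^+ 2 - tau_g X c s ^+ 2).
  have Hrho : smooth_on_open N rho by exact: smooth_sqrt.
  have rho0 s : N s -> rho s != 0 by move=> /qpos h; rewrite gt_eqF // sqrtr_gt0.
  have rho2 s : N s -> rho s ^+ 2 = kappa_g X c s ^+ 2 - tau_g X c s ^+ 2.
    by move=> /qpos h; rewrite sqr_sqrtr // ltW.
  have Hdl : smooth_on_open N (deltaTr X c).
    have Hqi := smoothV oN (fun s Ns => lt0r_neq0 (qpos s Ns)) HqN.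
    exact: smoothB oN (smooth_sub NI Hkn) (smoothM oN (smooth_sub NI (num _ Hkg)) Hqi).
  have rho2' s : N s -> rho s ^+ 2 = - -1 * kappa_g X c s ^+ 2 + -1 * tau_g X c s ^+ 2.
    by move=> Ns; rewrite rho2 // opprK mul1r mulN1r.
  have dlE s : N s -> deltaTr X c s = kappa_n X c s + -1 *
      ((kappa_g X c s * derive1 (tau_g X c) s - derive1 (kappa_g X c) s * tau_g X c s) / rho s ^+ 2).
    by move=> Ns; rewrite rho2 // mulN1r.
  have [HD HT frN dD dB] := rectifying_frame Ht Hn Hkg Htau fr dt dn db
    oN NI Hrho rho0 mone2 rho2' dlE.
  have HbN := smooth_sub NI Hb.
  split.
    exact: (moving_frame_quadric mone2 mmone2 one2 oN N0 NI HD HT Hdl frN dD dB (rho0 _ N0)).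
  have eBD : (1 : R) = - -1 by rewrite opprK.
  exact: (moving_frame_cone mone2 mmone2 one2 oN N0 NI HD HT HbN Hdl Hrho frN dD dB (rho0 _ N0) eBD).
have D_and_E : (forall s, I s -> (kappa_n X c s, tau_g X c s) <> (0, 0)) ->
   ((nonsingular_at (DSo X c) s0 <-> deltaSo X c s0 <> 0) /\
        (locally_diffeo_to_cusp I (@S21 R) (DSo X c) s0 <->
          deltaSo X c s0 = 0 /\ derive1 (deltaSo X c) s0 <> 0)) /\
   ((nonsingular_at (DLo X c) s0 <-> deltaLo X c s0 <> 0) /\
        (locally_diffeo_to_cusp I (@LCstar R) (DLo X c) s0 <->
          deltaLo X c s0 = 0 /\ derive1 (deltaLo X c) s0 <> 0)).
  move=> nz.
  have Hq : smooth_on_open I (fun s => kappa_n X c s ^+ 2 + tau_g X c s ^+ 2) by exact: smoothD.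
  have qpos s : I s -> 0 < kappa_n X c s ^+ 2 + tau_g X c s ^+ 2.
    move=> /nz h; rewrite lt_neqAle addr_ge0 ?sqr_ge0 // andbT eq_sym.
    rewrite paddr_eq0 ?sqr_ge0 // !sqrf_eq0; apply/negP => /andP[/eqP h1 /eqP h2].
    by apply: h; rewrite h1 h2.
  pose rho s := Num.sqrt (kappa_n X c s ^+ 2 + tau_g X c s ^+ 2).
  have Hrho : smooth_on_open I rho by exact: smooth_sqrt.
  have rho0 s : I s -> rho s != 0 by move=> /qpos h; rewrite gt_eqF // sqrtr_gt0.
  have rho2 s : I s -> rho s ^+ 2 = kappa_n X c s ^+ 2 + tau_g X c s ^+ 2.
    by move=> /qpos h; rewrite sqr_sqrtr // ltW.
  have Hdl : smooth_on_open I (deltaSo X c).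
    have Hqi := smoothV oI (fun s Is => lt0r_neq0 (qpos s Is)) Hq.
    exact: smoothD oI Hkg (smoothM oI (num _ Hkn) Hqi).
  have dlE s : I s -> deltaSo X c s = kappa_g X c s +
      (kappa_n X c s * derive1 (tau_g X c) s - derive1 (kappa_n X c) s * tau_g X c s) / rho s ^+ 2.
    by move=> Is; rewrite rho2.
  have II : I `<=` I by [].
  have [HD HT frN dD dB] := osculating_frame Ht Hb Hkn Htau fr dt dn db
    oI II Hrho rho0 rho2 dlE.
  split.
    exact: (moving_frame_quadric one2 one2 mone2 oI hs0 II HD HT Hdl frN dD dB (rho0 _ hs0)).
  exact: (moving_frame_cone one2 one2 mone2 oI hs0 II HD HT Hn Hdl Hrho frN dD dB (rho0 _ hs0) erefl).
split.
- by move=> /A_and_C[].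
- move=> lt.
  have Hq : smooth_on_open I (fun s => tau_g X c s ^+ 2 - kappa_g X c s ^+ 2) by exact: smoothB.
  have [N [oN NI qpos posN]] := pos_set _ Hq.
  have N0 : N s0 by apply: posN => //; rewrite subr_gt0.
  have HqN := smooth_sub NI Hq.
  pose rho s := Num.sqrt (tau_g X c s ^+ 2 - kappa_g X c s ^+ 2).
  have Hrho : smooth_on_open N rho by exact: smooth_sqrt.
  have rho0 s : N s -> rho s != 0 by move=> /qpos h; rewrite gt_eqF // sqrtr_gt0.
  have rho2 s : N s -> rho s ^+ 2 = tau_g X c s ^+ 2 - kappa_g X c s ^+ 2.
    by move=> /qpos h; rewrite sqr_sqrtr // ltW.
  have Hdl : smooth_on_open N (deltaSr X c).
    have Hqi := smoothV oN (fun s Ns => lt0r_neq0 (qpos s Ns)) HqN.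
    exact: smoothD oN (smooth_sub NI Hkn) (smoothM oN (smooth_sub NI (num _ Hkg)) Hqi).
  have rho2' s : N s -> rho s ^+ 2 = - 1 * kappa_g X c s ^+ 2 + 1 * tau_g X c s ^+ 2.
    by move=> Ns; rewrite rho2 // mulN1r mul1r addrC.
  have dlE s : N s -> deltaSr X c s = kappa_n X c s + 1 *
      ((kappa_g X c s * derive1 (tau_g X c) s - derive1 (kappa_g X c) s * tau_g X c s) / rho s ^+ 2).
    by move=> Ns; rewrite rho2 // mul1r.
  have [HD HT frN dD dB] := rectifying_frame Ht Hn Hkg Htau fr dt dn db
    oN NI Hrho rho0 one2 rho2' dlE.
  exact: (moving_frame_quadric one2 mone2 one2 oN N0 NI HD HT Hdl frN dD dB (rho0 _ N0)).
- by move=> /A_and_C[].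
- by move=> /D_and_E[].
- by move=> /D_and_E[].
Qed.
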